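(* Almost surely, for any compact subset $K$ of $(c',c)$, $$\lim_{n\to\infty}\ \sup_{k:\ (k/\log n)\in K}\left|\frac{U_k(n)}{\mathbb{E}(U_k(n))}-\mathcal{M}_\infty\Big(\frac{k}{2\log n}\Big)\right|=0 .$$
   Context: Let $\mathbb{U}=\{\emptyset\}\cup\bigcup_{n\ge1}\{0,1\}^n$ be the set of finite words on $\{0,1\}$; $|u|$ denotes the length (depth) of $u$. A complete binary tree is a finite subset $T\subset\mathbb{U}$ such that $\emptyset\in T$; $uv\in T\Rightarrow u\in T$; $u1\in T\Leftrightarrow u0\in T$. Its leaves, forming the set $\partial T$, are the nodes of $T$ with no strict descendants in $T$. The binary search tree (BST) process $(\mathcal{T}_n)_{n\ge0}$ under the random permutation model is the Markov chain on complete binary trees with $\mathcal{T}_0=\{\emptyset\}$ and $\mathcal{T}_{n+1}=\mathcal{T}_n\cup\{D_n0,D_n1\}$, where conditionally on the past $D_n$ is uniform on the $n+1$ leaves $\partial\mathcal{T}_n$. Profile: $U_k(n):=\#\{u\in\partial\mathcal{T}_n: |u|=k\}$ for integers $k\ge1$. BST martingale: $\mathcal{M}_n(z):=\frac1{C_n(z)}\sum_{u\in\partial\mathcal{T}_n}z^{|u|}$ with $C_0(z)=1$, $C_n(z)=\prod_{k=0}^{n-1}\frac{k+2z}{k+1}$. Let $\eta_2(x)=x\log\frac x2-x+2$, $x\ge0$; $c'<c$ are the two solutions of $\eta_2(x)=1$ ($c'=0.3733\ldots$, $c=4.31107\ldots$). Almost surely $\mathcal{M}_n(z)$ converges uniformly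 on compact subsets of $z\in(c'/2,c/2)$; $\mathcal{M}_\infty(z)$ denotes the resulting (random) limit function on $(c'/2,c/2)$. A supremum over an empty set of indices $k$ is taken to be $0$. *)

(* Defs.v *)
From HB Require Import structures.
From mathcomp Require Import all_boot all_order all_algebra finmap.
From mathcomp Require Import all_classical all_reals all_analysis.

Set Implicit Arguments.
Unset Strict Implicit.
Unset Printing Implicit Defensive.

Import Order.TTheory GRing.Theory Num.Theory.
Import numFieldNormedType.Exports.

Local Open Scope classical_set_scope.
Local Open Scope ring_scope.

(* Finite words on {0,1}, with false for the letter 0 and true for 1.  The
   depth of u is [size u], and u0, u1 are [rcons u false], [rcons u true]. *)
Definition word := seq bool.

Definition complete_tree (t : {fset word}) : Prop :=
  [/\ [::] \in t,
      forall u v : word, u ++ v \in t -> u \in t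
    & forall u : word, rcons u true \in t <-> rcons u false \in t].

Definition leaves (t : {fset word}) : {fset word} :=
  [fset u in t | all (fun v : word => prefix u v ==> (v == u)) t]%fset.

(* [T n] is the tree at time n and [D n] the leaf at which it is grown. *)
Record BST_process (d : measure_display) (Omega : measurableType d)
    (R : realType) (P : probability Omega R)
    (T : nat -> Omega -> {fset word}) (D : nat -> Omega -> word) : Prop := {
  BST_measurable : forall n u, measurable (D n @^-1` [set u]);
  BST_complete : forall n w, complete_tree (T n w);
  BST_init : forall w, T 0%N w = [fset [::]]%fset;
  BST_step : forall n w,
    T n.+1 w = (T n w `|` [fset rcons (D n w) false; rcons (D n w) true])%fset;
  (* Conditionally on (T 0, ..., T n) = (t 0, ..., t n), D n is uniform on the
     leaves of t n.  The conditional probability is cleared of its denominator,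
     so that histories t of probability 0 need no separate treatment. *)
  BST_uniform : forall n (t : nat -> {fset word}) (u : word),
    let past := [set w | forall i, (i <= n)%N -> T i w = t i] in
    P (past `&` (D n @^-1` [set u])) =
    (P past * (if u \in leaves (t n)
               then (#|` leaves (t n)|%:R)^-1 else 0)%:E)%E
}.

Section Functionals.
Context (R : realType) (Omega : Type) (T : nat -> Omega -> {fset word}).

(* U_k(n), as a real-valued random variable *)
Definition profile (k n : nat) (w : Omega) : R :=
  (#|` [fset u in leaves (T n w) | size u == k]%fset|)%:R.

Definition BST_norm (n : nat) (z : R) : R :=
  \prod_(0 <= k < n) ((k%:R + 2 * z) / k.+1%:R).

Definition BST_martingale (n : nat) (z : R) (w : Omega) : R :=
  (BST_norm n z)^-1 * \sum_(u <- leaves (T n w)) z ^+ size u.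

(* The value is unspecified when the sequence diverges. *)
Definition BST_limit (z : R) (w : Omega) : R :=
  limn (fun n => BST_martingale n z w).

End Functionals.

Arguments profile R {Omega} T k n w.

(* Only meant for x >= 0; since [ln 0 = 0], eta2 0 = 2, which is also the limit
   of eta2 at 0. *)
Definition eta2 (R : realType) (x : R) : R := x * ln (x / 2) - x + 2.

(* Main.v *)
Require Import Defs.
From HB Require Import structures.
From mathcomp Require Import all_boot all_order all_algebra finmap.
From mathcomp Require Import all_classical all_reals all_analysis.
From mathcomp Require Import ring lra zify.

Set Implicit Arguments.
Unset Strict Implicit.
Unset Printing Implicit Defensive.

Import Order.TTheory GRing.Theory Num.Theory.
Import numFieldNormedType.Exports.

Local Open Scope classical_set_scope.
Local Open Scope ring_scope.

(** Growing a tree with n + 1 leaves at a uniform leaf multiplies the mean of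
    the sum of z^|u| over its leaves u by (n + 2 z) / (n + 1).  Hence the mean
    profile E U_k(n) is the coefficient of X^k in [growth 0 n], the product of
    the factors (i + 2 X) / (i + 1) for i < n, whose value at z is C_n(z).  More
    generally, E(U_k(n) | T_m) is the sum over the leaves u of T_m of the
    coefficient of X^(k - |u|) in [growth m n]; this is [cond_profile].

    Fix z = k / (2 ln n) and let m be a large fixed power of ln n.  The theorem
    is the chain of approximations
      U_k(n) / E U_k(n) ~ cond_profile n k m / E U_k(n) ~ M_m(z) ~ M_oo(z),
    each of them uniform in k.

    The first one is a concentration bound.  In m, [cond_profile n k m] is a
    martingale, and its jump when T_t grows at the leaf u is at most a constant
    times z^|u| / C_t(z), measured in units of C_n(z) / z^k
    ([profile_weight_le]).  The hypothesis on k enters here: c' < 2 z < c means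
    that eta2 (2 z) < 1 ([eta2_lt1]), that is, the derivative at p = 1 of
    (2 z^p - 1) / p is negative, so that (2 z^p - 1) / p < 2 z - 1 for some p in
    ]1, 2] ([gap_pos_exponent]); the difference is [gap].  By the maximal
    inequality ([ville]), the sum of z^(p |u|) over the leaves of T_t is almost
    surely at most B C_t(z^p), for some B and all t.  Then the largest z^|u| and
    the l^2 norm of (z^|u|)_u, both bounded by the l^p norm, are at most
    (B C_t(z^p))^(1/p), and C_t(x) has order t^(2 x - 1), so that the jumps
    decay like t^(- gap).  An exponential supermartingale turns this into
    deviations of order m^(- gap / 2), up to a factor ln n, with an exceptional
    probability of order n^-6 ([profile_deviation]); Borel and Cantelli then
    treat all m and k at once ([ae_profile_deviation]).

    These deviations are measured in units of C_n(z) / z^k, which bounds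
    E U_k(n) from above; it exceeds E U_k(n) by a factor O(ln n) at most
    ([mean_profile_ge]).  Indeed inequalities of Newton type between the
    elementary symmetric functions of the 2 / i and their power sums show that
    consecutive coefficients of [growth m n] have nearly the ratios of an
    exponential series.  The power m of ln n is chosen so that m^(gap / 2) is
    about (ln n)^4, which absorbs these losses.

    The second approximation uses the same ratios: lowering the index k by d
    multiplies the coefficient of [growth m n] by nearly z^d, uniformly over the
    depths d of the leaves of T_m, which are O(ln ln n)
    ([cond_profile_ratio]).

    For the third one, M_n(z) - M_m(z) is the sum over k of z^k / C_n(z) times
    U_k(n) - cond_profile n k m.  Bounding the latter with one parameter zp
    slightly larger than z makes this sum geometric, and M_n is uniformly
    Cauchy with a rate that is a power of m ([martingale_uniform]).

    All of this takes place in a small neighbourhood of each point of ]c', c[;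
    compactness of segments gives the theorem. *)

(** * Coefficients of the generating polynomial of the mean profile *)
Section Norm.
Context {R : realType}.
Implicit Types (m n l : nat) (z : R).

Definition growth_factor (i : nat) : {poly R} :=
  (i.+1%:R^-1)%:P * (i%:R%:P + 2%:P * 'X).

Definition growth (m n : nat) : {poly R} := \prod_(m <= i < n) growth_factor i.

Definition harm (n : nat) : R := \sum_(0 <= i < n) (i.+1%:R)^-1.

Lemma harm_ge0 n : 0 <= harm n.
Proof. by rewrite /harm sumr_ge0// => i _; rewrite invr_ge0. Qed.

Lemma horner_factor i z : (growth_factor i).[z] = (i%:R + 2 * z) / i.+1%:R.
Proof. by rewrite /growth_factor !hornerE mulrC. Qed.

Lemma horner_growth m n z :
  (growth m n).[z] = \prod_(m <= i < n) ((i%:R + 2 * z) / i.+1%:R).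
Proof. by rewrite horner_prod; apply: eq_bigr => i _; rewrite horner_factor. Qed.

Lemma horner_growth0 n z : (growth 0 n).[z] = BST_norm n z.
Proof. exact: horner_growth. Qed.

Lemma growthnn n : growth n n = 1.
Proof. by rewrite /growth big_geq. Qed.

Lemma growth_cat m t n : (m <= t)%N -> (t <= n)%N ->
  growth m n = growth m t * growth t n.
Proof. by move=> mt tn; rewrite /growth (big_cat_nat mt tn). Qed.

Lemma growthSr m n : (m <= n)%N -> growth m n.+1 = growth m n * growth_factor n.
Proof. by move=> mn; rewrite /growth big_nat_recr. Qed.

Lemma growthSl m n : (m < n)%N -> growth m n = growth_factor m * growth m.+1 n.
Proof. by move=> mn; rewrite /growth big_ltn. Qed.

Lemma growth_factorM i (p : {poly R}) : growth_factor i * p =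
  (i.+1%:R^-1)%:P * (i%:R%:P * p + 2%:P * ('X * p)).
Proof. by rewrite /growth_factor -!mulrA mulrDl -!mulrA. Qed.

Lemma coef_factorM0 i (p : {poly R}) :
  (growth_factor i * p)`_0 = i%:R / i.+1%:R * p`_0.
Proof.
rewrite growth_factorM coefCM coefD !coefCM coefXM /=.
by rewrite mulr0 addr0 mulrA (mulrC _^-1).
Qed.

Lemma coef_factorMS i (p : {poly R}) l :
  (growth_factor i * p)`_l.+1 = (i%:R * p`_l.+1 + 2 * p`_l) / i.+1%:R.
Proof. by rewrite growth_factorM coefCM coefD !coefCM coefXM /= mulrC. Qed.

Lemma coef_growth_ge0 m n l : 0 <= (growth m n)`_l.
Proof.
elim: n l => [|n IHn] l.
  by rewrite /growth big_geq// coef1; case: (l == _); rewrite ?ler01.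
case: (leqP m n) => mn; last by rewrite /growth big_geq// coef1; case: (l == _); rewrite ?ler01.
rewrite growthSr// mulrC; case: l => [|l].
  by rewrite coef_factorM0 mulr_ge0// divr_ge0.
by rewrite coef_factorMS divr_ge0// addr_ge0// mulr_ge0.
Qed.

Lemma horner_growth_gt0 m n z : 0 < z -> 0 < (growth m n).[z].
Proof.
move=> z0; rewrite horner_growth; apply: prodr_gt0 => i _.
by rewrite divr_gt0// ltr_wpDl// mulr_gt0.
Qed.

Lemma size_growth m n : (size (growth m n) <= (n - m).+1)%N.
Proof.
elim: n => [|n IHn]; first by rewrite /growth big_geq// size_poly1.
case: (leqP m n) => mn; last by rewrite /growth big_geq// size_poly1.
rewrite growthSr// (leq_trans (size_polyMleq _ _))//.
have : (size (growth_factor n) <= 2)%N.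
  rewrite /growth_factor (leq_trans (size_polyMleq _ _))//.
  have h1 := size_polyC_leq1 (n.+1%:R^-1 : R).
  have h2 : (size (n%:R%:P + 2%:P * 'X : {poly R})%R <= 2)%N.
    rewrite (leq_trans (size_polyD _ _))// geq_max (leq_trans (size_polyC_leq1 _))//=.
    rewrite (leq_trans (size_polyMleq _ _))// size_polyX addn2 /=.
    by rewrite ltnS size_polyC_leq1.
  by move: (leq_add h1 h2); case: (_ + _)%N.
by move=> h; move: (leq_add IHn h); rewrite subSn// addn2; case: (_ + _)%N.
Qed.

Lemma horner_growthE m n N z : (n - m <= N)%N ->
  (growth m n).[z] = \sum_(0 <= l < N.+1) (growth m n)`_l * z ^+ l.
Proof.
move=> nN; rewrite (@horner_coef_wide _ N.+1) ?big_mkord//.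
by rewrite (leq_trans (size_growth m n)).
Qed.

Lemma coef_growth_le m n l z : 0 <= z ->
  (growth m n)`_l * z ^+ l <= (growth m n).[z].
Proof.
move=> z0; rewrite (@horner_growthE _ _ (maxn (n - m) l)) ?leq_maxl//.
rewrite (bigD1_seq l) ?iota_uniq//=; last by rewrite mem_index_iota ltnS leq_maxr.
rewrite lerDl sumr_ge0// => i _.
by rewrite mulr_ge0 ?coef_growth_ge0 ?exprn_ge0.
Qed.

(** Up to the constant factor m / n, [growth m n] with 0 < m <= n is the product of
    the 1 + (2 / i) X, so its coefficients are proportional to the elementary
    symmetric functions of the numbers 2 / i, m <= i < n, whose first two power
    sums are the following. *)
Definition psum1 m n : R := \sum_(m <= i < n) 2 / i%:R.
Definition psum2 m n : R := \sum_(m <= i < n) (2 / i%:R) ^+ 2.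

(** This inequality and [coef_growth_newton_ge] truncate Newton's identity
      (l + 1) e_(l+1) = p_1 e_l - p_2 e_(l-1) + p_3 e_(l-2) - ...
    after one and after two terms. *)
Lemma coef_growth_newton m n l : (0 < m)%N ->
  l.+1%:R * (growth m n)`_l.+1 <= psum1 m n * (growth m n)`_l.
Proof.
move=> m0; elim: n l => [|n IHn] l.
  by rewrite /growth /psum1 !big_geq// coef1 mulr0 mul0r.
case: (leqP m n) => mn; last by rewrite /growth /psum1 !big_geq// coef1 mulr0 mul0r.
have n0 : (0 < n%:R :> R) by rewrite ltr0n (leq_trans m0 mn).
rewrite growthSr// /psum1 big_nat_recr//= -/(psum1 m n) mulrC [in leRHS]mulrC.
set p := growth m n in IHn *.
rewrite (mulrC p) coef_factorMS mulrAC.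
have nn : (0 < n.+1%:R :> R) by [].
case: l => [|l].
  rewrite coef_factorM0 mulr1 (mulrAC n%:R) [leRHS]mulrAC ler_pM2r ?invr_gt0//.
  have := IHn 0%N; rewrite mul1r => h.
  suff : n%:R * p`_1 <= n%:R * (psum1 m n * p`_0).
    move=> h1; have -> : (n%:R * p`_0) * (psum1 m n + 2 / n%:R) = n%:R * (psum1 m n * p`_0) + 2 * p`_0.
      by field; rewrite gt_eqF.
    lra.
  by rewrite ler_pM2l.
rewrite coef_factorMS [leRHS]mulrAC ler_pM2r ?invr_gt0//.
have h1 := IHn l; have h2 := IHn l.+1.
have h3 : n%:R * (l.+2%:R * p`_l.+2) <= n%:R * (psum1 m n * p`_l.+1) by rewrite ler_pM2l.
have h4 : 2 * p`_l * (2 / n%:R) >= 0 by rewrite !mulr_ge0 ?coef_growth_ge0 ?invr_ge0 ?ltW.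
have -> : (n%:R * p`_l.+1 + 2 * p`_l) * (psum1 m n + 2 / n%:R) =
  n%:R * (psum1 m n * p`_l.+1) + 2 * (psum1 m n * p`_l) + 2 * p`_l.+1 + 2 * p`_l * (2 / n%:R).
  by field; rewrite gt_eqF.
move: h1 h3 h4; rewrite (natrD _ 1 l.+1); lra.
Qed.

Lemma coef_growth_newton0 m n : (0 < m)%N ->
  (growth m n)`_1 = psum1 m n * (growth m n)`_0.
Proof.
move=> m0; elim: n => [|n IHn].
  by rewrite /growth /psum1 !big_geq// coef1 mul0r.
case: (leqP m n) => mn; last by rewrite /growth /psum1 !big_geq// coef1 mul0r.
have n0 : (0 < n%:R :> R) by rewrite ltr0n (leq_trans m0 mn).
rewrite growthSr// /psum1 big_nat_recr//= -/(psum1 m n) mulrC.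
rewrite coef_factorMS coef_factorM0 IHn; field.
by rewrite nat1r (gt_eqF n0) pnatr_eq0.
Qed.

Lemma coef_growth_newton_ge m n l : (0 < m)%N ->
  psum1 m n * (growth m n)`_l.+1 - psum2 m n * (growth m n)`_l
  <= l.+2%:R * (growth m n)`_l.+2.
Proof.
move=> m0; elim: n l => [|n IHn] l.
  by rewrite /growth /psum1 /psum2 !big_geq// !coef1 /= mulr0 !mul0r subr0.
case: (leqP m n) => mn; last first.
  by rewrite /growth /psum1 /psum2 !big_geq// !coef1 /= mulr0 !mul0r subr0.
have n0 : (0 < n%:R :> R) by rewrite ltr0n (leq_trans m0 mn).
rewrite growthSr// /psum1 /psum2 !big_nat_recr//= -/(psum1 m n) -/(psum2 m n).
set p := growth m n in IHn *.
have nn : (0 < n.+1%:R :> R) by [].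
rewrite (mulrC p) (coef_factorMS _ _ l.+1) (coef_factorMS _ _ l).
have h3 : n%:R * (psum1 m n * p`_l.+1 - psum2 m n * p`_l) <= n%:R * (l.+2%:R * p`_l.+2).
  by rewrite ler_pM2l.
case: l h3 => [|l] h3.
  rewrite coef_factorM0 !mulrA ler_pdivlMr// mulrBl !divfK ?gt_eqF//.
  rewrite (mulrAC _ _^-1) divfK ?gt_eqF// coef_growth_newton0// in h3 *.
  rewrite -subr_ge0 in h3; rewrite -subr_ge0; apply: le_trans h3 _; rewrite le_eqVlt; apply/orP; left; apply/eqP.
  rewrite expr2; field; rewrite gt_eqF//.
rewrite (coef_factorMS _ _ l) !mulrA ler_pdivlMr// mulrBl !divfK ?gt_eqF//.
have h1 := IHn l; have h4 := coef_growth_ge0 m n l.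
rewrite -subr_ge0 in h3; rewrite -subr_ge0 in h1; rewrite -subr_ge0.
have h5 : 0 <= 2 * p`_l * (2 / n%:R) ^+ 2 by rewrite !mulr_ge0// exprn_ge0// divr_ge0// ltW.
apply: le_trans (addr_ge0 h3 (addr_ge0 (mulr_ge0 (ler0n _ 2) h1) h5)) _.
rewrite le_eqVlt; apply/orP; left; apply/eqP.
rewrite (natrD _ 1 l.+2) expr2; field; rewrite gt_eqF//.
Qed.

(** The squares (2 / i)^2 are dominated by the telescoping differences of
    4 / (i - 1/2), and the first of these terms is at most 8. *)
Lemma psum2_le m n : (0 < m)%N -> psum2 m n <= 8.
Proof.
move=> m0; case: (leqP m n) => mn; last by rewrite /psum2 big_geq ?ler0n 1?ltnW.
suff h : psum2 m n <= 8 - 4 / (n%:R - 2^-1).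
  have n1 : 1 <= n%:R :> R by rewrite ler1n (leq_trans m0).
  apply: le_trans h _; rewrite lerBlDr lerDl divr_ge0//; lra.
elim: n mn => [|n IHn] mn; first by move: m0; rewrite lt0n -leqn0 mn.
move: mn; rewrite leq_eqVlt => /orP[/eqP <-|].
  rewrite /psum2 big_geq// subr_ge0 ler_pdivrMr.
    have : 1 <= m%:R :> R by rewrite ler1n.
    lra.
  have : 1 <= m%:R :> R by rewrite ler1n.
  lra.
rewrite ltnS => mn; rewrite /psum2 big_nat_recr//= -/(psum2 m n).
have n1 : 1 <= n%:R :> R by rewrite ler1n (leq_trans m0).
apply: le_trans (lerD (IHn mn) (lexx _)) _.
rewrite -(natr1 n).
have -> : (2 / n%:R) ^+ 2 = 4 / n%:R ^+ 2 :> R by field; lra.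
suff : 4 / n%:R ^+ 2 <= 4 / (n%:R - 2^-1) - 4 / (n%:R + 1 - 2^-1) :> R by lra.
have -> : 4 / (n%:R - 2^-1) - 4 / (n%:R + 1 - 2^-1) = 4 / (n%:R ^+ 2 - 4^-1) :> R.
  by field; apply/andP; split; [|apply/andP; split]; rewrite gt_eqF//; nra.
rewrite ler_pM2l// lef_pV2 ?posrE; nra.
Qed.

Lemma ln_succ_le i : (0 < i)%N -> ln (i.+1%:R : R) - ln i%:R <= i%:R^-1.
Proof.
move=> i0; rewrite -ln_div ?posrE ?ltr0n//.
have -> : i.+1%:R / i%:R = 1 + i%:R^-1 :> R.
  by rewrite -natr1; field; rewrite pnatr_eq0 -lt0n.
by apply: le_ln1Dx; rewrite (lt_trans (ltrN10 _))// invr_gt0 ltr0n.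
Qed.

Lemma ln_succ_ge i : (0 < i)%N -> (i.+1%:R : R)^-1 <= ln (i.+1%:R : R) - ln i%:R.
Proof.
move=> i0; rewrite -lerN2 opprB -ln_div ?posrE ?ltr0n//.
have -> : i%:R / i.+1%:R = 1 + (- i.+1%:R^-1) :> R.
  by rewrite -natr1; field; rewrite natr1 pnatr_eq0.
apply: le_ln1Dx; rewrite ltrN2 invf_lt1 ?ltr0n// ltr1n ltnS//.
Qed.

Lemma harm_le n : harm n <= 1 + ln n%:R.
Proof.
case: n => [|n]; first by rewrite /harm big_geq// ln0 ?addr0 ?lexx.
elim: n => [|n IHn]; first by rewrite /harm big_nat1 ln1 invr1 addr0.
rewrite /harm big_nat_recr//= -/(harm n.+1).
move: IHn (@ln_succ_ge n.+1 isT).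
by move: (ln _) (ln _) (_^-1) => a b c; lra.
Qed.

Lemma harm_ge n : ln n.+1%:R <= harm n.
Proof.
elim: n => [|n IHn]; first by rewrite /harm big_geq// ln1.
rewrite /harm big_nat_recr//= -/(harm n).
move: IHn (@ln_succ_le n.+1 isT).
by move: (ln _) (ln _) (_^-1) => a b c; lra.
Qed.

Lemma harm_mono m n : (m <= n)%N -> harm m <= harm n.
Proof.
move=> mn; rewrite /harm [leRHS](big_cat_nat (leq0n m) mn)/= lerDl.
by rewrite sumr_ge0// => i _; rewrite invr_ge0.
Qed.

Lemma psum1_ge m n : (0 < m)%N -> (m <= n)%N -> 2 * (ln n%:R - ln m%:R) <= psum1 m n.
Proof.
move=> m0; elim: n => [|n IHn] mn; first by move: m0; rewrite lt0n -leqn0 mn.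
move: mn; rewrite leq_eqVlt => /orP[/eqP <-|].
  by rewrite /psum1 big_geq// subrr mulr0.
rewrite ltnS => mn; rewrite /psum1 big_nat_recr//= -/(psum1 m n).
have := IHn mn; have := @ln_succ_le n (leq_trans m0 mn); lra.
Qed.

Lemma psum1_le m n : (0 < m)%N -> (m <= n)%N ->
  psum1 m n <= 2 * (m%:R^-1 + ln n%:R - ln m%:R).
Proof.
move=> m0 mn; suff : psum1 m n <= 2 * (m%:R^-1 - n%:R^-1 + ln n%:R - ln m%:R).
  have : 0 <= n%:R^-1 :> R by rewrite invr_ge0.
  lra.
elim: n mn => [|n IHn] mn; first by move: m0; rewrite lt0n -leqn0 mn.
move: mn; rewrite leq_eqVlt => /orP[/eqP <-|].
  by rewrite /psum1 big_geq//; lra.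
rewrite ltnS => mn; rewrite /psum1 big_nat_recr//= -/(psum1 m n).
move: (IHn mn) (@ln_succ_ge n (leq_trans m0 mn)).
by move: (ln n.+1%:R) (n.+1%:R^-1) => a b; lra.
Qed.

(** Starting at m >= 2 removes the additive constant of [psum1_le], because
    1 / m <= ln m; this keeps [psum1 m n - 8 * r] below 2 ln n. *)
Lemma psum1_le_ln m n : (1 < m)%N -> (m <= n)%N -> psum1 m n <= 2 * ln n%:R.
Proof.
move=> m1 mn; apply: le_trans (psum1_le (ltnW m1) mn) _.
suff : m%:R^-1 <= ln m%:R :> R by lra.
have m0 : 0 < m%:R :> R by rewrite ltr0n ltnW.
have h : ln (m%:R^-1) <= m%:R^-1 - 1 :> R.
  rewrite -[X in ln X](subrKC 1); apply: le_ln1Dx.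
  by rewrite ltrBrDl subrr invr_gt0.
rewrite lnV ?posrE// in h.
have h2 : m%:R^-1 <= 2^-1 :> R by rewrite lef_pV2 ?posrE// ler_nat.
lra.
Qed.

(** If coefficients up to l + 1 grow at least like those of an exponential
    series with parameter q, then e_l <= r e_(l+1) for l + 1 <= r q, and the
    second term p_2 e_l of Newton's identity is at most 8 r e_(l+1): this is why
    q is [psum1 m n - 8 * r], the value that the induction reproduces. *)
Lemma coef_growth_ratio m n (r : R) l : (0 < m)%N ->
  let q := psum1 m n - 8 * r in 0 <= r -> 0 < q -> l.+1%:R <= r * q ->
  q * (growth m n)`_l <= l.+1%:R * (growth m n)`_l.+1.
Proof.
move=> m0 q r0 q0; elim: l => [|l IHl] lq.
  rewrite mul1r coef_growth_newton0// ler_wpM2r ?coef_growth_ge0// /q; lra.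
have l1 : l.+1%:R <= r * q by apply: le_trans lq; rewrite ler_nat.
apply: le_trans (coef_growth_newton_ge n l m0).
have h : (growth m n)`_l <= r * (growth m n)`_l.+1.
  rewrite -(ler_pM2l q0) (le_trans (IHl l1))// mulrA (mulrC q).
  by rewrite ler_wpM2r// coef_growth_ge0.
have h2 := ler_wpM2r (coef_growth_ge0 m n l) (psum2_le n m0).
rewrite /q; nra.
Qed.

Lemma coef_growth_back m n (r : R) k j : (0 < m)%N -> (j <= k)%N ->
  let q := psum1 m n - 8 * r in 0 <= r -> 0 < q -> k%:R <= r * q ->
  q ^+ j * (growth m n)`_(k - j) <= k%:R ^+ j * (growth m n)`_k.
Proof.
move=> m0 jk q r0 q0 kq; elim: j jk => [|j IHj] jk.
  by rewrite subn0 !expr0.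
apply: le_trans (_ : k%:R * (q ^+ j * (growth m n)`_(k - j)) <= _); last first.
  by rewrite exprS -mulrA ler_wpM2l// IHj// ltnW.
rewrite exprSr -mulrA [leRHS]mulrCA ler_wpM2l ?exprn_ge0 ?(ltW q0)//.
have e : (k - j.+1).+1 = (k - j)%N by lia.
have := @coef_growth_ratio m n r (k - j.+1) m0 r0 q0; rewrite e => h.
have kj : (k - j)%:R <= k%:R :> R by rewrite ler_nat leq_subr.
apply: le_trans (h _) _; first exact: le_trans kj _.
by rewrite ler_wpM2r// coef_growth_ge0.
Qed.

Lemma coef_growth_front m n k j : (0 < m)%N -> (j <= k)%N ->
  (k ^_ j)%:R * (growth m n)`_k <= psum1 m n ^+ j * (growth m n)`_(k - j).
Proof.
move=> m0; elim: j => [|j IHj] jk; first by rewrite subn0 ffactn0 expr0.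
have p0 : 0 <= psum1 m n by rewrite /psum1 sumr_ge0// => i _; rewrite divr_ge0.
have e : (k - j.+1).+1 = (k - j)%N by lia.
rewrite ffactnSr natrM exprSr -mulrA mulrCA.
apply: le_trans (_ : (k - j)%:R * (psum1 m n ^+ j * (growth m n)`_(k - j)) <= _).
  by rewrite ler_wpM2l// IHj// ltnW.
rewrite -mulrA [leLHS]mulrCA ler_wpM2l ?exprn_ge0//.
by have := coef_growth_newton n (k - j.+1) m0; rewrite e.
Qed.

(** The falling factorial k (k - 1) ... (k - j + 1) is at least
    k^j (1 - j^2 / k); the inequality is multiplied by k. *)
Lemma ffact_ge (k j : nat) : (j <= k)%N ->
  (k%:R : R) ^+ j * (k%:R - j%:R ^+ 2) <= k%:R * (k ^_ j)%:R.
Proof.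
elim: j => [|j IHj] jk; first by rewrite expr0 expr0n/= subr0 mul1r ffactn0 mulr1.
rewrite ffactnSr natrM mulrA (natrB _ (ltnW jk)).
have kj : 0 <= k%:R - j%:R :> R by rewrite subr_ge0 ler_nat ltnW.
apply: le_trans (ler_wpM2r kj (IHj (ltnW jk))).
rewrite exprSr -!mulrA ler_wpM2l ?exprn_ge0// -natr1.
have h0 : 0 <= j%:R :> R by []. have h1 : 0 <= k%:R :> R by [].
have h2 : 0 <= (j%:R ^+ 3 : R) by rewrite exprn_ge0.
rewrite !exprS expr0 in h2 *; nra.
Qed.

Lemma coef_growth_fact_up m n k j : (0 < m)%N ->
  (k + j)`!%:R * (growth m n)`_(k + j) <= psum1 m n ^+ j * (k`!%:R * (growth m n)`_k).
Proof.
move=> m0; elim: j => [|j IHj]; first by rewrite addn0 expr0 mul1r.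
have p0 : 0 <= psum1 m n by rewrite /psum1 sumr_ge0// => i _; rewrite divr_ge0.
rewrite addnS factS mulnC natrM exprS -!mulrA.
apply: le_trans (ler_wpM2l _ (coef_growth_newton _ _ m0)) _ => //.
by rewrite mulrCA ler_wpM2l.
Qed.

Lemma coef_growth_fact_down m n (r : R) k j : (0 < m)%N -> (j <= k)%N ->
  let q := psum1 m n - 8 * r in 0 <= r -> 0 < q -> k%:R <= r * q ->
  q ^+ j * ((k - j)`!%:R * (growth m n)`_(k - j)) <= k`!%:R * (growth m n)`_k.
Proof.
move=> m0 jk q r0 q0 kq; elim: j jk => [|j IHj] jk.
  by rewrite subn0 expr0 mul1r.
apply: le_trans (IHj (ltnW jk)).
rewrite exprSr -mulrA ler_wpM2l ?exprn_ge0 ?(ltW q0)// mulrCA.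
have e : (k - j.+1).+1 = (k - j)%N by lia.
have kj : (k - j)%:R <= k%:R :> R by rewrite ler_nat leq_subr.
have := @coef_growth_ratio m n r (k - j.+1) m0 r0 q0; rewrite e => h.
have -> : (k - j)`! = ((k - j.+1)`! * (k - j))%N by rewrite -{1}e factS e mulnC.
rewrite natrM -mulrA ler_wpM2l//; apply: h; exact: le_trans kj _.
Qed.

Lemma sum_exp_coeff_le (x : R) N : 0 <= x ->
  \sum_(0 <= l < N) x ^+ l / l`!%:R <= expR x.
Proof.
move=> x0; rewrite /expR.
have := @nondecreasing_cvgn_le R (series (exp_coeff x)) _ (is_cvg_series_exp_coeff x) N.
apply; apply: nondecreasing_series => n _.
by rewrite /exp_coeff/= divr_ge0// exprn_ge0.
Qed.

(** The factor k, instead of the sharp square root of k, costs a factor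
    sqrt (ln n) in [mean_profile_ge]; it makes the induction elementary. *)
Lemma fact_le_stirling k : (0 < k)%N ->
  (k`!%:R : R) <= expR 1 * k%:R * (k%:R ^+ k * expR (- k%:R)).
Proof.
elim: k => // -[_ _|k IHk _].
  by rewrite mulr1 expr1n mul1r -expRD subrr expR0.
rewrite factS natrM; apply: le_trans (ler_wpM2l _ (IHk isT)) _ => //.
set a : R := k.+1%:R; set b : R := k.+2%:R.
have ab : b = a + 1 by rewrite /a /b -natr1.
have a0 : 0 < a by rewrite /a ltr0n.
have b0 : 0 < b by lra.
have -> : b * (expR 1 * a * (a ^+ k.+1 * expR (- a))) =
  b * expR 1 * expR (- b) * (expR 1 * a ^+ k.+2).
  have e1 : expR 1 * expR (- 1) = 1 :> R by rewrite -expRD subrr expR0.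
  transitivity (b * (expR 1 * a * (a ^+ k.+1 * expR (- a))) * (expR 1 * expR (- 1))).
    by rewrite e1 mulr1.
  have eb : expR (- b) = expR (- a) * expR (- 1) by rewrite -expRD ab opprD.
  by rewrite eb (exprS _ k.+1); ring.
have -> : expR 1 * b * (b ^+ k.+2 * expR (- b)) = b * expR 1 * expR (- b) * b ^+ k.+2.
  by ring.
rewrite ler_wpM2l ?mulr_ge0 ?expR_ge0 ?(ltW b0)//.
rewrite -ler_pdivlMr ?exprn_gt0// -expr_div_n.
have -> : b / a = expR (ln b - ln a) by rewrite -ln_div ?posrE// lnK ?posrE// divr_gt0.
rewrite -expRM_natl ler_expR -ler_pdivrMl ?ltr0n// mulr1.
exact: ln_succ_ge.
Qed.

(** The Poisson weight x^k exp (- x) / k! is not much smaller than 1 / k when k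
    is within O(sqrt x) of the parameter x. *)
Lemma fact_expR_le k (x : R) : (0 < k)%N -> 0 < x ->
  k`!%:R * expR x <= expR 1 * k%:R * expR ((x - k%:R) ^+ 2 / x) * x ^+ k.
Proof.
move=> k0 x0; have kR : 0 < k%:R :> R by rewrite ltr0n.
apply: le_trans (ler_wpM2r (expR_ge0 _) (fact_le_stirling k0)) _.
set Y := (_ ^+ 2 / x).
rewrite -!mulrA ler_wpM2l ?expR_ge0// ler_wpM2l ?(ltW kR)//.
rewrite -expRD [leRHS]mulrC -ler_pdivrMl ?exprn_gt0// mulrA -exprVn -exprMn.
have -> : x^-1 * k%:R = expR (ln k%:R - ln x).
  by rewrite -ln_div ?posrE// lnK ?posrE ?divr_gt0// mulrC.
rewrite -expRM_natl -expRD ler_expR -ln_div ?posrE// /Y.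
have h : ln (k%:R / x) <= k%:R / x - 1.
  rewrite -[X in ln X](subrKC 1); apply: le_ln1Dx.
  by rewrite ltrBrDl subrr divr_gt0.
have h2 := ler_wpM2l (ltW kR) h.
apply: le_trans (lerD h2 (lexx _)) _.
rewrite le_eqVlt; apply/orP; left; apply/eqP; field; exact: lt0r_neq0.
Qed.

(** The coefficient l! a_l is at most q^(l - k) k! a_k below k and p^(l - k) k! a_k
    above k, so the value at z is dominated by two exponential series, with
    parameters z q and z p; both are comparable to their k-th terms because k is
    close to z q and to z p. *)
Lemma horner_growth_le_coef n k (r z c : R) :
  let q := psum1 1 n - 8 * r in let p := psum1 1 n in
  (0 < k)%N -> 0 <= r -> 0 < q -> k%:R <= r * q -> 0 < z ->
  (z * q - k%:R) ^+ 2 <= c * (z * q) -> (z * p - k%:R) ^+ 2 <= c * (z * p) ->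
  (growth 1 n).[z] <= 2 * (expR 1 * k%:R * expR c) * (z ^+ k * (growth 1 n)`_k).
Proof.
move=> q p k0 r0 q0 kq z0 hq hp.
have p0 : 0 < p by apply: lt_le_trans q0 _; rewrite /q lerBlDr lerDl mulr_ge0.
have fact_gt l : 0 < l`!%:R :> R by rewrite ltr0n fact_gt0.
pose A : R := k`!%:R * (growth 1 n)`_k.
have A0 : 0 <= A by rewrite mulr_ge0// coef_growth_ge0.
have term l : (growth 1 n)`_l * z ^+ l <=
    A * (q ^- k * ((z * q) ^+ l / l`!%:R) + p ^- k * ((z * p) ^+ l / l`!%:R)).
  have hz : 0 <= z ^+ l / l`!%:R by rewrite divr_ge0 ?exprn_ge0// ltW.
  suff h : l`!%:R * (growth 1 n)`_l <= A * (q ^+ l / q ^+ k + p ^+ l / p ^+ k).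
    have := ler_wpM2l hz h.
    congr (_ <= _); first by field; exact: lt0r_neq0.
    by rewrite !exprMn; ring.
  have q1 : 0 <= q ^+ l / q ^+ k by rewrite divr_ge0// exprn_ge0// ltW.
  have p1 : 0 <= p ^+ l / p ^+ k by rewrite divr_ge0// exprn_ge0// ltW.
  case: (leqP l k) => lk.
    have h := @coef_growth_fact_down 1 n r k (k - l) isT (leq_subr _ _) r0 q0 kq.
    rewrite subKn// -/q -/A in h.
    apply: le_trans (_ : A * (q ^+ l / q ^+ k) <= _).
      have -> : q ^+ l / q ^+ k = (q ^+ (k - l))^-1.
        have -> : q ^+ k = q ^+ (k - l) * q ^+ l by rewrite -exprD subnK.
        by rewrite invfM mulrCA divff ?mulr1// expf_eq0 (gt_eqF q0) andbF.
      by rewrite ler_pdivlMr ?exprn_gt0// mulrC.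
    by rewrite ler_wpM2l// lerDl.
  have h := @coef_growth_fact_up 1 n k (l - k) isT.
  rewrite subnKC 1?ltnW// -/p -/A in h.
  apply: le_trans (_ : A * (p ^+ l / p ^+ k) <= _); last by rewrite ler_wpM2l// lerDr.
  have -> : p ^+ l / p ^+ k = p ^+ (l - k).
    have -> : p ^+ l = p ^+ (l - k) * p ^+ k by rewrite -exprD subnK// ltnW.
    by rewrite mulfK// expf_eq0 (gt_eqF p0) andbF.
  by rewrite [leRHS]mulrC.
rewrite (@horner_growthE _ _ n); last exact: leq_subr.
apply: le_trans (ler_sum _ (fun l _ => term l)) _.
rewrite -mulr_sumr big_split/= -!mulr_sumr.
have zq0 : 0 < z * q by rewrite mulr_gt0.
have zp0 : 0 < z * p by rewrite mulr_gt0.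
have bnd (x : R) : 0 < x -> (z * x - k%:R) ^+ 2 <= c * (z * x) ->
    A * (x ^- k * \sum_(0 <= l < n.+1) (z * x) ^+ l / l`!%:R) <=
    expR 1 * k%:R * expR c * (z ^+ k * (growth 1 n)`_k).
  move=> x0 hx; have zx0 : 0 < z * x by rewrite mulr_gt0.
  have xk : 0 < x ^+ k by rewrite exprn_gt0.
  apply: le_trans (_ : A * (x ^- k * expR (z * x)) <= _).
    rewrite ler_wpM2l// ler_wpM2l ?invr_ge0 ?exprn_ge0 ?(ltW x0)//.
    by rewrite sum_exp_coeff_le// ltW.
  have := fact_expR_le k0 zx0.
  have hc : expR ((z * x - k%:R) ^+ 2 / (z * x)) <= expR c.
    by rewrite ler_expR ler_pdivrMr.
  have h1 : 0 <= expR 1 * k%:R :> R by rewrite mulr_ge0 ?expR_ge0.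
  have h2 : 0 <= (z * x) ^+ k by rewrite exprn_ge0// ltW.
  move=> h; have h3 := le_trans h (ler_wpM2r h2 (ler_wpM2l h1 hc)).
  have h4 : 0 <= x ^- k * (growth 1 n)`_k by rewrite mulr_ge0 ?invr_ge0 ?exprn_ge0 ?(ltW x0) ?coef_growth_ge0.
  have := ler_wpM2l h4 h3; congr (_ <= _).
    by rewrite /A; ring.
  by rewrite exprMn; field; exact: lt0r_neq0.
rewrite mulrDr -mulrA mulr2n mulrDl mul1r.
by apply: lerD; apply: bnd.
Qed.

End Norm.

(** * Growth of the normalisation *)
Section NormBounds.
Context {R : realType}.
Implicit Types (m n t : nat) (z x s : R).
Local Notation C := (@BST_norm R).
Local Notation H := (@harm R).

Lemma BST_norm_gt0 n z : 0 < z -> 0 < C n z.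
Proof. by move=> z0; rewrite -horner_growth0 horner_growth_gt0. Qed.

Lemma BST_norm_cat m n z : (m <= n)%N -> C n z = C m z * (growth m n).[z].
Proof. by move=> mn; rewrite -!horner_growth0 -hornerM -growth_cat. Qed.

Lemma le_BST_norm n z z' : 0 < z -> z <= z' -> C n z <= C n z'.
Proof.
move=> z0 zz; rewrite /BST_norm; apply: ler_prod => i _.
rewrite divr_ge0 ?addr_ge0 ?mulr_ge0 ?(ltW z0)//=.
by rewrite ler_pM2r ?invr_gt0// lerD2l ler_pM2l.
Qed.

Lemma BST_norm_le n x : 0 < x -> C n x <= expR ((2 * x - 1) * H n).
Proof.
move=> x0; rewrite /BST_norm /harm mulr_sumr expR_sum; apply: ler_prod => i _.
rewrite divr_ge0 ?addr_ge0 ?mulr_ge0 ?(ltW x0)//=.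
have -> : (i%:R + 2 * x) / i.+1%:R = 1 + (2 * x - 1) / i.+1%:R.
  by rewrite -natr1; field; rewrite nat1r pnatr_eq0.
exact: expR_ge1Dx.
Qed.

(** Bounds the sum of (1 - 2 z)^2 / ((i + 2 z) (i + 1)) over all i, the error
    made in replacing (1 - 2 z) / (i + 2 z) by (1 - 2 z) / (i + 1). *)
Definition norm_const z : R := (1 - 2 * z) ^+ 2 * ((2 * z)^-1 + 1).

Lemma sum_inv_prod_le n :
  \sum_(0 <= i < n) (i%:R * i.+1%:R)^-1 <= 1 :> R.
Proof.
suff : \sum_(0 <= i < n) (i%:R * i.+1%:R)^-1 <= 1 - n%:R^-1 :> R.
  have : 0 <= n%:R^-1 :> R by rewrite invr_ge0.
  lra.
elim: n => [|n IHn]; first by rewrite big_geq// invr0 subr0.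
rewrite big_nat_recr//=; case: n IHn => [|n] IHn.
  by rewrite big_geq// mul0r invr0 add0r invr1 subrr.
apply: le_trans (lerD IHn (lexx _)) _.
rewrite le_eqVlt; apply/orP; left; apply/eqP.
rewrite -(natr1 n.+1); field.
by rewrite nat1r natr1 !pnatr_eq0.
Qed.

Lemma BST_norm_inv_le n z : 0 < z ->
  (C n z)^-1 <= expR ((1 - 2 * z) * H n + norm_const z).
Proof.
move=> z0; rewrite /BST_norm -prodfV.
set b := fun i : nat => (1 - 2 * z) * i.+1%:R^-1 +
  (1 - 2 * z) ^+ 2 * ((i == 0%N)%:R / (2 * z) + (i%:R * i.+1%:R)^-1) : R.
apply: (@le_trans _ _ (\prod_(0 <= i < n) expR (b i))); last first.
  rewrite -expR_sum ler_expR /b big_split/= -!mulr_sumr lerD2l /norm_const.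
  rewrite ler_wpM2l ?sqr_ge0// big_split/=; apply: lerD; last exact: sum_inv_prod_le.
  case: n => [|n]; first by rewrite big_geq// invr_ge0 mulr_ge0// ltW.
  rewrite big_ltn//= mul1r big_nat big1 ?addr0// => i /andP[i0 _].
  by rewrite gtn_eqF// mul0r.
apply: ler_prod => i _.
have z2 : 0 < 2 * z by rewrite mulr_gt0.
have iz : 0 < i%:R + 2 * z by rewrite ltr_wpDl.
rewrite invr_ge0 divr_ge0 ?(ltW iz)//=.
have i1 : i.+1%:R = i%:R + 1 :> R by rewrite natr1.
have i0 : 0 <= i%:R :> R by [].
rewrite invf_div.
have -> : i.+1%:R / (i%:R + 2 * z) = 1 + (1 - 2 * z) / (i%:R + 2 * z).
  by rewrite i1; field; rewrite gt_eqF.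
apply: le_trans (expR_ge1Dx _) _; rewrite ler_expR /b.
have -> : (1 - 2 * z) / (i%:R + 2 * z) = (1 - 2 * z) * i.+1%:R^-1 +
   (1 - 2 * z) ^+ 2 / ((i%:R + 2 * z) * i.+1%:R).
  by rewrite i1; field; rewrite natr1 (gt_eqF iz) pnatr_eq0.
rewrite lerD2l ler_wpM2l ?sqr_ge0//.
case: i iz i1 i0 => [|i] iz i1 i0 /=.
  by rewrite add0r !mulr1 invr0 addr0 mul1r.
rewrite mul0r add0r lef_pV2 ?posrE ?mulr_gt0//.
by rewrite ler_pM2r// lerDl ltW.
Qed.

(** The logarithmic derivative of C_m at z is the sum of 2 / (i + 2 z) for
    i < m: the term i = 0 is 1 / z, the others are at most 2 / i. *)
Lemma BST_norm_scale m z s : 0 < z -> 1 <= s ->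
  C m (z * s) <= C m z * expR ((s - 1) * (1 + 2 * z * H m)).
Proof.
move=> z0 s1; have s0 : 0 <= s - 1 by rewrite subr_ge0.
case: m => [|m].
  rewrite /BST_norm /harm !big_geq// mul1r mulr0 addr0 mulr1.
  by apply: le_trans (expR_ge1Dx _); rewrite lerDl.
set b := fun i : nat => (s - 1) * ((i == 0%N)%:R + (i != 0%N)%:R * (2 * z / i%:R)) : R.
have bE : \sum_(0 <= i < m.+1) b i <= (s - 1) * (1 + 2 * z * H m.+1).
  rewrite /b -mulr_sumr ler_wpM2l// big_ltn//= mul0r addr0 lerD2l.
  rewrite big_add1/= /harm big_nat_recr//= mulrDr mulr_sumr.
  rewrite ler_wpDr ?mulr_ge0 ?(ltW z0) ?invr_ge0//.
  by apply: ler_sum => i _; rewrite add0r mul1r.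
apply: le_trans (_ : C m.+1 z * \prod_(0 <= i < m.+1) expR (b i) <= _); last first.
  by rewrite -expR_sum ler_wpM2l ?(ltW (BST_norm_gt0 _ z0))// ler_expR.
rewrite /BST_norm -big_split/=; apply: ler_prod => i _.
have zs : 0 < z * s by rewrite mulr_gt0// (lt_le_trans ltr01).
have i0 : 0 <= i%:R :> R by [].
have iz : 0 < i%:R + 2 * z by rewrite ltr_wpDl// mulr_gt0.
have -> : 0 <= (i%:R + 2 * (z * s)) / i.+1%:R.
  by rewrite divr_ge0// addr_ge0// mulr_ge0// ltW.
rewrite /= [leRHS]mulrAC ler_pM2r ?invr_gt0//.
case: i i0 iz => [|i] i0 iz.
  rewrite /b /= mul0r addr0 !add0r mulr1 mulrA ler_pM2l ?mulr_gt0//.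
  by rewrite -[leLHS](subrKC 1) expR_ge1Dx.
rewrite /b /= mul1r add0r.
apply: le_trans (_ : (i.+1%:R + 2 * z) * (1 + (s - 1) * (2 * z / i.+1%:R)) <= _); last first.
  by rewrite ler_wpM2l ?(ltW iz)// expR_ge1Dx.
rewrite mulrDr mulr1 -lerBlDl.
have -> : i.+1%:R + 2 * (z * s) - (i.+1%:R + 2 * z) = i.+1%:R * ((s - 1) * (2 * z / i.+1%:R)).
  by field; rewrite nat1r pnatr_eq0.
rewrite ler_wpM2r ?mulr_ge0 ?invr_ge0 ?(ltW z0)//.
by rewrite lerDl mulr_ge0// ltW.
Qed.

End NormBounds.

(** * Growing trees, and their histories *)
Section Tree.
Implicit Types (t : {fset word}) (u v : word) (h : seq word).

Definition grow t u : {fset word} :=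
  (t `|` [fset rcons u false; rcons u true])%fset.

Definition prefix_closed t := forall u v, u ++ v \in t -> u \in t.

Lemma leavesP t u :
  reflect (u \in t /\ forall v, v \in t -> prefix u v -> v = u) (u \in leaves t).
Proof.
rewrite /leaves !inE /=; apply: (iffP andP) => -[ut].
  by move=> /allP h; split=> // v vt uv; have /implyP/(_ uv)/eqP := h v vt.
by move=> h; split=> //; apply/allP => v vt; apply/implyP => uv; apply/eqP/h.
Qed.

Lemma in_grow t u v :
  (v \in grow t u) = [|| v \in t, v == rcons u false | v == rcons u true].
Proof. by rewrite /grow !inE. Qed.

Lemma prefix_rcons_eq u v (b : bool) :
  prefix v (rcons u b) = (v == rcons u b) || prefix v u.
Proof.
apply/idP/idP.
  move=> /prefixP[s]; case/lastP: s => [|s c].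
    by rewrite cats0 => ->; rewrite eqxx.
  rewrite -rcons_cat => /rcons_inj[-> _]; by rewrite prefix_prefix orbT.
move=> /orP[/eqP->|]; first exact: prefix_refl.
move=> /prefixP[s ->]; rewrite rcons_cat; exact: prefix_prefix.
Qed.

Lemma rcons_leaf_notin t u b : u \in leaves t -> rcons u b \notin t.
Proof.
move=> /leavesP[_ h]; apply/negP => /h; rewrite prefix_rcons => /(_ isT)/(congr1 size).
by rewrite size_rcons => /eqP; rewrite -[X in _ == X]addn0 -addn1 eqn_add2l.
Qed.

Lemma prefix_closed_grow t u : prefix_closed t -> u \in t -> prefix_closed (grow t u).
Proof.
move=> pt ut x y; rewrite !in_grow.
case/lastP: y => [|y c]; first by rewrite cats0.
have pu b : rcons (x ++ y) c = rcons u b -> x \in t.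
  by move=> /rcons_inj[e _]; apply: (pt x y); rewrite e.
rewrite -rcons_cat => /or3P[|/eqP/pu ->//|/eqP/pu ->//].
by rewrite rcons_cat => /pt ->.
Qed.

(** Prefix closure is what prevents the two new nodes from having descendants
    that are already in the tree. *)
Lemma leaves_grow t u : prefix_closed t -> u \in leaves t ->
  leaves (grow t u) = (rcons u false |` (rcons u true |` (leaves t `\ u)))%fset.
Proof.
move=> pt lu; have /leavesP[ut hu] := lu.
have nb b := rcons_leaf_notin b lu.
have leaf_new b : rcons u b \in leaves (grow t u).
  apply/leavesP; split; first by rewrite in_grow; case: b; rewrite eqxx ?orbT.
  move=> v; rewrite in_grow => /or3P[vt|/eqP->|/eqP->].
  - by move=> /prefixP[s vE]; move: vt; rewrite vE => /pt; rewrite (negbTE (nb b)).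
  - rewrite prefix_rcons_eq => /orP[/eqP//|/prefixP[s]] /(congr1 size).
    by rewrite size_cat size_rcons; lia.
  - rewrite prefix_rcons_eq => /orP[/eqP//|/prefixP[s]] /(congr1 size).
    by rewrite size_cat size_rcons; lia.
apply/fsetP => v; rewrite !in_fset1U in_fsetD1.
have [->|nv0] := eqVneq v (rcons u false); first by rewrite leaf_new.
have [->|nv1] := eqVneq v (rcons u true); first by rewrite leaf_new.
rewrite /=; apply/idP/andP.
  move=> /leavesP[]; rewrite in_grow (negbTE nv0) (negbTE nv1) !orbF => vt hv.
  split; last first.
    apply/leavesP; split=> // w wt; apply: hv; by rewrite in_grow wt.
  apply/negP => /eqP vu; have := hv (rcons u false).
  rewrite in_grow eqxx orbT vu prefix_rcons => /(_ isT isT)/(congr1 size).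
  by rewrite size_rcons; lia.
move=> [vu /leavesP[vt hv]]; apply/leavesP; split; first by rewrite in_grow vt.
have hb b : prefix v (rcons u b) -> rcons u b = v.
  rewrite prefix_rcons_eq => /orP[/eqP//|/(hv _ ut)/esym/eqP]; by rewrite (negbTE vu).
by move=> w; rewrite in_grow => /or3P[/hv|/eqP->|/eqP->]//; exact: hb.
Qed.

Lemma sum_leaves_grow (V : zmodType) t u (f : word -> V) :
  prefix_closed t -> u \in leaves t ->
  \sum_(v <- leaves (grow t u)) f v =
  \sum_(v <- leaves t) f v + (f (rcons u false) + f (rcons u true) - f u).
Proof.
move=> pt lu; rewrite leaves_grow//.
have nb b := rcons_leaf_notin b lu.
have nl b : rcons u b \notin (leaves t `\ u)%fset.
  by apply/negP; rewrite in_fsetD1 => /andP[_ /leavesP[]]; rewrite (negbTE (nb b)).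
rewrite big_fsetU1/=; last first.
  rewrite in_fset1U negb_or nl andbT (_ : (rcons u false == rcons u true) = false)//.
  by apply/eqP => /rcons_inj[].
rewrite big_fsetU1//= [in RHS](big_fsetD1 u)//=.
rewrite [RHS]addrC -!addrA; congr (_ + (_ + _)).
by rewrite addKr.
Qed.

Definition tree_of h : {fset word} := foldl grow [fset [::]]%fset h.

Lemma tree_of_rcons h u : tree_of (rcons h u) = grow (tree_of h) u.
Proof. by rewrite /tree_of foldl_rcons. Qed.

(** There are n! of these sequences, and the first n choices of leaves in the
    BST process form one of them, with uniform distribution ([prob_cyl]).
    Expectations of functions of (D_0, ..., D_(n-1)) are therefore the finite
    averages [Ex] below, on which all martingale arguments are carried out. *)
Fixpoint histories (n : nat) : seq (seq word) :=
  if n is n'.+1 then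
    [seq rcons h u | h <- histories n', u <- leaves (tree_of h)]
  else [:: [::]].

Lemma histories_rcons n h u : h \in histories n -> u \in leaves (tree_of h) ->
  rcons h u \in histories n.+1.
Proof. by move=> hn ul; apply: allpairs_f_dep. Qed.

Lemma historiesS n h : h \in histories n.+1 -> exists h' u,
  [/\ h = rcons h' u, h' \in histories n & u \in leaves (tree_of h')].
Proof. by move=> /allpairsPdep[h' [u [hn ul ->]]]; exists h', u. Qed.

Lemma size_history n h : h \in histories n -> size h = n.
Proof.
elim: n h => [|n IHn] h; first by rewrite inE => /eqP->.
by move=> /historiesS[h' [u [-> /IHn <- _]]]; rewrite size_rcons.
Qed.

Lemma leaves_root : leaves [fset [::]]%fset = [fset [::]]%fset.
Proof.
apply/fsetP => v; rewrite !inE; apply/andP/eqP => [[/eqP]//|->].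
by split=> //; apply/allP => w; rewrite inE => /eqP->.
Qed.

Lemma history_prefix_closed n h : h \in histories n -> prefix_closed (tree_of h).
Proof.
elim: n h => [|n IHn] h.
  by rewrite inE => /eqP-> u v; rewrite !inE; case: u.
move=> /historiesS[h' [u [-> hn /leavesP[ut _]]]]; rewrite tree_of_rcons.
exact: prefix_closed_grow (IHn _ hn) ut.
Qed.

Lemma take_history n m h : h \in histories n -> (m <= n)%N -> take m h \in histories m.
Proof.
elim: n h => [|n IHn] h.
  by rewrite inE leqn0 => /eqP-> /eqP->.
move=> hn; have hs := size_history hn; move: hn => /historiesS[h' [u [hE hn ul]]].
rewrite leq_eqVlt => /orP[/eqP->|].
  by rewrite take_oversize ?hs// hE; apply: histories_rcons.
rewrite ltnS => mn; rewrite hE -cats1 takel_cat ?(size_history hn)//.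
exact: IHn.
Qed.

Lemma size_leaves n h : h \in histories n -> size (leaves (tree_of h)) = n.+1.
Proof.
have sz t : \sum_(v <- leaves t) 1 = (size (leaves t))%:Z.
  by rewrite big_const_seq count_predT iter_addr_0 natz.
elim: n h => [|n IHn] h.
  by rewrite inE => /eqP->; rewrite /tree_of /= leaves_root cardfs1.
move=> /historiesS[h' [u [-> hn ul]]]; rewrite tree_of_rcons.
have := sum_leaves_grow (fun=> 1 : int) (history_prefix_closed hn) ul.
rewrite !sz (IHn _ hn) addrK; lia.
Qed.

End Tree.

(** * Averages over histories *)
Section Expectation.
Context {R : realType}.
Implicit Types (n m t : nat) (h : seq word) (u : word).

Definition hsum h (f : nat -> R) : R := \sum_(u <- leaves (tree_of h)) f (size u).

Lemma hsum_rcons n h u (f : nat -> R) : h \in histories n ->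
  u \in leaves (tree_of h) ->
  hsum (rcons h u) f = hsum h f + (2 * f (size u).+1 - f (size u)).
Proof.
move=> hn ul; rewrite /hsum tree_of_rcons sum_leaves_grow//; last exact: history_prefix_closed hn.
by rewrite !size_rcons; congr (_ + _); ring.
Qed.

Lemma hsum_nil (f : nat -> R) : hsum [::] f = f 0%N.
Proof. by rewrite /hsum /tree_of /= leaves_root big_seq_fset1. Qed.

Definition Ex n (f : seq word -> R) : R := (n`!%:R)^-1 * \sum_(h <- histories n) f h.

Lemma Ex0 f : Ex 0 f = f [::].
Proof. by rewrite /Ex big_seq1 fact0 invr1 mul1r. Qed.

Lemma ExS n f : Ex n.+1 f =
  Ex n (fun h => n.+1%:R^-1 * \sum_(u <- leaves (tree_of h)) f (rcons h u)).
Proof.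
by rewrite /Ex big_allpairs_dep /= factS natrM invfM -mulrA mulrCA mulr_sumr.
Qed.

Lemma le_Ex n f g : (forall h, h \in histories n -> f h <= g h) -> Ex n f <= Ex n g.
Proof.
move=> fg; rewrite /Ex ler_wpM2l ?invr_ge0//.
by rewrite big_seq [leRHS]big_seq; apply: ler_sum => h /fg.
Qed.

Lemma eq_Ex n f g : (forall h, h \in histories n -> f h = g h) -> Ex n f = Ex n g.
Proof. by move=> fg; rewrite /Ex; congr (_ * _); apply: eq_big_seq. Qed.

Lemma ExZ n c f : Ex n (fun h => c * f h) = c * Ex n f.
Proof. by rewrite /Ex -mulr_sumr mulrCA. Qed.

Lemma ExD n f g : Ex n (fun h => f h + g h) = Ex n f + Ex n g.
Proof. by rewrite /Ex big_split/= mulrDr. Qed.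

Lemma Ex_sum n (I : Type) (s : seq I) (f : I -> seq word -> R) :
  Ex n (fun h => \sum_(i <- s) f i h) = \sum_(i <- s) Ex n (f i).
Proof. by rewrite /Ex exchange_big/= mulr_sumr. Qed.

Lemma Ex_cst n c : Ex n (fun=> c) = c.
Proof.
elim: n => [|n IHn]; first exact: Ex0.
rewrite ExS -[RHS]IHn; apply: eq_Ex => h hn.
rewrite big_const_seq count_predT iter_addr_0 (size_leaves hn).
by rewrite -[c *+ _]mulr_natr mulrCA mulVf ?mulr1 ?pnatr_eq0.
Qed.

(** Growing at u replaces f |u| by 2 f (|u| + 1), so averaging over the n + 1
    leaves is the same as applying an operator to f. *)
Lemma mean_hsum n h (f : nat -> R) : h \in histories n ->
  n.+1%:R^-1 * \sum_(u <- leaves (tree_of h)) hsum (rcons h u) f =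
  hsum h (fun d => (n%:R * f d + 2 * f d.+1) / n.+1%:R).
Proof.
move=> hn; under eq_big_seq => u ul do rewrite (hsum_rcons _ hn ul).
rewrite big_split/= big_const_seq count_predT iter_addr_0 (size_leaves hn).
rewrite -[hsum h f *+ _]mulr_natr mulrDr.
have -> : n.+1%:R^-1 * (hsum h f * n.+1%:R) = hsum h f.
  by rewrite mulrCA mulVf ?mulr1 ?pnatr_eq0.
rewrite mulr_sumr {1}/hsum -big_split/=; apply: eq_bigr => u _.
by rewrite -(natr1 n); field; rewrite natr1 pnatr_eq0.
Qed.

(** The recurrence on [phi] says by [mean_hsum] that [hsum h (phi t)] is a
    martingale in the length t of the history h. *)
Lemma Ex_hsum n (phi : nat -> nat -> R) :
  (forall t d, (t < n)%N -> phi t d = (t%:R * phi t.+1 d + 2 * phi t.+1 d.+1) / t.+1%:R) ->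
  Ex n (fun h => hsum h (phi n)) = phi 0%N 0%N.
Proof.
move=> hphi; suff H t : (t <= n)%N -> Ex t (fun h => hsum h (phi t)) = phi 0%N 0%N by exact: H.
elim: t => [|t IHt] tn; first by rewrite Ex0 hsum_nil.
rewrite ExS -(IHt (ltnW tn)); apply: eq_Ex => h ht.
by rewrite (mean_hsum _ ht); apply: eq_bigr => u _; rewrite [RHS]hphi.
Qed.

End Expectation.

(** * Maximal inequality for the martingale *)
Section Ville.
Context {R : realType}.
Implicit Types (n m t k d : nat) (h : seq word) (u : word) (z zeta B : R).
Local Notation C := (@BST_norm R).

Definition pgf h z : R := hsum h (fun d => z ^+ d).

Definition pgf_bounded zeta B h :=
  all (fun t => pgf (take t h) zeta <= B * C t zeta) (iota 0 (size h).+1).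

Lemma pgf_bounded_rcons zeta B h u :
  pgf_bounded zeta B (rcons h u) =
  pgf_bounded zeta B h && (pgf (rcons h u) zeta <= B * C (size h).+1 zeta).
Proof.
rewrite /pgf_bounded size_rcons -[(size h).+2]addn1 iotaD all_cat all_seq1 add0n.
congr (_ && _); last by rewrite take_oversize ?size_rcons.
apply: eq_in_all => t; rewrite mem_iota /= add0n ltnS => tn.
by rewrite -cats1 takel_cat.
Qed.

Lemma pgf_boundedW zeta B h t : pgf_bounded zeta B h -> (t <= size h)%N ->
  pgf (take t h) zeta <= B * C t zeta.
Proof. by move=> /allP hb th; apply: hb; rewrite mem_iota add0n. Qed.

Lemma BST_normS n z : C n.+1 z = C n z * ((n%:R + 2 * z) / n.+1%:R).
Proof. by rewrite /BST_norm big_nat_recr. Qed.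

Lemma mean_pgf n h z : h \in histories n ->
  n.+1%:R^-1 * \sum_(u <- leaves (tree_of h)) pgf (rcons h u) z =
  pgf h z * ((n%:R + 2 * z) / n.+1%:R).
Proof.
move=> hn; rewrite /pgf (mean_hsum _ hn) /hsum mulr_suml; apply: eq_bigr => u _.
by rewrite exprS; ring.
Qed.

Lemma pgf_ge0 h z : 0 <= z -> 0 <= pgf h z.
Proof. by move=> z0; apply: sumr_ge0 => u _; rewrite exprn_ge0. Qed.

(** The process equal to S_t(zeta) / (B C_t(zeta)) as long as [pgf_bounded]
    holds, and to 1 afterwards, is a supermartingale that starts at 1 / B and
    dominates the indicator of the failure of [pgf_bounded]. *)
Lemma ville n zeta B : 0 < zeta -> 1 <= B ->
  Ex n (fun h => (~~ pgf_bounded zeta B h)%:R) <= B^-1.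
Proof.
move=> z0 B1; have B0 : 0 < B by apply: lt_le_trans B1.
pose Y n h : R := if pgf_bounded zeta B h then pgf h zeta / (B * C n zeta) else 1.
have BC t : 0 < B * C t zeta by rewrite mulr_gt0// BST_norm_gt0.
apply: (@le_trans _ _ (Ex n (Y n))).
  apply: le_Ex => h _; rewrite /Y; case: ifP => //= _.
  by rewrite divr_ge0 ?pgf_ge0// ltW.
elim: n => [|n IHn].
  rewrite Ex0 /Y /pgf_bounded /= /pgf hsum_nil /BST_norm big_geq// expr0 mulr1 B1.
  by rewrite div1r.
apply: le_trans IHn; rewrite ExS; apply: le_Ex => h hn; rewrite /Y.
case: ifPn => hb.
  apply: le_trans (_ : n.+1%:R^-1 * \sum_(u <- leaves (tree_of h))
      (pgf (rcons h u) zeta / (B * C n.+1 zeta)) <= _).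
    rewrite ler_wpM2l ?invr_ge0//; apply: ler_sum => u _.
    rewrite pgf_bounded_rcons hb /= (size_history hn).
    by case: ifPn => //; rewrite -ltNge ler_pdivlMr// mul1r => /ltW.
  rewrite -mulr_suml mulrA (mean_pgf _ hn) BST_normS le_eqVlt; apply/orP; left; apply/eqP.
  have c0 := BST_norm_gt0 n z0.
  have nz : 0 < n%:R + 2 * zeta by rewrite ltr_wpDl// mulr_gt0.
  field; rewrite !gt_eqF//=; have := nz; rewrite ?ltr0n//.
rewrite (eq_bigr (fun=> 1)); last first.
  by move=> u _; rewrite pgf_bounded_rcons (negbTE hb).
rewrite big_const_seq count_predT iter_addr_0 (size_leaves hn).
by rewrite mulVf ?pnatr_eq0.
Qed.

End Ville.

(** * Exponential supermartingales *)
Section ExpMartingale.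
Context {R : realType}.
Implicit Types (n m t k d : nat) (h : seq word) (u : word).

(** Obtained from exp (y / 2) <= 1 / (1 - y / 2), squared; the constant 2 leaves
    room for a factorisation of the difference. *)
Lemma expR_le_quadratic (y : R) : `|y| <= 1 -> expR y <= 1 + y + 2 * y ^+ 2.
Proof.
move=> y1; have [ya yb] : -1 <= y /\ y <= 1 by move: y1; rewrite ler_norml => /andP.
have e1 : 1 - y / 2 <= expR (- (y / 2)) by exact: expR_ge1Dx.
have p1 : 0 < 1 - y / 2 by lra.
have e2 : expR (y / 2) <= (1 - y / 2)^-1.
  by rewrite -[y / 2]opprK expRN opprK lef_pV2 ?posrE// expR_gt0.
have -> : expR y = expR (y / 2) ^+ 2 by rewrite -expRM_natl; congr expR; field.
apply: le_trans (_ : ((1 - y / 2)^-1) ^+ 2 <= _).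
  by rewrite ler_sqr ?nnegrE ?expR_ge0// invr_ge0 ltW.
rewrite exprVn -div1r ler_pdivrMr ?exprn_gt0//.
rewrite -subr_ge0.
have -> : (1 + y + 2 * y ^+ 2) * (1 - y / 2) ^+ 2 - 1 =
  y ^+ 2 * ((1 - y) * (5 / 4 - y / 2)) by field.
by rewrite mulr_ge0 ?sqr_ge0// mulr_ge0//; lra.
Qed.

(** The increment of [hsum h f] when a leaf of depth d is grown. *)
Definition jump (f : nat -> R) d : R := 2 * f d.+1 - f d.

Lemma mean_expR t h (f : nat -> R) (lam : R) : h \in histories t ->
  (forall u, u \in leaves (tree_of h) -> `|lam * jump f (size u)| <= 1) ->
  t.+1%:R^-1 * \sum_(u <- leaves (tree_of h)) expR (lam * hsum (rcons h u) f) <=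
  expR (lam * hsum h (fun d => (t%:R * f d + 2 * f d.+1) / t.+1%:R)
        + 2 * lam ^+ 2 * (t.+1%:R^-1 * hsum h (fun d => jump f d ^+ 2))).
Proof.
move=> ht hsmall; set x := _ * (_ * hsum h _).
have step u : u \in leaves (tree_of h) -> expR (lam * hsum (rcons h u) f) <=
   expR (lam * hsum h f) * (1 + lam * jump f (size u) + 2 * lam ^+ 2 * jump f (size u) ^+ 2).
  move=> ul; rewrite (hsum_rcons _ ht ul) mulrDr expRD ler_wpM2l ?expR_ge0//.
  apply: le_trans (expR_le_quadratic (hsmall _ ul)) _.
  by rewrite exprMn mulrA.
apply: le_trans (ler_wpM2l _ (_ : _ <= \sum_(u <- leaves (tree_of h))
   (expR (lam * hsum h f) * (1 + lam * jump f (size u) + 2 * lam ^+ 2 * jump f (size u) ^+ 2)))) _.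
- by rewrite invr_ge0.
- by rewrite big_seq [leRHS]big_seq; apply: ler_sum => u /step.
rewrite -mulr_sumr mulrCA !big_split/= big_const_seq count_predT iter_addr_0 (size_leaves ht).
rewrite !mulrDr mulVf ?pnatr_eq0// -!mulr_sumr.
set y := \sum_(u <- _) jump f _.
have -> : t.+1%:R^-1 * (2 * lam ^+ 2 * \sum_(u <- leaves (tree_of h)) jump f (size u) ^+ 2) = x.
  by rewrite /x /hsum; ring.
have -> : lam * hsum h (fun d : nat => (t%:R * f d + 2 * f d.+1) / t.+1%:R) + x =
   lam * hsum h f + (t.+1%:R^-1 * (lam * y) + x).
  rewrite addrA; congr (_ + _); rewrite mulrCA -mulrDr; congr (_ * _).
  rewrite /y mulr_sumr /hsum -big_split/=; apply: eq_bigr => u _; rewrite /jump.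
  by rewrite -(natr1 t); field; rewrite natr1 pnatr_eq0.
rewrite expRD -!mulrDr ler_wpM2l ?expR_ge0// -addrA.
exact: expR_ge1Dx.
Qed.

(** Freedman's method: on the event G, which only shrinks with time, the jumps
    are at most 1 / lam and the conditional second moments at most q, so the
    exponential of lam times the martingale grows in mean by at most the factor
    exp (2 lam^2 q t) at time t.  Off G the process is replaced by 0. *)
Lemma exp_martingale n m (phi : nat -> nat -> R) (lam : R) (G : pred (seq word))
    (q : nat -> R) : (m <= n)%N ->
  (forall t d, (t < n)%N -> phi t d = (t%:R * phi t.+1 d + 2 * phi t.+1 d.+1) / t.+1%:R) ->
  (forall h u, G (rcons h u) -> G h) ->
  (forall t h, (m <= t < n)%N -> h \in histories t -> G h ->
     (forall u, u \in leaves (tree_of h) -> `|lam * jump (phi t.+1) (size u)| <= 1) /\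
     t.+1%:R^-1 * hsum h (fun d => jump (phi t.+1) d ^+ 2) <= q t) ->
  Ex n (fun h => (G h)%:R * expR (lam * (hsum h (phi n) - hsum (take m h) (phi m))))
  <= expR (2 * lam ^+ 2 * \sum_(m <= i < n) q i).
Proof.
move=> mn hphi hG hq.
suff H t : (m <= t <= n)%N ->
    Ex t (fun h => (G h)%:R * expR (lam * (hsum h (phi t) - hsum (take m h) (phi m))))
    <= expR (2 * lam ^+ 2 * \sum_(m <= i < t) q i) by apply: H; rewrite mn leqnn.
elim: t => [|t IHt] /andP[mt tn].
  move: mt; rewrite leqn0 => /eqP->; rewrite Ex0 big_geq// mulr0 expR0 subrr mulr0 expR0 mulr1.
  by case: (G _).
move: mt; rewrite leq_eqVlt => /orP[/eqP mE|].
  rewrite big_geq ?mE// mulr0 expR0 -[leRHS](Ex_cst t.+1).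
  apply: le_Ex => h ht; rewrite take_oversize ?(size_history ht) ?mE//.
  by rewrite subrr mulr0 expR0 mulr1; case: (G _).
rewrite ltnS => mt; have tn' := ltnW tn.
rewrite big_nat_recr//= mulrDr expRD.
apply: le_trans (ler_wpM2r (expR_ge0 _) (IHt _)); last by rewrite mt.
rewrite mulrC -ExZ ExS; apply: le_Ex => h ht.
have [Gh|nGh] := boolP (G h); last first.
  rewrite !mul0r mulr0 big_seq big1 ?mulr0// => u ul.
  by rewrite (negbTE (contra (@hG h u) nGh)) mul0r.
rewrite mul1r.
have [hs hv] := hq t h (introT andP (conj mt tn)) ht Gh.
set X := hsum (take m h) (phi m).
apply: le_trans (_ : t.+1%:R^-1 * \sum_(u <- leaves (tree_of h))
   (expR (lam * hsum (rcons h u) (phi t.+1)) * expR (- (lam * X))) <= _).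
  rewrite ler_wpM2l ?invr_ge0//; apply: ler_sum => u _.
  rewrite -expRD -mulrBr -cats1 takel_cat ?(size_history ht)// cats1 -/X.
  by case: (G _); rewrite ?mul1r// mul0r expR_ge0.
rewrite -mulr_suml mulrA.
apply: le_trans (ler_wpM2r (expR_ge0 _) (mean_expR ht hs)) _.
rewrite -!expRD ler_expR.
have -> : hsum h (phi t) = hsum h (fun d : nat => (t%:R * phi t.+1 d + 2 * phi t.+1 d.+1) / t.+1%:R).
  by apply: eq_bigr => u _; rewrite [LHS]hphi.
have l2 : 0 <= 2 * lam ^+ 2 by rewrite mulr_ge0// sqr_ge0.
have := ler_wpM2l l2 hv.
by rewrite mulrBr; move: (_ * q t) (_ * (_ * hsum _ _)) (lam * hsum _ _) => a b c; lra.
Qed.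

Lemma chernoff n m (phi : nat -> nat -> R) (lam kap : R) (G : pred (seq word))
    (q : nat -> R) : (m <= n)%N -> 0 <= lam ->
  (forall t d, (t < n)%N -> phi t d = (t%:R * phi t.+1 d + 2 * phi t.+1 d.+1) / t.+1%:R) ->
  (forall h u, G (rcons h u) -> G h) ->
  (forall t h, (m <= t < n)%N -> h \in histories t -> G h ->
     (forall u, u \in leaves (tree_of h) -> `|lam * jump (phi t.+1) (size u)| <= 1) /\
     t.+1%:R^-1 * hsum h (fun d => jump (phi t.+1) d ^+ 2) <= q t) ->
  Ex n (fun h => (G h && (kap <= `|hsum h (phi n) - hsum (take m h) (phi m)|))%:R)
  <= 2 * expR (2 * lam ^+ 2 * (\sum_(m <= i < n) q i) - lam * kap).
Proof.
move=> mn l0 hphi hG hq.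
have h1 := exp_martingale mn hphi hG hq.
have h2 : Ex n (fun h => (G h)%:R * expR (- lam * (hsum h (phi n) - hsum (take m h) (phi m))))
  <= expR (2 * lam ^+ 2 * \sum_(m <= i < n) q i).
  rewrite -(sqrrN lam); apply: exp_martingale => // t h tn ht Gh.
  have [ha hb] := hq t h tn ht Gh; split=> // u ul.
  by rewrite mulNr normrN ha.
rewrite expRD mulrA mulr_natl mulr2n [leRHS]mulrC.
apply: le_trans (ler_wpM2l (expR_ge0 _) (lerD h1 h2)).
rewrite -ExD -ExZ; apply: le_Ex => h _.
case: (G h) => /=; last by rewrite !mul0r addr0 mulr0.
rewrite !mul1r; set x := _ - _; rewrite expRN mulrC ler_pdivlMr ?expR_gt0//.
have [hk|_] := boolP (kap <= `|x|); last by rewrite mul0r addr_ge0// expR_ge0.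
rewrite mul1r; have [x0|x0] := leP 0 x.
  rewrite ger0_norm// in hk.
  by apply: le_trans (_ : expR (lam * x) <= _); rewrite ?lerDl ?expR_ge0// ler_expR ler_wpM2l.
rewrite ltr0_norm// in hk.
apply: le_trans (_ : expR (- lam * x) <= _); rewrite ?lerDr ?expR_ge0// ler_expR.
by rewrite mulNr -mulrN ler_wpM2l.
Qed.

End ExpMartingale.

(** * Concentration of the profile around its conditional mean *)
Section ProfileDeviation.
Context {R : realType}.
Implicit Types (n m t k d : nat) (h : seq word) (u : word) (z : R).
Local Notation C := (@BST_norm R).
Local Notation H := (@harm R).

(** The mean number of leaves of depth k at time n that descend from a given
    leaf of depth d at time t. *)
Definition profile_weight n k t d : R :=
  if (d <= k)%N then (growth t n)`_(k - d) else 0.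

Lemma profile_weight_rec n k t d : (t < n)%N ->
  profile_weight n k t d =
  (t%:R * profile_weight n k t.+1 d + 2 * profile_weight n k t.+1 d.+1) / t.+1%:R.
Proof.
move=> tn; rewrite /profile_weight growthSl//; case: ltngtP => dk.
- by rewrite subnS -(subnSK dk) coef_factorMS.
- by rewrite !mulr0 addr0 mul0r.
- by rewrite dk subnn coef_factorM0 mulr0 addr0 mulrAC.
Qed.

Lemma profile_weight_end n k d : profile_weight n k n d = (d == k)%:R.
Proof.
rewrite /profile_weight growthnn coef1; case: ltngtP => // dk.
  by rewrite subn_eq0 leqNgt dk.
by rewrite dk subnn.
Qed.

Lemma profile_weight_ge0 n k t d : 0 <= profile_weight n k t d.
Proof. by rewrite /profile_weight; case: ifP => // _; exact: coef_growth_ge0. Qed.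

(** A coefficient of a polynomial with nonnegative coefficients is at most the
    value at z divided by the power of z. *)
Lemma profile_weight_le n k t d z : 0 < z -> (t <= n)%N ->
  profile_weight n k t d <= C n z / z ^+ k * (z ^+ d / C t z).
Proof.
move=> z0 tn; have zk : 0 < z ^+ k by rewrite exprn_gt0.
have ct := BST_norm_gt0 t z0.
rewrite (BST_norm_cat _ tn).
have -> : C t z * (growth t n).[z] / z ^+ k * (z ^+ d / C t z) =
   (growth t n).[z] * z ^+ d / z ^+ k by field; rewrite !gt_eqF.
rewrite ler_pdivlMr// /profile_weight; case: ifP => dk; last first.
  by rewrite mul0r mulr_ge0 ?exprn_ge0 ?(ltW z0)// ltW// horner_growth_gt0.
rewrite -[in z ^+ k](subnK dk) exprD mulrA ler_wpM2r ?exprn_ge0 ?(ltW z0)//.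
by rewrite coef_growth_le// ltW.
Qed.

Definition cond_profile n k t h : R := hsum h (profile_weight n k t).

Lemma cond_profile_end n k h : cond_profile n k n h = hsum h (fun d => (d == k)%:R).
Proof. by apply: eq_bigr => u _; rewrite profile_weight_end. Qed.

Lemma Ex_profile n k :
  Ex n (fun h => hsum h (fun d => (d == k)%:R)) = (growth 0 n)`_k :> R.
Proof.
transitivity (Ex n (fun h => hsum h (profile_weight n k n))).
  by apply: eq_Ex => h _; rewrite -(cond_profile_end n).
by rewrite (Ex_hsum (@profile_weight_rec n k)) /profile_weight leq0n subn0.
Qed.

(** From here on z ranges over [zm, zp], and [pgf_bounded] is used at the single
    point zeta = zp^p, so that one event serves all z in the segment. *)
Section Params.
Context (zm zp p B : R).
Context (zm0 : 0 < zm) (zmp : zm <= zp) (p1 : 1 <= p) (p2 : p <= 2) (B1 : 1 <= B).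

Let zeta := expR (p * ln zp).
Let zp0 : 0 < zp. Proof. exact: lt_le_trans zm0 zmp. Qed.
Let p0 : 0 < p. Proof. exact: lt_le_trans p1. Qed.
Let B0 : 0 < B. Proof. exact: lt_le_trans B1. Qed.
Let z0 : 0 < zeta. Proof. exact: expR_gt0. Qed.

(* The logarithm of (B C_t(zeta))^(1/p), the bound on the l^p norm of the family
   (zp^|u|) over the leaves u of the tree at time t. *)
Let smax t : R := (ln B + ln (C t zeta)) / p.

Let zpE d : zp ^+ d = expR (ln zp * d%:R).
Proof. by rewrite mulrC expRM_natl lnK. Qed.

Let zetaE d : zeta ^+ d = expR (p * (ln zp * d%:R)).
Proof. by rewrite /zeta -expRM_natl mulrC mulrA. Qed.

Let leaf_exponent_le t h u : pgf h zeta <= B * C t zeta ->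
  u \in leaves (tree_of h) -> ln zp * (size u)%:R <= smax t.
Proof.
move=> hb ul; rewrite /smax ler_pdivlMr// mulrC -lnM ?posrE ?BST_norm_gt0//.
rewrite -ler_expR lnK ?posrE ?mulr_gt0 ?BST_norm_gt0// -zetaE.
apply: le_trans hb; rewrite /pgf /hsum (big_fsetD1 u)//= lerDl.
by apply: sumr_ge0 => v _; rewrite exprn_ge0// ltW.
Qed.

(* The l^2 norm is at most the l^p norm: zp^(2 |u|) is the product of
   zp^((2 - p) |u|), bounded by the maximum, and of zeta^|u|. *)
Let sum_sq_le t h : pgf h zeta <= B * C t zeta ->
  hsum h (fun d => (zp ^+ d) ^+ 2) <= expR (smax t) ^+ 2.
Proof.
move=> hb.
have pp : B * C t zeta = expR (p * smax t).
  rewrite /smax mulrCA divff ?gt_eqF// mulr1 -lnM ?posrE ?BST_norm_gt0//.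
  by rewrite lnK ?posrE ?mulr_gt0 ?BST_norm_gt0.
apply: le_trans (_ : expR ((2 - p) * smax t) * pgf h zeta <= _); last first.
  apply: le_trans (ler_wpM2l (expR_ge0 _) hb) _.
  by rewrite pp -expRD -expRM_natl -mulrDl subrK.
rewrite /pgf /hsum mulr_sumr big_seq [leRHS]big_seq; apply: ler_sum => u ul.
rewrite zetaE zpE -expRM_natl -expRD ler_expR.
have := leaf_exponent_le hb ul; move: (ln zp * _) => x hx.
have hp : 0 <= 2 - p by rewrite subr_ge0.
have := ler_wpM2l hp hx; lra.
Qed.

Let jump_le n k t d z : zm <= z -> z <= zp -> (t < n)%N ->
  `|jump (profile_weight n k t.+1) d| <=
  C n z / z ^+ k * ((2 * zp + 1) / C t.+1 zm * zp ^+ d).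
Proof.
move=> zmz zzp tn; have zz : 0 < z by exact: lt_le_trans zmz.
have h1 := profile_weight_le k d zz tn; have h2 := profile_weight_le k d.+1 zz tn.
have g1 := profile_weight_ge0 n k t.+1 d; have g2 := profile_weight_ge0 n k t.+1 d.+1.
have K0 : 0 <= C n z / z ^+ k.
  by rewrite divr_ge0 ?exprn_ge0 ?(ltW zz)// ltW// BST_norm_gt0.
have cz := BST_norm_gt0 t.+1 zz; have cm := BST_norm_gt0 t.+1 zm0.
have a d' : z ^+ d' / C t.+1 z <= zp ^+ d' / C t.+1 zm.
  apply: ler_pM; rewrite ?exprn_ge0 ?invr_ge0 ?(ltW zz) ?(ltW cz)//.
    by rewrite lerXn2r ?nnegrE ?(ltW zz) ?(ltW zp0).
  by rewrite lef_pV2 ?posrE// le_BST_norm.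
have {}h1 := le_trans h1 (ler_wpM2l K0 (a d)).
have {}h2 := le_trans h2 (ler_wpM2l K0 (a d.+1)).
rewrite /jump; apply: (@le_trans _ _ (2 * profile_weight n k t.+1 d.+1 + profile_weight n k t.+1 d)).
  by rewrite ler_norml; apply/andP; split; lra.
apply: le_trans (lerD (ler_wpM2l (ler0n _ 2) h2) h1) _.
rewrite le_eqVlt; apply/orP; left; apply/eqP; rewrite exprS; ring.
Qed.

(** C_t(x) has order t^(2 x - 1), so t^(- gap) is the order of
    C_t(zp^p)^(1/p) / C_t(zm), which bounds the jumps at time t. *)
Definition gap : R := (2 * zm - 1) - (2 * zeta - 1) / p.
Definition gap_const : R := (2 * zp + 1) *
  expR (ln B / p + `|2 * zeta - 1| / p + 2 * `|1 - 2 * zm| + norm_const zm).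

Lemma gap_const_gt0 : 0 < gap_const.
Proof. by rewrite /gap_const mulr_gt0 ?expR_gt0// addr_gt0// mulr_gt0. Qed.

Let Gam t : R := (2 * zp + 1) / C t.+1 zm * expR (smax t).

Let Gam_le t : Gam t <= gap_const * expR (- gap * ln t.+1%:R).
Proof.
have z21 : 0 <= 2 * zp + 1 by rewrite addr_ge0// mulr_ge0// ltW.
rewrite /Gam /gap_const -!mulrA ler_wpM2l//.
apply: le_trans (ler_wpM2r (expR_ge0 _) (BST_norm_inv_le _ zm0)) _.
rewrite -!expRD ler_expR.
have lnC : ln (C t zeta) <= (2 * zeta - 1) * H t.
  by rewrite -ler_expR lnK ?posrE ?BST_norm_gt0// BST_norm_le.
have hx (a x l e : R) : l <= x -> x <= e + l -> a * x <= `|a| * e + a * l.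
  move=> lx xl; rewrite -lerBlDr -mulrBr.
  apply: le_trans (ler_norm _) _; rewrite normrM ler_wpM2l//.
  rewrite ger0_norm ?subr_ge0//; lra.
have t1 : ln t.+1%:R <= H t by exact: harm_ge.
have t2 : H t <= 1 + ln t.+1%:R.
  apply: le_trans (harm_le t) _; rewrite lerD2l; case: (t) => [|t'].
    by rewrite ln0// ln1.
  by rewrite ler_ln ?posrE// ler_nat.
have t3 : ln t.+1%:R <= H t.+1 by apply: le_trans t1 (harm_mono (leqnSn t)).
have t4 : H t.+1 <= 2 + ln t.+1%:R.
  rewrite /harm big_nat_recr//= -/(harm t).
  have : t.+1%:R^-1 <= 1 :> R by rewrite invf_le1// ler1n.
  move: t2; move: (t.+1%:R^-1) (ln _) => a b; lra.
have e1 := hx (2 * zeta - 1) _ _ _ t1 t2.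
have e2 := hx (1 - 2 * zm) _ _ _ t3 t4.
have e3 : smax t <= ln B / p + (`|2 * zeta - 1| * 1 + (2 * zeta - 1) * ln t.+1%:R) / p.
  by rewrite /smax mulrDl lerD2l ler_wpM2r ?invr_ge0 ?(ltW p0)// (le_trans lnC).
apply: le_trans (lerD (lerD e2 (lexx _)) e3) _.
rewrite /gap mulr1 le_eqVlt; apply/orP; left; apply/eqP; ring.
Qed.

(** The jumps after time m are at most K gap_const m^(- gap) with
    K = C_n(z) / z^k, and so are their conditional standard deviations times
    sqrt (t + 1).  The assumption on m allows lam = m^(gap / 2) / K in
    [chernoff]. *)
Lemma profile_deviation n m k z (kap : R) : zm <= z -> z <= zp -> (m <= n)%N ->
  0 <= gap -> gap_const ^+ 2 * (1 + 2 * H n) <= expR (gap * ln m.+1%:R) ->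
  Ex n (fun h => (pgf_bounded zeta B h &&
    (kap * (C n z / z ^+ k) <=
      `|hsum h (fun d => (d == k)%:R) - cond_profile n k m (take m h)|))%:R)
  <= 2 * expR (1 - kap * expR (gap / 2 * ln m.+1%:R)).
Proof.
move=> zmz zzp mn gap0 hE; have zz : 0 < z by exact: lt_le_trans zmz.
set K := C n z / z ^+ k.
have K0 : 0 < K by rewrite divr_gt0 ?exprn_gt0// BST_norm_gt0.
pose lam := expR (gap / 2 * ln m.+1%:R) / K.
have lam0 : 0 <= lam by rewrite divr_ge0 ?expR_ge0// ltW.
pose q t : R := K ^+ 2 * (gap_const * expR (- gap * ln m.+1%:R)) ^+ 2 * t.+1%:R^-1.
have GamE t : (m <= t)%N -> Gam t <= gap_const * expR (- gap * ln m.+1%:R).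
  move=> mt; apply: le_trans (Gam_le t) _; rewrite ler_wpM2l ?(ltW gap_const_gt0)//.
  by rewrite ler_expR !mulNr lerN2 ler_wpM2l// ler_ln ?posrE// ler_nat.
have Gam0 t : 0 <= (2 * zp + 1) / C t.+1 zm.
  by rewrite divr_ge0 ?(ltW (BST_norm_gt0 _ zm0))// addr_ge0// mulr_ge0// ltW.
have E2 : expR (gap * ln m.+1%:R) = expR (gap / 2 * ln m.+1%:R) ^+ 2.
  by rewrite -expRM_natl; congr expR; field.
have E0 := expR_gt0 (gap / 2 * ln (m.+1%:R : R)).
have EN : expR (- gap * ln m.+1%:R) = (expR (gap / 2 * ln m.+1%:R) ^+ 2)^-1.
  by rewrite -E2 -expRN mulNr.
have c0 := gap_const_gt0.
have Hn : 0 <= H n by exact: harm_ge0.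
have small : lam * K * (gap_const * expR (- gap * ln m.+1%:R)) <= 1.
  rewrite /lam divfK ?gt_eqF// EN.
  move: hE; rewrite E2; set E := expR _ in E0 * => hE.
  have -> : E * (gap_const / E ^+ 2) = gap_const / E by field; rewrite gt_eqF.
  rewrite ler_pdivrMr// mul1r -(@ler_pXn2r _ 2)// ?nnegrE ?(ltW c0) ?(ltW E0)//.
  apply: le_trans hE; rewrite ler_peMr ?sqr_ge0// lerDl mulr_ge0//.
have var : 2 * lam ^+ 2 * (\sum_(m <= i < n) q i) <= 1.
  rewrite /q -mulr_sumr.
  apply: le_trans (_ : 2 * lam ^+ 2 * (K ^+ 2 * (gap_const * expR (- gap * ln m.+1%:R)) ^+ 2 * H n) <= _).
    apply: ler_wpM2l; first by rewrite mulr_ge0// sqr_ge0.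
    apply: ler_wpM2l; first by rewrite mulr_ge0// sqr_ge0.
    rewrite /harm [leRHS](big_cat_nat (leq0n m) mn)/= lerDr.
    by rewrite sumr_ge0// => i _; rewrite invr_ge0.
  rewrite /lam EN; move: hE; rewrite E2; set E := expR _ in E0 * => hE.
  have -> : 2 * (E / K) ^+ 2 * (K ^+ 2 * (gap_const / E ^+ 2) ^+ 2 * H n) =
     gap_const ^+ 2 * (2 * H n) / E ^+ 2 by field; rewrite !gt_eqF.
  rewrite ler_pdivrMr ?exprn_gt0// mul1r (le_trans _ hE)// ler_wpM2l ?sqr_ge0//.
  by rewrite lerDr.
have := @chernoff R n m (profile_weight n k) lam (kap * K) (pgf_bounded zeta B) q mn lam0
  (@profile_weight_rec n k) _ _.
move=> /(_ _ _)/le_trans; rewrite /cond_profile.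
have -> : Ex n (fun h => (pgf_bounded zeta B h && (kap * K <=
      `|hsum h (fun d => (d == k)%:R) - hsum (take m h) (profile_weight n k m)|))%:R) =
   Ex n (fun h => (pgf_bounded zeta B h && (kap * K <=
      `|hsum h (profile_weight n k n) - hsum (take m h) (profile_weight n k m)|))%:R) :> R.
  by apply: eq_Ex => h _; rewrite -(cond_profile_end n).
apply.
- by move=> h u; rewrite pgf_bounded_rcons => /andP[].
- move=> t h /andP[mt tn] ht hb.
  have hb' : pgf h zeta <= B * C t zeta.
    by have := pgf_boundedW hb (leqnn _); rewrite take_size (size_history ht).
  split=> [u ul|].
    rewrite normrM (ger0_norm lam0); apply: le_trans small.
    rewrite -mulrA ler_wpM2l//; apply: le_trans (jump_le _ _ zmz zzp tn) _.
    rewrite ler_wpM2l ?(ltW K0)//; apply: le_trans (GamE t mt).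
    rewrite /Gam ler_wpM2l// zpE ler_expR; exact: leaf_exponent_le hb' ul.
  rewrite /q mulrC ler_wpM2r ?invr_ge0//.
  apply: le_trans (_ : K ^+ 2 * Gam t ^+ 2 <= _); last first.
    rewrite ler_wpM2l ?sqr_ge0// lerXn2r ?nnegrE ?GamE//.
      by rewrite /Gam mulr_ge0 ?expR_ge0.
    by rewrite mulr_ge0 ?expR_ge0// ltW.
  apply: le_trans (_ : hsum h (fun d => (K * ((2 * zp + 1) / C t.+1 zm)) ^+ 2 * (zp ^+ d) ^+ 2) <= _).
    apply: ler_sum => u _; rewrite -exprMn -[leLHS]ger0_norm ?sqr_ge0// normrX.
    rewrite lerXn2r ?nnegrE ?normr_ge0//; last first.
      by rewrite -mulrA jump_le.
    by apply: mulr_ge0; [exact: mulr_ge0 (ltW K0) _|rewrite exprn_ge0// ltW].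
  rewrite /hsum -mulr_sumr -/(hsum h (fun d => (zp ^+ d) ^+ 2)).
  have -> : K ^+ 2 * Gam t ^+ 2 =
      (K * ((2 * zp + 1) / C t.+1 zm)) ^+ 2 * expR (smax t) ^+ 2.
    by rewrite /Gam; ring.
  by rewrite ler_wpM2l ?sqr_ge0// sum_sq_le.
- rewrite ler_wpM2l// ler_expR lerD// lerN2 /lam mulrCA divfK ?gt_eqF//.
Qed.

End Params.
End ProfileDeviation.

(** * The law of the histories of a BST process *)
Section Process.
Context (R : realType) (d : measure_display) (Omega : measurableType d)
  (P : probability Omega R) (T : nat -> Omega -> {fset word})
  (D : nat -> Omega -> word) (hTD : BST_process P T D).
Implicit Types (n k : nat) (h : seq word) (w : Omega).

Definition history n w : seq word := mkseq (fun i => D i w) n.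

Lemma tree_history n w : T n w = tree_of (history n w).
Proof.
elim: n => [|n IHn]; first by rewrite (BST_init hTD).
by rewrite (BST_step hTD) IHn /history mkseqS tree_of_rcons.
Qed.

Lemma take_historyE m n w : (m <= n)%N -> take m (history n w) = history m w.
Proof. by move=> mn; rewrite /history /mkseq -map_take take_iota (minn_idPl mn). Qed.

Definition cyl h : set Omega := [set w | history (size h) w = h].

Lemma cyl_rcons h u : cyl (rcons h u) = cyl h `&` (D (size h) @^-1` [set u]).
Proof.
apply/seteqP; split=> w; rewrite /cyl /= size_rcons /history mkseqS.
  by move=> /rcons_inj[-> ->].
by move=> [-> ->].
Qed.

Lemma measurable_cyl h : measurable (cyl h).
Proof.
elim/last_ind: h => [|h u IHh]; first by rewrite (_ : cyl [::] = setT)//; apply/seteqP.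
by rewrite cyl_rcons; apply: measurableI => //; exact: BST_measurable hTD _ _.
Qed.

(** The trees determine the leaves that were grown: T_(i+1) contains the
    children of D_i, which T_i does not. *)
Lemma cyl_past n h : h \in histories n ->
  cyl h = [set w | forall i, (i <= n)%N -> T i w = tree_of (take i h)].
Proof.
move=> hn; apply/seteqP; split=> w; rewrite /cyl /= (size_history hn).
  by move=> hw i ni; rewrite tree_history -hw take_historyE.
move=> hT; suff H i : (i <= n)%N -> history i w = take i h.
  by rewrite (H n)// take_oversize// (size_history hn).
elim: i => [|i IHi] ni; first by rewrite take0.
have := hT _ ni; rewrite (BST_step hTD) hT; last exact: ltnW.
have hi := take_history hn ni.
have sh := size_history hn.
have e : take i.+1 h = rcons (take i h) (nth [::] h i) by rewrite -take_nth// sh.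
have /historiesS[h' [u [hE _ ul]]] := hi.
move: hE; rewrite e => /rcons_inj[eh' eu]; rewrite -eh' -eu in ul.
rewrite tree_of_rcons /history mkseqS -/(history i w) (IHi (ltnW ni)) => eT.
congr rcons; apply/esym.
have : rcons (nth [::] h i) false \in grow (tree_of (take i h)) (nth [::] h i).
  by rewrite in_grow eqxx orbT.
rewrite -eT in_grow (negbTE (rcons_leaf_notin _ ul)) /=.
by case/orP => /eqP/rcons_inj[].
Qed.

Lemma prob_cyl n h : h \in histories n -> P (cyl h) = ((n`!%:R)^-1)%:E.
Proof.
elim: n h => [|n IHn] h.
  rewrite inE => /eqP->; rewrite (_ : cyl [::] = setT) ?probability_setT ?invr1//.
  exact/seteqP.
move=> /historiesS[h' [u [-> hn ul]]].
rewrite cyl_rcons (cyl_past hn) (size_history hn) (BST_uniform hTD) -(cyl_past hn).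
rewrite IHn// (take_oversize (eq_leq (size_history hn))) ul (size_leaves hn) -EFinM.
by rewrite factS natrM invfM mulrC.
Qed.

Lemma uniq_histories n : uniq (histories n).
Proof.
elim: n => //= n IHn; apply: allpairs_uniq_dep => //.
  by move=> h _; exact: fset_uniq.
by move=> [h1 u1] [h2 u2] _ _ /= /rcons_inj[-> ->].
Qed.

(** Any set of histories defines an event, because there are only countably many
    finite sequences of words. *)
Lemma measurable_history_pred n (Y : set (seq word)) :
  measurable [set w | Y (history n w)].
Proof.
rewrite (_ : mkset _ = \bigcup_(h : seq word) [set w | history n w = h /\ Y h]).
  apply: countable_bigcupT_measurable; first exact: countableP.
  move=> h; have [Yh|nYh] := pselect (Y h); last first.
    by rewrite (_ : mkset _ = set0)//; apply/seteqP; split=> w //= -[].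
  have [sh|sh] := eqVneq (size h) n.
    rewrite (_ : mkset _ = cyl h); first exact: measurable_cyl.
    by apply/seteqP; split=> w; rewrite /cyl /= sh => // -[].
  rewrite (_ : mkset _ = set0)//; apply/seteqP; split=> w //= -[hw _].
  by move: sh; rewrite -hw size_mkseq eqxx.
apply/seteqP; split=> w /=; first by move=> Yw; exists (history n w).
by move=> [h _ [-> ]].
Qed.

Let union n := \big[setU/set0]_(h <- histories n) cyl h.

Let measurable_union n : measurable (union n).
Proof. by apply: bigsetU_measurable => h _; exact: measurable_cyl. Qed.

Let trivIset_cyl n : trivIset [set` histories n] cyl.
Proof.
move=> h1 h2 /= hn1 hn2 [w []]; rewrite /cyl /= (size_history hn1) (size_history hn2).
by move=> -> .
Qed.

Let integral_union n (g : seq word -> R) : (forall h, 0 <= g h) ->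
  (\int[P]_(w in union n) (g (history n w))%:E)%E = (Ex n g)%:E.
Proof.
move=> g0; rewrite ge0_integral_bigsetU//.
- transitivity (\sum_(h <- histories n) (g h * (n`!%:R)^-1)%:E)%E; last first.
    by rewrite sumEFin /Ex mulrC mulr_suml.
  apply: eq_big_seq => h hn.
  rewrite (eq_integral (cst (g h)%:E)); last first.
    by move=> w; rewrite inE /cyl /= (size_history hn) => ->.
  rewrite integral_cst; last exact: measurable_cyl.
  by rewrite [X in (_ * X)%E](prob_cyl hn) -EFinM.
- exact: measurable_cyl.
- exact: uniq_histories.
- apply: (measurable_funS measurableT) => //.
  by move=> _ Y _; rewrite setTI; exact: (measurable_history_pred n (fun h => Y (g h)%:E)).
- by move=> w _; rewrite lee_fin.
Qed.

(* The n! cylinders of the valid histories have total mass 1. *)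
Let prob_union n : P (~` union n) = 0%E.
Proof.
rewrite probability_setC//.
have := @integral_union n (fun=> 1) (fun _ => ler01).
rewrite Ex_cst (eq_integral (cst 1%:E))// integral_cst// mul1e => ->.
by rewrite subee.
Qed.

Lemma integral_history n (g : seq word -> R) : (forall h, 0 <= g h) ->
  (\int[P]_w (g (history n w))%:E)%E = (Ex n g)%:E.
Proof.
move=> g0; rewrite (ge0_negligible_integral (N := ~` union n))//; last exact: prob_union.
- by rewrite setDE setCK setTI integral_union.
- exact: measurableC.
- by move=> _ Y _; rewrite setTI; exact: (measurable_history_pred n (fun h => Y (g h)%:E)).
- by move=> w _; rewrite lee_fin.
Qed.

Lemma prob_history n (b : pred (seq word)) :
  P [set w | b (history n w)] = (Ex n (fun h => (b h)%:R))%:E.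
Proof.
rewrite -integral_history; last by move=> h; case: (b h).
rewrite -[X in P X]setIT -integral_indic//; last exact: (measurable_history_pred n b).
apply: eq_integral => w _; rewrite indicE; congr (_ %:R%:E).
by case: (boolP (b _)) => bw; [rewrite mem_set|rewrite memNset//; apply/negP].
Qed.

Lemma ae_history : {ae P, forall w, forall n, history n w \in histories n}.
Proof.
apply/ae_foralln => n; exists (~` union n); split=> //.
- exact: measurableC.
- exact: prob_union.
move=> w /= hw; apply: contra_not hw; rewrite /union -bigcup_seq => -[h /= hn].
by rewrite /cyl /= (size_history hn) => ->.
Qed.

Lemma profile_history k n w :
  profile R T k n w = hsum (history n w) (fun i => (i == k)%:R).
Proof.
rewrite /profile /hsum -tree_history.
transitivity (\sum_(u <- [fset u in leaves (T n w) | size u == k]%fset) 1 : R).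
  by rewrite big_const_seq count_predT iter_addr_0.
rewrite [RHS](bigID (fun u => size u == k))/= [X in _ = _ + X]big1 ?addr0.
  rewrite [RHS]big_fset_condE/=; apply: eq_big_seq => u.
  by rewrite in_fset inE => /andP[_ ->].
by move=> u /negbTE->.
Qed.

Lemma expectation_profile k n :
  fine ('E_P[profile R T k n])%E = (growth 0 n)`_k.
Proof.
rewrite unlock.
rewrite (eq_integral (fun w => (hsum (history n w) (fun i => (i == k)%:R : R))%:E)).
  rewrite (@integral_history n (fun h => hsum h (fun i => (i == k)%:R : R))).
    by rewrite Ex_profile.
  by move=> h; apply: sumr_ge0 => u _; case: (_ == _).
by move=> w _; rewrite profile_history.
Qed.

End Process.

(** * Almost sure bounds *)
Section AlmostSure.
Context (R : realType) (d : measure_display) (Omega : measurableType d)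
  (P : probability Omega R) (T : nat -> Omega -> {fset word})
  (D : nat -> Omega -> word) (hTD : BST_process P T D).
Implicit Types (n k m : nat) (h : seq word) (w : Omega).
Local Notation hist := (history D).
Local Notation C := (@BST_norm R).

(** Borel and Cantelli, for the summable bound 1 / ((n + 1) (n + 2)). *)
Lemma ae_eventually_not (b : nat -> pred (seq word)) (K : R) :
  (forall n, Ex n (fun h => (b n h)%:R) <= K * (n.+1%:R * n.+2%:R)^-1) ->
  {ae P, forall w, exists N, forall n, (N <= n)%N -> ~~ b n (hist n w)}.
Proof.
move=> hb; pose F n := [set w | b n (hist n w)].
have mF n : measurable (F n) by exact: (measurable_history_pred hTD n (b n)).
have K0 : 0 <= K.
  have h0 : 0 <= Ex 0 (fun h => (b 0%N h)%:R) :> R by rewrite Ex0; case: (b _ _).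
  by have := le_trans h0 (hb 0%N); rewrite pmulr_lge0 ?invr_gt0 ?mulr_gt0.
have sumF : (\sum_(0 <= n <oo) P (F n) < +oo)%E.
  apply: (@le_lt_trans _ _ K%:E); last exact: ltry.
  apply: lime_le; first exact: is_cvg_nneseries.
  apply: nearW => N; rewrite (eq_bigr (fun n => (Ex n (fun h => (b n h)%:R))%:E)); last first.
    by move=> n _; rewrite /F (prob_history hTD).
  rewrite sumEFin lee_fin; apply: le_trans (ler_sum _ (fun n _ => hb n)) _.
  rewrite -mulr_sumr -[leRHS]mulr1 ler_wpM2l//.
  suff : \sum_(0 <= n < N) (n.+1%:R * n.+2%:R)^-1 <= 1 - N.+1%:R^-1 :> R.
    have : 0 <= N.+1%:R^-1 :> R by rewrite invr_ge0.
    move: (N.+1%:R^-1) => x; lra.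
  elim: N => [|N IHN]; first by rewrite big_geq// invr1 subrr.
  rewrite big_nat_recr//=; apply: le_trans (lerD IHN (lexx _)) _.
  rewrite le_eqVlt; apply/orP; left; apply/eqP.
  rewrite -(natr1 N.+1) -(natr1 N); field.
  by rewrite !natr1 !pnatr_eq0.
exists (lim_sup_set F); split.
- by apply: bigcap_measurable => // n _; apply: bigcup_measurable => *; exact: mF.
- exact: lim_sup_set_cvg0.
- move=> w /=; apply: contra_notP => nw.
  have [N hN] : exists N, forall j, (N <= j)%N -> ~ F j w.
    apply: contra_notP nw => /forallNP h n _.
    have [j hj] := (iffRL (existsNP _)) (h n).
    move/not_implyP : hj => [nj /contrapT Fj]; by exists j.
  by exists N => n /hN /negP.
Qed.

Lemma ae_pgf_bounded (zeta : R) : 0 < zeta ->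
  {ae P, forall w, exists B : nat, forall n, pgf_bounded zeta B.+1%:R (hist n w)}.
Proof.
move=> z0; pose E (B : nat) n := [set w | ~~ pgf_bounded zeta (B.+1%:R : R) (hist n w)].
have mE B n : measurable (E B n).
  exact: (measurable_history_pred hTD n (fun h => ~~ pgf_bounded zeta (B.+1%:R : R) h)).
have mU B : measurable (\bigcup_n E B n) by exact: bigcup_measurable.
have homE B : {homo E B : n m / (n <= m)%N >-> (n <= m)%O}.
  apply/nondecreasing_seqP => n; apply/subsetPset => w; rewrite /E /=.
  by apply: contra; rewrite /history mkseqS pgf_bounded_rcons => /andP[].
have PU B : (P (\bigcup_n E B n) <= (B.+1%:R^-1)%:E)%E.
  have cE := @nondecreasing_cvg_mu _ _ _ P _ (mE B) (mU B) (@homE B).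
  rewrite -(cvg_lim _ cE)//; apply: lime_le; first by apply/cvg_ex; eexists; exact: cE.
  apply: nearW => n /=.
  by rewrite /E (prob_history hTD n (fun h => ~~ pgf_bounded zeta (B.+1%:R : R) h)) lee_fin ville// ler1n.
exists (\bigcap_B \bigcup_n E B n); split.
- exact: bigcap_measurable.
- apply/eqP; rewrite eq_le measure_ge0 andbT; apply/lee_addgt0Pr => e e0.
  rewrite add0e.
  have [B hB] : exists B : nat, B.+1%:R^-1 <= e.
    exists (Num.truncn e^-1); rewrite -[leRHS]invrK lef_pV2 ?posrE ?invr_gt0//.
    by rewrite ltW// truncnS_gt.
  apply: le_trans (_ : (P (\bigcup_n E B n) <= _)%E).
    by apply: le_measure; rewrite ?inE//; [exact: bigcap_measurable|apply: bigcap_inf].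
  by apply: le_trans (PU B) _; rewrite lee_fin.
- move=> w /=; apply: contra_notP => nw.
  have [B hB] : exists B, ~ (\bigcup_n E B n) w.
    by apply: contra_notP nw => /forallNP h B _; apply: contrapT (h B).
  exists B => n; apply/negPn/negP => hn; apply: hB; by exists n.
Qed.

Section Deviation.
Context (zm zp p B : R).
Context (zm0 : 0 < zm) (zmp : zm <= zp) (p1 : 1 <= p) (p2 : p <= 2) (B1 : 1 <= B).
(** The parameter z of [profile_deviation] may depend on n and k: both
    z = k / (2 ln n) and the constant z = zp are used below. *)
Context (zf : nat -> nat -> R) (zfm : forall n k, zm <= zf n k) (zfp : forall n k, zf n k <= zp).
Context (gap0 : 0 <= gap zm zp p).
Local Notation zeta := (expR (p * ln zp)).
Local Notation gap := (gap zm zp p).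
Local Notation gapc := (gap_const zm zp p B).

Definition admissible n m := gapc ^+ 2 * (1 + 2 * harm n) <= expR (gap * ln m.+1%:R).

Definition dev_bound n m k : R :=
  (1 + 6 * ln n.+1%:R) / expR (gap / 2 * ln m.+1%:R) * (C n (zf n k) / zf n k ^+ k).

(** With 6 ln (n + 1) in the deviation, each triple (n, m, k) fails with
    probability at most 2 (n + 1)^-6, and there are (n + 1)^2 pairs (m, k). *)
Lemma ae_profile_deviation : {ae P, forall w,
  (forall n, pgf_bounded zeta B (hist n w)) ->
  exists N, forall n k m, (N <= n)%N -> (k <= n)%N -> (m <= n)%N -> admissible n m ->
  `|profile R T k n w - cond_profile n k m (hist m w)| <= dev_bound n m k}.
Proof.
pose dev n m k h := [&& admissible n m, pgf_bounded zeta B h &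
  dev_bound n m k <= `|hsum h (fun d => (d == k)%:R) - cond_profile n k m (take m h)|].
pose b n : pred (seq word) := fun h => has (fun m => has (fun k => dev n m k h) (iota 0 n.+1)) (iota 0 n.+1).
have hb n : Ex n (fun h => (b n h)%:R) <= 4 * (n.+1%:R * n.+2%:R)^-1 :> R.
  have has_le (s : seq nat) (a : nat -> bool) : (has a s)%:R <= \sum_(i <- s) (a i)%:R :> R.
    elim: s => [|x s IHs]; first by rewrite big_nil.
    rewrite big_cons /=; case: (a x) => /=; last by rewrite add0r.
    by rewrite lerDl sumr_ge0// => i _; case: (a i).
  apply: le_trans (_ : \sum_(m <- iota 0 n.+1) \sum_(k <- iota 0 n.+1)
     Ex n (fun h => (dev n m k h)%:R) <= _).
    under eq_bigr do rewrite -Ex_sum.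
    rewrite -Ex_sum; apply: le_Ex => h _; apply: le_trans (has_le _ _) _.
    by apply: ler_sum => m _; exact: has_le.
  have term m k : (m <= n)%N -> Ex n (fun h => (dev n m k h)%:R) <= 2 * (n.+1%:R ^+ 6)^-1 :> R.
    move=> mn; have [ha|nha] := boolP (admissible n m); last first.
      rewrite (@eq_Ex _ _ _ (fun=> 0)) ?Ex_cst ?mulr_ge0 ?invr_ge0 ?exprn_ge0//.
      by move=> h _; rewrite /dev (negbTE nha).
    have := @profile_deviation R zm zp p B zm0 zmp p1 p2 B1 n m k (zf n k)
      ((1 + 6 * ln n.+1%:R) / expR (gap / 2 * ln m.+1%:R)) (zfm n k) (zfp n k) mn gap0 ha.
    rewrite divfK ?gt_eqF ?expR_gt0// opprD addrA subrr add0r.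
    rewrite expRN expRM_natl lnK ?posrE//; apply: le_trans.
    by apply: le_Ex => h _; rewrite /dev ha.
  have term' : \sum_(m <- iota 0 n.+1) \sum_(k <- iota 0 n.+1) Ex n (fun h => (dev n m k h)%:R)
      <= \sum_(m <- iota 0 n.+1) \sum_(k <- iota 0 n.+1) 2 * (n.+1%:R ^+ 6)^-1 :> R.
    rewrite big_seq [leRHS]big_seq; apply: ler_sum => m; rewrite mem_iota add0n ltnS => mn.
    by apply: ler_sum => k _; exact: term.
  apply: le_trans term' _.
  rewrite !big_const_seq !count_predT !iter_addr_0 size_iota -mulrnA -[_ *+ _]mulr_natr natrM.
  set a : R := n.+1%:R; have -> : n.+2%:R = a + 1 :> R by rewrite /a -natr1.
  have a1 : 1 <= a by rewrite /a ler1n.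
  have a0 : 0 < a by lra.
  have -> : 2 / a ^+ 6 * (a * a) = 2 / a ^+ 4 by field; rewrite gt_eqF.
  rewrite ler_pdivrMr ?exprn_gt0// mulrAC ler_pdivlMr ?mulr_gt0//; last lra.
  have a3 : 1 <= a ^+ 2 by rewrite exprn_ege1.
  have -> : a ^+ 4 = a ^+ 2 * a ^+ 2 by rewrite -exprD.
  have a4 : a <= a ^+ 2 by rewrite expr2 ler_peMl// ltW.
  rewrite expr2 in a3 a4 *; nra.
have := ae_eventually_not hb.
apply: filterS => w [N hN] hw; exists N => n k m Nn kn mn ha.
rewrite leNgt; apply/negP => /ltW hlt.
have /hasPn/(_ m) := hN n Nn; rewrite mem_iota add0n ltnS mn => /(_ isT)/hasPn/(_ k).
rewrite mem_iota add0n ltnS kn => /(_ isT); rewrite /dev ha hw/=.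
rewrite -(profile_history hTD) (take_historyE D w mn) => /negP; exact.
Qed.

End Deviation.
End AlmostSure.

(** * The conditional profile at an early time *)
Section Ratio.
Context {R : realType}.
Implicit Types (n m k d j : nat) (h : seq word) (z s e : R).
Local Notation C := (@BST_norm R).
Local Notation H := (@harm R).

Lemma size_leaf n h u : h \in histories n -> u \in leaves (tree_of h) -> (size u <= n)%N.
Proof.
elim: n h u => [|n IHn] h u.
  by rewrite inE => /eqP->; rewrite /tree_of /= leaves_root inE => /eqP->.
move=> /historiesS[h' [v [-> hn vl]]].
rewrite tree_of_rcons leaves_grow//; last exact: history_prefix_closed hn.
rewrite !in_fset1U in_fsetD1 => /or3P[/eqP->|/eqP->|/andP[_ ul]].
- by rewrite size_rcons ltnS (IHn _ _ hn vl).
- by rewrite size_rcons ltnS (IHn _ _ hn vl).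
- exact: leq_trans (IHn _ _ hn ul) (leqnSn n).
Qed.

Lemma Ex_pgf n z : Ex n (fun h => pgf h z) = C n z.
Proof.
elim: n => [|n IHn]; first by rewrite Ex0 /pgf hsum_nil expr0 /BST_norm big_geq.
rewrite ExS BST_normS -IHn mulrC -ExZ; apply: eq_Ex => h hn.
by rewrite (mean_pgf _ hn) mulrC.
Qed.

Lemma Ex_cond_profile n k m : (m <= n)%N -> Ex m (cond_profile n k m) = (growth 0 n)`_k :> R.
Proof.
move=> mn; rewrite /cond_profile (@Ex_hsum R m (profile_weight n k)).
  by rewrite /profile_weight leq0n subn0.
by move=> t d tm; apply: profile_weight_rec; exact: leq_trans tm mn.
Qed.

Lemma sum_profile n h z : h \in histories n ->
  \sum_(0 <= k < n.+1) z ^+ k * hsum h (fun d => (d == k)%:R) = pgf h z.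
Proof.
move=> hn; under eq_bigr do rewrite /hsum mulr_sumr.
rewrite exchange_big/= /pgf /hsum; apply: eq_big_seq => u ul.
have su := size_leaf hn ul.
rewrite (bigD1_seq (size u)) ?iota_uniq ?mem_index_iota//=.
rewrite eqxx mulr1 big1 ?addr0// => k kn.
by rewrite eq_sym (negbTE kn) mulr0.
Qed.

Lemma sum_cond_profile n m h z : (m <= n)%N -> h \in histories m ->
  \sum_(0 <= k < n.+1) z ^+ k * cond_profile n k m h = pgf h z * (growth m n).[z].
Proof.
move=> mn hm; under eq_bigr do rewrite /cond_profile /hsum mulr_sumr.
rewrite exchange_big/= /pgf /hsum mulr_suml; apply: eq_big_seq => u ul.
have su := leq_trans (size_leaf hm ul) mn.
rewrite (big_cat_nat (leq0n (size u)) (leqW su))/=.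
rewrite big_nat big1 ?add0r; last first.
  by move=> k /andP[_ ku]; rewrite /profile_weight leqNgt ku mulr0.
rewrite (@horner_growthE _ m n (n - size u)); last first.
  by rewrite leq_sub2l// (size_leaf hm ul).
rewrite -{1}[size u]add0n big_addn subSn// mulr_sumr; apply: eq_bigr => l _.
by rewrite /profile_weight leq_addl addnK exprD; ring.
Qed.

(** Going from index k down to k - d multiplies the coefficient of [growth m n]
    by at least (k (k-1) ... (k-d+1)) / p_1^d, where p_1 <= 2 ln n, and by at most
    (k / q)^d, where q is close to 2 ln n; both are close to z^d. *)
Lemma profile_weight_bounds n m k d (r x z : R) : (1 < m)%N -> (m <= n)%N -> (0 < k)%N ->
  let q := psum1 m n - 8 * r in 0 <= r -> 0 < q -> k%:R <= r * q ->
  0 < x -> x = ln n%:R -> z = k%:R / (2 * x) ->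
  (growth m n)`_k * (z ^+ d * (1 - d%:R ^+ 2 / k%:R)) <= profile_weight n k m d
  <= (growth m n)`_k * (z * (2 * x / q)) ^+ d.
Proof.
move=> m1 mn k0 q r0 q0 kq x0 xE zE; have m0 := ltnW m1.
have kR : 0 < k%:R :> R by rewrite ltr0n.
have z0 : 0 < z by rewrite zE divr_gt0 ?mulr_gt0.
have a0 := coef_growth_ge0 m n k (R := R).
have zs : z * (2 * x / q) = k%:R / q by rewrite zE; field; rewrite !gt_eqF.
have kE : k%:R = z * (2 * x) by rewrite zE divfK// gt_eqF// mulr_gt0.
rewrite /profile_weight; case: leqP => dk; apply/andP; split.
- have h1 := coef_growth_front n m0 dk (R := R).
  have h2 := @ffact_ge R _ _ dk.
  have p1 : psum1 m n <= 2 * x by rewrite xE; exact: psum1_le_ln.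
  have p0 : 0 <= psum1 m n :> R by rewrite /psum1 sumr_ge0// => i _; rewrite divr_ge0.
  have x2 : 0 < (2 * x) ^+ d by rewrite exprn_gt0// mulr_gt0.
  rewrite -(ler_pM2l x2).
  apply: le_trans (_ : psum1 m n ^+ d * (growth m n)`_(k - d) <= _); last first.
    by rewrite ler_wpM2r ?coef_growth_ge0// lerXn2r ?nnegrE// (le_trans p0).
  apply: le_trans h1.
  have -> : (2 * x) ^+ d * ((growth m n)`_k * (z ^+ d * (1 - d%:R ^+ 2 / k%:R))) =
    (k%:R ^+ d * (k%:R - d%:R ^+ 2)) / k%:R * (growth m n)`_k.
    have -> : k%:R ^+ d = z ^+ d * (2 * x) ^+ d by rewrite [in LHS]kE exprMn.
    by move: (z ^+ d) ((2 * x) ^+ d) => a b; field; rewrite gt_eqF.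
  by rewrite ler_wpM2r// ler_pdivrMr// [leRHS]mulrC.
- have := coef_growth_back m0 dk r0 q0 kq; rewrite -/q zs expr_div_n => h.
  by rewrite mulrA ler_pdivlMr ?exprn_gt0// mulrC [leRHS]mulrC.
- rewrite mulr_ge0_le0// mulr_ge0_le0 ?exprn_ge0 ?(ltW z0)//.
  rewrite subr_le0 ler_pdivlMr// mul1r -natrX ler_nat.
  by rewrite (leq_trans (ltnW dk))// -{1}(expn1 d) leq_pexp2l// (leq_ltn_trans _ dk).
- by rewrite mulr_ge0// exprn_ge0// zs divr_ge0 ?ltW.
Qed.

(** Since (e d)^2 / 2 <= exp (e d), second moments of the depth are controlled by
    the generating function at the slightly larger point z exp e. *)
Lemma sqr_pow_le d z e : 0 < z -> 0 < e ->
  d%:R ^+ 2 * z ^+ d <= 2 / e ^+ 2 * (z * expR e) ^+ d.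
Proof.
move=> z0 e0; rewrite exprMn mulrCA [leLHS]mulrC ler_wpM2l ?exprn_ge0 ?(ltW z0)//.
rewrite -expRM_natl mulrAC ler_pdivlMr ?exprn_gt0// -exprMn.
have := @expR_ge1Dxn R (d%:R * e) 1 (mulr_ge0 (ler0n _ _) (ltW e0)).
rewrite -[2`!]/2%N; set y := (_ ^+ 2) => h; lra.
Qed.

Definition spread_const z : R := 2 * expR (3 + 6 * z).

(** [sqr_pow_le] with e = 1 / (1 + H_m), for which C_m(z exp e) is still of
    order C_m(z). *)
Lemma Ex_second_moment m z : 0 < z ->
  Ex m (fun h => hsum h (fun d => d%:R ^+ 2 * z ^+ d)) <=
  spread_const z * (1 + H m) ^+ 2 * C m z.
Proof.
move=> z0; set e := (1 + H m)^-1.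
have H0 : 0 <= H m by exact: harm_ge0.
have e0 : 0 < e by rewrite invr_gt0 ltr_wpDr.
have e1 : e <= 1 by rewrite /e invf_le1 ?ltr_wpDr// lerDl.
apply: le_trans (_ : Ex m (fun h => 2 / e ^+ 2 * pgf h (z * expR e)) <= _).
  apply: le_Ex => h _; rewrite /pgf /hsum mulr_sumr; apply: ler_sum => u _.
  exact: sqr_pow_le.
rewrite ExZ Ex_pgf.
have s1 : 1 <= expR e by rewrite -expR0 ler_expR ltW.
have c0 : 0 <= 2 / e ^+ 2 by rewrite divr_ge0 ?exprn_ge0// ltW.
apply: le_trans (ler_wpM2l c0 (BST_norm_scale m z0 s1)) _.
have -> : spread_const z * (1 + H m) ^+ 2 * C m z = 2 / e ^+ 2 * (C m z * expR (3 + 6 * z)).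
  by rewrite /spread_const /e exprVn invrK; ring.
rewrite ler_wpM2l// ler_wpM2l ?(ltW (BST_norm_gt0 _ z0))// ler_expR.
have q := @expR_le_quadratic R e; rewrite ger0_norm ?(ltW e0)// in q.
have e2 : e ^+ 2 <= e by rewrite expr2 ler_piMl// ltW.
have h1 : expR e - 1 <= 3 * e by have := q e1; lra.
have eH : e * H m <= 1 by rewrite /e mulrC ler_pdivrMr ?ltr_wpDr// mul1r lerDr.
have h2 : 0 <= 1 + 2 * z * H m by rewrite addr_ge0// !mulr_ge0// ltW.
apply: le_trans (ler_wpM2r h2 h1) _.
have : 2 * z * (e * H m) <= 2 * z * 1 by rewrite ler_wpM2l// mulr_ge0// ltW.
lra.
Qed.

Definition mean_const (zp : R) : R :=
  4 * expR 1 * expR ((1 + 2 * zp + 16 * zp ^+ 2) ^+ 2) * zp.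

(** The factor i = 0 of C_n is 2 X, so that E U_k(n) is twice the coefficient of
    index k - 1 of [growth 1 n], to which [horner_growth_le_coef] applies with
    r = 2 zp. *)
Lemma mean_profile_ge n k (zp x z : R) : (0 < n)%N -> 0 < x -> x = ln n%:R ->
  z = k%:R / (2 * x) -> z <= zp -> 16 * zp <= x -> 2 + 16 * zp ^+ 2 <= k%:R ->
  C n z / z ^+ k <= mean_const zp * x * (growth 0 n)`_k.
Proof.
move=> n0 x0 xE zE zzp xbig kbig.
have kE : k%:R = z * (2 * x) by rewrite zE divfK// gt_eqF// mulr_gt0.
have zp2 : 0 <= zp ^+ 2 by exact: sqr_ge0.
have k1 : (1 < k)%N by rewrite -(ltr_nat R); lra.
have z0 : 0 < z by rewrite zE divr_gt0 ?mulr_gt0// ltr0n ltnW.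
have zp0 : 0 < zp by exact: lt_le_trans zzp.
have pge : 2 * x <= psum1 1 n by have := @psum1_ge R 1 n isT n0; rewrite ln1 subr0 xE.
have ple : psum1 1 n <= 2 * (1 + x).
  by have := @psum1_le R 1 n isT n0; rewrite ln1 subr0 invr1 xE.
pose r := 2 * zp; pose q := psum1 1 n - 8 * r; pose p : R := psum1 1 n.
have rE : r = 2 * zp by []. have qE : q = p - 16 * zp by rewrite /q /p rE; ring.
have q0 : x <= q by rewrite qE /p; lra.
have kS : k.-1.+1 = k by rewrite prednK// ltnW.
have kR : k.-1%:R = k%:R - 1 :> R by rewrite -[in RHS]kS -(natr1 k.-1) addrK.
have bc y : z * y <= k%:R + 2 * z -> k%:R - 16 * zp ^+ 2 <= z * y ->
    (z * y - k.-1%:R) ^+ 2 <= (1 + 2 * zp + 16 * zp ^+ 2) ^+ 2 * (z * y).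
  move=> y1 y2; have zy1 : 1 <= z * y by lra.
  apply: le_trans (_ : (1 + 2 * zp + 16 * zp ^+ 2) ^+ 2 <= _); last first.
    by rewrite ler_peMr// sqr_ge0.
  rewrite kR -subr_ge0 subr_sqr mulr_ge0//; move: zzp zp0 zp2 y1 y2; lra.
have kz : k%:R <= 2 * zp * x by rewrite kE mulrCA mulrA ler_wpM2r ?(ltW x0)// ler_wpM2l.
have h := @horner_growth_le_coef R n k.-1 r z ((1 + 2 * zp + 16 * zp ^+ 2) ^+ 2).
have zz : z * zp <= zp ^+ 2 by rewrite expr2 ler_wpM2r// ltW.
have {}h : (growth 1 n).[z] <= 2 * (expR 1 * k.-1%:R * expR ((1 + 2 * zp + 16 * zp ^+ 2) ^+ 2)) *
    (z ^+ k.-1 * (growth 1 n)`_k.-1).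
  apply: h; rewrite -/q -/p ?ltn_predRL//.
  - by rewrite rE mulr_ge0// ltW.
  - exact: lt_le_trans q0.
  - have : r * x <= r * q by rewrite ler_wpM2l// rE mulr_ge0// ltW.
    rewrite kR rE; lra.
  - apply: bc; rewrite qE /p; nra.
  - apply: bc; rewrite /p; nra.
have e0 : (growth 0 n)`_k = 2 * (growth 1 n)`_k.-1 :> R.
  by rewrite growthSl// -kS coef_factorMS mul0r add0r divr1.
have eC : C n z = 2 * z * (growth 1 n).[z].
  by rewrite -horner_growth0 growthSl// hornerM horner_factor add0r divr1.
rewrite e0 eC ler_pdivrMr ?exprn_gt0//.
apply: le_trans (ler_wpM2l _ h) _; first by rewrite mulr_ge0// ltW.
have -> : z ^+ k = z * z ^+ k.-1 by rewrite -exprS kS.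
have a0 := coef_growth_ge0 1 n k.-1 (R := R).
have zk : 0 <= z ^+ k.-1 by rewrite exprn_ge0// ltW.
rewrite /mean_const; set e := expR (_ ^+ 2).
have -> : 2 * z * (2 * (expR 1 * k.-1%:R * e) * (z ^+ k.-1 * (growth 1 n)`_k.-1)) =
  4 * expR 1 * e * (z * z ^+ k.-1 * (growth 1 n)`_k.-1) * k.-1%:R by ring.
have -> : 4 * expR 1 * e * zp * x * (2 * (growth 1 n)`_k.-1) * (z * z ^+ k.-1) =
  4 * expR 1 * e * (z * z ^+ k.-1 * (growth 1 n)`_k.-1) * (2 * zp * x) by ring.
rewrite ler_wpM2l//; last by rewrite kR; lra.
by rewrite !mulr_ge0 ?expR_ge0// ltW.
Qed.

(** Summed over the leaves of T_m, [profile_weight_bounds] shows that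
    [cond_profile n k m h] is close to the coefficient a of X^k in [growth m n]
    times S_m(z).  Averaged over histories, it shows that E U_k(n) is close to
    a C_m(z); this is where the second moment of the depths appears.  The factor
    a drops out of the quotient. *)
Lemma cond_profile_ratio n m k h (r x z e dmax : R) : h \in histories m ->
  (1 < m)%N -> (m <= n)%N -> (0 < k)%N ->
  let q := psum1 m n - 8 * r in 0 <= r -> 0 < q -> q <= 2 * x -> k%:R <= r * q ->
  0 < x -> x = ln n%:R -> z = k%:R / (2 * x) ->
  (forall u, u \in leaves (tree_of h) -> (size u)%:R <= dmax) -> 0 <= dmax ->
  0 <= e -> e <= 2^-1 ->
  dmax ^+ 2 <= e * k%:R -> dmax * (2 * x / q - 1) <= e ->
  spread_const z * (1 + H m) ^+ 2 <= e * k%:R ->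
  (2 * x / q - 1) * (1 + 2 * z * H m) <= e ->
  0 < (growth m n)`_k :> R ->
  `|cond_profile n k m h / (growth 0 n)`_k - pgf h z / C m z| <= 6 * e * (pgf h z / C m z).
Proof.
move=> hm m1 mn k0 q r0 q0 qx kq x0 xE zE hd d0 e0 e12 c1 c2 c3 c4 a0.
have kR : 0 < k%:R :> R by rewrite ltr0n.
have z0 : 0 < z by rewrite zE divr_gt0 ?mulr_gt0.
set s := 2 * x / q; pose a : R := (growth m n)`_k; rewrite -/a in a0.
have s1 : 1 <= s by rewrite /s ler_pdivlMr// mul1r.
have wb d := profile_weight_bounds d m1 mn k0 r0 q0 kq x0 xE zE.
have cm := BST_norm_gt0 m z0.
have H0 : 0 <= H m by exact: harm_ge0.
have pg0 : 0 <= pgf h z by rewrite pgf_ge0// ltW.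
have mean_le : (growth 0 n)`_k <= a * (C m z * expR e).
  rewrite -(Ex_cond_profile k mn); apply: le_trans (_ : Ex m (fun h => a * pgf h (z * s)) <= _).
    apply: le_Ex => h' _; rewrite /pgf /cond_profile /hsum mulr_sumr; apply: ler_sum => u _.
    by have /andP[] := wb (size u).
  rewrite ExZ Ex_pgf ler_wpM2l ?(ltW a0)//; apply: le_trans (BST_norm_scale m z0 s1) _.
  by rewrite ler_wpM2l ?(ltW cm)// ler_expR.
have mean_ge : a * (C m z * (1 - e)) <= (growth 0 n)`_k.
  rewrite -(Ex_cond_profile k mn).
  apply: le_trans (_ : Ex m (fun h => a * (pgf h z + (- k%:R^-1) * hsum h (fun d => d%:R ^+ 2 * z ^+ d))) <= _); last first.
    apply: le_Ex => h' _; rewrite /pgf /cond_profile /hsum mulr_sumr -big_split/= mulr_sumr.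
    apply: ler_sum => u _; have /andP[+ _] := wb (size u); apply: le_trans.
    by rewrite le_eqVlt; apply/orP; left; apply/eqP; rewrite -/a; field; rewrite gt_eqF.
  rewrite ExZ ExD ExZ Ex_pgf ler_wpM2l ?(ltW a0)// mulrBr mulr1 mulNr lerD2l lerN2.
  rewrite mulrC ler_pdivrMr//; apply: le_trans (Ex_second_moment m z0) _.
  have := ler_wpM2r (ltW cm) c3; rewrite -[e * _ * _]mulrA => /le_trans; apply.
  by rewrite le_eqVlt; apply/orP; left; apply/eqP; ring.
have cond_le : cond_profile n k m h <= a * (pgf h z * expR e).
  rewrite /pgf /cond_profile /hsum mulr_suml mulr_sumr.
  rewrite big_seq [leRHS]big_seq; apply: ler_sum => u ul.
  have /andP[_] := wb (size u); rewrite -/s -/a => /le_trans; apply.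
  rewrite ler_wpM2l ?(ltW a0)// exprMn ler_wpM2l ?exprn_ge0 ?(ltW z0)//.
  apply: le_trans (_ : expR ((size u)%:R * (s - 1)) <= _).
    rewrite expRM_natl lerXn2r ?nnegrE ?expR_ge0//; first exact: le_trans s1.
    by rewrite -[leLHS](subrKC 1) expR_ge1Dx.
  rewrite ler_expR; apply: le_trans c2; rewrite ler_wpM2r ?subr_ge0// hd//.
have cond_ge : a * (pgf h z * (1 - e)) <= cond_profile n k m h.
  rewrite /pgf /cond_profile /hsum mulr_suml mulr_sumr.
  rewrite big_seq [leRHS]big_seq; apply: ler_sum => u ul.
  have /andP[+ _] := wb (size u); apply: le_trans; rewrite -/a.
  rewrite ler_wpM2l ?(ltW a0)// ler_wpM2l ?exprn_ge0 ?(ltW z0)// lerD2l lerN2.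
  rewrite ler_pdivrMr//; apply: le_trans c1.
  by rewrite lerXn2r ?nnegrE// hd.
have A0 : 0 < (growth 0 n)`_k :> R.
  apply: lt_le_trans mean_ge; rewrite !mulr_gt0// subr_gt0; lra.
have ee : expR e <= 1 + 2 * e.
  have := @expR_le_quadratic R e; rewrite ger0_norm// => /(_ (le_trans e12 _)) h1.
  by apply: le_trans (h1 _) _; nra.
set M := pgf h z / C m z.
have M0 : 0 <= M by rewrite divr_ge0// ltW.
have pgM : pgf h z = M * C m z by rewrite /M divfK// gt_eqF.
have aC : 0 < a * C m z by rewrite mulr_gt0.
rewrite pgM in cond_le cond_ge.
have {}cond_le := le_trans cond_le (ler_wpM2l (ltW a0) (ler_wpM2l (mulr_ge0 M0 (ltW cm)) ee)).
have {}mean_le := le_trans mean_le (ler_wpM2l (ltW a0) (ler_wpM2l (ltW cm) ee)).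
rewrite ler_norml; apply/andP; split.
  rewrite lerBrDl ler_pdivlMr//; apply: le_trans cond_ge.
  have h1 : (M - 6 * e * M) * (growth 0 n)`_k <= (M * (1 - 6 * e)) * (growth 0 n)`_k by lra.
  have [e6|e6] := leP 0 (1 - 6 * e).
    apply: le_trans (_ : M * (1 - 6 * e) * (a * (C m z * (1 + 2 * e))) <= _).
      have := ler_wpM2l (mulr_ge0 M0 e6) mean_le; lra.
    have : 0 <= M * (a * C m z) by rewrite mulr_ge0// ltW.
    move=> y0; rewrite -subr_ge0.
    have -> : a * (M * C m z * (1 - e)) - M * (1 - 6 * e) * (a * (C m z * (1 + 2 * e))) =
      M * (a * C m z) * (3 * e + 12 * e ^+ 2) by ring.
    by rewrite mulr_ge0// addr_ge0 ?mulr_ge0 ?exprn_ge0.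
  apply: le_trans (_ : 0 <= _).
    by apply: le_trans h1 _; rewrite mulr_le0_ge0 ?(ltW A0)// mulr_ge0_le0// ltW.
  have e1 : 0 <= 1 - e by move: e12; lra.
  exact: mulr_ge0 (ltW a0) (mulr_ge0 (mulr_ge0 M0 (ltW cm)) e1).
rewrite lerBlDr ler_pdivrMr//; apply: le_trans cond_le _.
have Mp : 0 <= 6 * e * M + M.
  exact: addr_ge0 (mulr_ge0 (mulr_ge0 (ler0n _ 6) e0) M0) M0.
apply: le_trans (ler_wpM2l Mp mean_ge); rewrite -subr_ge0.
have -> : (6 * e * M + M) * (a * (C m z * (1 - e))) - a * (M * C m z * (1 + 2 * e)) =
  M * (a * C m z) * (6 * e * (2^-1 - e)) by field.
have e1 : 0 <= 2^-1 - e by rewrite subr_ge0.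
exact: mulr_ge0 (mulr_ge0 M0 (ltW aC)) (mulr_ge0 (mulr_ge0 (ler0n _ 6) e0) e1).
Qed.

End Ratio.

(** * Uniform convergence of the martingale *)
Section UniformConvergence.
Context {R : realType}.
Implicit Types (n m k N : nat) (z : R).
Local Notation C := (@BST_norm R).
Local Notation H := (@harm R).

Lemma sum_geometric_le (rho : R) N : 0 <= rho -> rho < 1 ->
  \sum_(0 <= k < N) rho ^+ k <= (1 - rho)^-1.
Proof.
move=> r0 r1; rewrite -[leRHS]mul1r ler_pdivlMr ?subr_gt0// big_mkord mulrC.
have := subrX1 rho N; set S := \sum_(i < N) _ => h.
have -> : (1 - rho) * S = 1 - rho ^+ N by rewrite -[RHS]opprB h -mulNr opprB.
by rewrite gerBl exprn_ge0.
Qed.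

Lemma ln_ge_eventually (Y : R) : exists N, forall n, (N <= n)%N -> Y <= ln n%:R.
Proof.
exists (Num.truncn (expR Y)).+1 => n Nn; rewrite -[Y]expRK ler_ln ?posrE ?expR_gt0//.
  by apply: le_trans (ltW (truncnS_gt _)) _; rewrite ler_nat.
by rewrite ltr0n (leq_trans _ Nn).
Qed.

(** From m, the index n is reached by doublings, and at each of them
    (2 m + 1) / (m + 1) >= 3 / 2 makes the bound decrease geometrically. *)
Lemma dyadic_chain (f : nat -> R) (K del : R) N : 0 < del -> 0 <= K -> (0 < N)%N ->
  (forall m n, (N <= m)%N -> (m <= n)%N -> (n <= m.*2)%N ->
     `|f n - f m| <= K * expR (- del * ln m.+1%:R)) ->
  forall m n, (N <= m)%N -> (m <= n)%N ->
    `|f n - f m| <= K / (1 - expR (- del * ln (3 / 2))) * expR (- del * ln m.+1%:R).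
Proof.
move=> d0 K0 N0 hf m n; set rho := expR (- del * ln (3 / 2)).
have l32 : 0 < ln (3 / 2) :> R by apply: ln_gt0; lra.
have r1 : rho < 1 by rewrite /rho expR_lt1 mulNr oppr_lt0 mulr_gt0.
have r10 : 0 < 1 - rho by rewrite subr_gt0.
have K1 : K <= K / (1 - rho).
  by rewrite ler_pdivlMr// ler_piMr// gerBl expR_ge0.
have [j nj] := ubnP (n - m)%N; elim: j m nj => // j IHj m nj Nm mn.
have [n2|n2] := leqP n m.*2.
  by apply: le_trans (hf _ _ Nm mn n2) _; rewrite ler_wpM2r// expR_ge0.
have m0 : (0 < m)%N by exact: leq_trans Nm.
have h1 := hf m m.*2 Nm (_ : (m <= m.*2)%N) (leqnn _).
have {}h1 : `|f m.*2 - f m| <= K * expR (- del * ln m.+1%:R) by apply: h1; lia.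
have h2 : `|f n - f m.*2| <= K / (1 - rho) * expR (- del * ln m.*2.+1%:R).
  by apply: IHj; lia.
have h3 : expR (- del * ln m.*2.+1%:R) <= rho * expR (- del * ln m.+1%:R).
  rewrite /rho -expRD ler_expR -mulrDr !mulNr lerN2 ler_wpM2l ?(ltW d0)//.
  have m1 : 0 < m.+1%:R :> R by rewrite ltr0n.
  have m3 : 0 < 3 / 2 :> R by lra.
  rewrite -(@lnM _ (3 / 2))// ler_ln ?posrE ?(mulr_gt0 m3 m1)//.
  have : 1 <= m%:R :> R by rewrite ler1n.
  rewrite -muln2 -(natr1 m) -(natr1 (m * 2)) natrM; lra.
have -> : f n - f m = (f n - f m.*2) + (f m.*2 - f m) by rewrite addrA subrK.
apply: le_trans (ler_normD _ _) _; apply: le_trans (lerD h2 h1) _.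
have c0 : 0 <= K / (1 - rho) by rewrite divr_ge0// ltW.
apply: le_trans (lerD (ler_wpM2l c0 h3) (lexx _)) _.
rewrite mulrA -mulrDl ler_wpM2r ?expR_ge0// le_eqVlt; apply/orP; left; apply/eqP.
by field; rewrite gt_eqF.
Qed.

Lemma cauchy_bound_cvg (f : nat -> R) (K del : R) N : 0 < del -> 0 <= K ->
  (forall m n, (N <= m)%N -> (m <= n)%N ->
    `|f n - f m| <= K * expR (- del * ln m.+1%:R)) ->
  forall m, (N <= m)%N -> `|limn f - f m| <= K * expR (- del * ln m.+1%:R).
Proof.
move=> d0 K0 hf.
have fc : cvgn f.
  apply/cauchy_cvgP/cauchy_exP => e e0.
  have Ke : 0 < (K + 1) / e by rewrite divr_gt0// ltr_wpDl.
  have [N1 hN1] := ln_ge_eventually (ln ((K + 1) / e) / del).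
  exists (f (maxn N N1)); exists (maxn N N1) => // n /= hn.
  rewrite /ball /= distrC; apply: le_lt_trans (hf _ _ (leq_maxl _ _) hn) _.
  apply: le_lt_trans (_ : K * (e / (K + 1)) < _); last first.
    by rewrite mulrCA gtr_pMr// ltr_pdivrMr ?mul1r ?ltrDl// ltr_wpDl.
  rewrite ler_wpM2l// -[e / _]invf_div -[leRHS]lnK ?posrE ?invr_gt0// ler_expR lnV ?posrE//.
  rewrite mulNr lerN2 [leRHS]mulrC -ler_pdivrMr// hN1//.
  exact: leq_trans (leq_maxr _ _) (leqnSn _).
move=> m Nm; rewrite ler_norml; apply/andP; split.
  rewrite lerBrDl; apply: limr_ge => //; near=> n.
  have := hf m n Nm; rewrite ler_norml => /(_ _)/andP[].
    by near: n; exact: nbhs_infty_ge.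
  by move=> h _; lra.
rewrite lerBlDr; apply: limr_le => //; near=> n.
have := hf m n Nm; rewrite ler_norml => /(_ _)/andP[].
  by near: n; exact: nbhs_infty_ge.
by move=> _ h; lra.
Unshelve. all: by end_near.
Qed.

(** The difference is the sum over k <= n of z^k / C_n(z) times the deviations in
    the hypothesis.  They are in units of C_n(zp) / zp^k, which makes the sum
    geometric with ratio at most z1 / zp < 1. *)
Lemma martingale_increment_le n m (h h' : seq word) (zm z1 zp kap z : R) :
  0 < zm -> z1 < zp -> (m <= n)%N -> h \in histories n -> h' \in histories m ->
  zm <= z -> z <= z1 -> 0 <= kap ->
  (forall k, (k <= n)%N -> `|hsum h (fun d => (d == k)%:R) - cond_profile n k m h'|
     <= kap * (C n zp / zp ^+ k)) ->
  `|pgf h z / C n z - pgf h' z / C m z| <= kap * (C n zp / C n zm) * (1 - z1 / zp)^-1.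
Proof.
move=> zm0 z1p mn hn hm zmz zz1 kap0 hU.
have z0 : 0 < z by exact: lt_le_trans zmz.
have zp0 : 0 < zp by apply: lt_trans z1p; exact: lt_le_trans zz1.
have rho0 : 0 <= z1 / zp by rewrite divr_ge0 ?ltW//; exact: lt_le_trans zz1.
have rho1 : z1 / zp < 1 by rewrite ltr_pdivrMr// mul1r.
have cn := BST_norm_gt0 n z0; have cm := BST_norm_gt0 m z0; have cp := BST_norm_gt0 n zp0.
have czm := BST_norm_gt0 n zm0.
have -> : pgf h z / C n z - pgf h' z / C m z =
   (\sum_(0 <= k < n.+1) z ^+ k * (hsum h (fun d => (d == k)%:R) - cond_profile n k m h')) / C n z.
  under eq_bigr do rewrite mulrBr.
  rewrite sumrB (sum_profile _ hn) (sum_cond_profile _ mn hm) (BST_norm_cat _ mn).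
  have g0 := horner_growth_gt0 m n z0.
  by field; rewrite !gt_eqF.
rewrite normrM normfV (ger0_norm (ltW cn)) ler_pdivrMr//.
apply: le_trans (ler_norm_sum _ _ _) _.
apply: le_trans (_ : \sum_(0 <= k < n.+1) kap * C n zp * (z1 / zp) ^+ k <= _).
  rewrite big_nat [leRHS]big_nat; apply: ler_sum => k /andP[_ kn].
  rewrite normrM ger0_norm ?exprn_ge0 ?(ltW z0)//.
  have zk : 0 <= z ^+ k by rewrite exprn_ge0// ltW.
  apply: le_trans (ler_wpM2l zk (hU k kn)) _.
  rewrite [leLHS](_ : _ = kap * C n zp * (z / zp) ^+ k); last first.
    by rewrite expr_div_n; ring.
  have zp0' : 0 <= z / zp by rewrite divr_ge0// ltW.
  rewrite ler_wpM2l ?mulr_ge0 ?(ltW cp)// lerXn2r ?nnegrE//.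
  by rewrite ler_pM2r ?invr_gt0.
rewrite -mulr_sumr.
have kc : 0 <= kap * C n zp by rewrite mulr_ge0// ltW.
apply: le_trans (ler_wpM2l kc (sum_geometric_le n.+1 rho0 rho1)) _.
have i0 : 0 <= (1 - z1 / zp)^-1 by rewrite invr_ge0 subr_ge0 ltW.
rewrite [leRHS](_ : _ = kap * C n zp * (1 - z1 / zp)^-1 * (C n z / C n zm)); last by ring.
by rewrite (ler_peMr (mulr_ge0 kc i0))// ler_pdivlMr// mul1r le_BST_norm.
Qed.

(** For n <= 2 m, the deviations m^(- g / 2) of the profile are multiplied by
    C_n(zp) / C_n(zm), of order n^(2 (zp - zm)), and by ln n; each is at most of
    order m^(g / 8), which leaves m^(- g / 4).  [dyadic_chain] removes the
    restriction on n. *)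
Lemma martingale_uniform (hs : nat -> seq word) (zm z1 zp g gc : R) :
  (forall n, hs n \in histories n) -> 0 < zm -> zm <= z1 -> z1 < zp -> 0 < g -> 0 < gc ->
  2 * (zp - zm) <= g / 8 ->
  (exists N, forall n k m, (N <= n)%N -> (k <= n)%N -> (m <= n)%N ->
    gc ^+ 2 * (1 + 2 * H n) <= expR (g * ln m.+1%:R) ->
    `|hsum (hs n) (fun d => (d == k)%:R) - cond_profile n k m (hs m)| <=
    (1 + 6 * ln n.+1%:R) / expR (g / 2 * ln m.+1%:R) * (C n zp / zp ^+ k)) ->
  exists K N, 0 <= K /\ forall z, zm <= z -> z <= z1 -> forall m n, (N <= m)%N -> (m <= n)%N ->
    `|pgf (hs n) z / C n z - pgf (hs m) z / C m z| <= K * expR (- (g / 4) * ln m.+1%:R).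
Proof.
move=> hsP zm0 zm1 z1p g0 gc0 hg [N1 hdev].
have [N2 hN2] := ln_ge_eventually (2 / g * ln (gc ^+ 2 * (5 + 4 / g))).
have zp0 : 0 < zp by apply: lt_trans z1p; exact: lt_le_trans zm1.
have i0 : 0 <= (1 - z1 / zp)^-1.
  by rewrite invr_ge0 subr_ge0 ler_pdivrMr// mul1r ltW.
pose K := (7 + 48 / g) * expR (g / 4 + norm_const zm) * (1 - z1 / zp)^-1.
have K0 : 0 <= K.
  by rewrite /K !mulr_ge0 ?expR_ge0// addr_ge0// divr_ge0// ltW.
exists (K / (1 - expR (- (g / 4) * ln (3 / 2)))), (maxn 1 (maxn N1 N2)); split.
  have l32 : 0 < ln (3 / 2) :> R by apply: ln_gt0; lra.
  rewrite divr_ge0// subr_ge0 ltW// expR_lt1 mulNr oppr_lt0 mulr_gt0//.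
  by rewrite divr_gt0.
move=> z zmz zz1; apply: (@dyadic_chain (fun n => pgf (hs n) z / C n z)) => //.
- by rewrite divr_gt0.
- by rewrite leq_maxl.
move=> m n; rewrite !geq_max => /and3P[m1 Nm1 Nm2] mn n2m.
set L := ln m.+1%:R.
have L0 : 0 <= L by rewrite ln_ge0// ler1n.
have l2 : ln 2 <= 1 :> R by have := @le_ln1Dx R 1; rewrite -[1 + 1]/(2 : R); apply; lra.
have nL : ln n.+1%:R <= 1 + L.
  apply: le_trans (_ : ln (2 * m.+1%:R) <= _); last by rewrite lnM ?posrE// lerD2r.
  have n2 : (n.+1 <= 2 * m.+1)%N by rewrite mul2n doubleS ltnS (leq_trans n2m).
  by rewrite -natrM ler_ln ?posrE ?ltr0n// ler_nat.
have HL : H n <= 2 + L.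
  apply: le_trans (harm_le n) _; have : ln n%:R <= ln n.+1%:R :> R.
    by rewrite ler_ln ?posrE ?ltr0n ?ler_nat// (leq_trans m1 mn).
  by move: nL; lra.
have H0 : 0 <= H n by exact: harm_ge0.
have eL (a b : R) : 0 < a -> 0 <= b -> b * L <= b / a * expR (a * L).
  move=> a0 b0; have := expR_ge1Dx (a * L) => h.
  have := ler_wpM2l (divr_ge0 b0 (ltW a0)) (le_trans (_ : a * L <= 1 + a * L) h).
  by rewrite mulrA divfK ?gt_eqF// => -> //; rewrite lerDr.
have adm : gc ^+ 2 * (1 + 2 * H n) <= expR (g * L).
  have hY := hN2 m.+1 (leq_trans Nm2 (leqnSn m)); rewrite -/L in hY.
  have g4 : 0 < 5 + 4 / g by rewrite addr_gt0// divr_gt0.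
  have c0 : 0 < gc ^+ 2 * (5 + 4 / g) by rewrite mulr_gt0// exprn_gt0.
  have e1 : gc ^+ 2 * (5 + 4 / g) <= expR (g / 2 * L).
    rewrite -[leLHS]lnK ?posrE// ler_expR.
    have := ler_wpM2l (ltW (divr_gt0 g0 (ltr0n _ 2))) hY.
    by rewrite mulrA (_ : g / 2 * (2 / g) = 1) ?mul1r//; field; rewrite gt_eqF.
  have -> : expR (g * L) = expR (g / 2 * L) * expR (g / 2 * L).
    by rewrite -expRD; congr expR; field.
  apply: le_trans (ler_wpM2r (expR_ge0 _) e1).
  rewrite -(mulrA (gc ^+ 2)) ler_wpM2l ?sqr_ge0//.
  have h2 := eL (g / 2) 2 (divr_gt0 g0 (ltr0n _ 2)) (ler0n _ 2).
  have h3 : 1 <= expR (g / 2 * L) by rewrite -expR0 ler_expR mulr_ge0// divr_ge0// ltW.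
  have e4 : 2 / (g / 2) = 4 / g by field; rewrite gt_eqF.
  rewrite e4 in h2; move: h2 h3 HL; move: (expR _) (4 / g) => E G; lra.
have kap0 : 0 <= (1 + 6 * ln n.+1%:R) / expR (g / 2 * L).
  by rewrite divr_ge0 ?expR_ge0// addr_ge0// mulr_ge0// ln_ge0// ler1n.
apply: le_trans (martingale_increment_le zm0 z1p mn (hsP n) (hsP m) zmz zz1 kap0 _) _.
  by move=> k kn; apply: hdev => //; exact: leq_trans mn.
have -> : K * expR (- (g / 4) * L) =
    (7 + 48 / g) * expR (g / 4 + norm_const zm - g / 4 * L) * (1 - z1 / zp)^-1.
  by rewrite /K (expRD (g / 4 + norm_const zm)) mulNr; ring.
rewrite ler_wpM2r//.
have hR : C n zp / C n zm <= expR (g / 8 * (2 + L) + norm_const zm).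
  apply: le_trans (ler_pM _ _ (BST_norm_le n zp0) (BST_norm_inv_le n zm0)) _.
  - by rewrite ltW// BST_norm_gt0.
  - by rewrite invr_ge0 ltW// BST_norm_gt0.
  rewrite -expRD ler_expR addrA lerD2r -mulrDl.
  have -> : 2 * zp - 1 + (1 - 2 * zm) = 2 * (zp - zm) by ring.
  apply: ler_pM => //; rewrite mulr_ge0// subr_ge0 ltW//; exact: le_lt_trans z1p.
have hL : 1 + 6 * ln n.+1%:R <= (7 + 48 / g) * expR (g / 8 * L).
  have h2 := eL (g / 8) 6 (divr_gt0 g0 (ltr0n _ 8)) (ler0n _ 6).
  have h3 : 1 <= expR (g / 8 * L) by rewrite -expR0 ler_expR mulr_ge0// divr_ge0// ltW.
  have e4 : 6 / (g / 8) = 48 / g by field; rewrite gt_eqF.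
  rewrite e4 in h2; move: h2 h3 nL; move: (expR _) (48 / g) => E G; lra.
rewrite -expRN in kap0 *.
have r0 : 0 <= C n zp / C n zm by rewrite divr_ge0// ltW// BST_norm_gt0.
apply: le_trans (ler_pM kap0 r0 (ler_wpM2r (expR_ge0 _) hL) hR) _.
have -> : g / 4 + norm_const zm - g / 4 * L =
    g / 8 * L + - (g / 2 * L) + (g / 8 * (2 + L) + norm_const zm) by field.
rewrite (expRD (g / 8 * L - g / 2 * L)) (expRD (g / 8 * L)).
by rewrite le_eqVlt; apply/orP; left; apply/eqP; ring.
Qed.

End UniformConvergence.

(** * The profile along a fixed sequence of histories *)
Section ProfileUniform.
Context {R : realType}.
Implicit Types (n m k N : nat).
Local Notation C := (@BST_norm R).
Local Notation H := (@harm R).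

Lemma sqr_le_expR (K y : R) : 0 <= K -> 1 <= y -> 24 * K <= y -> K * (1 + y) ^+ 2 <= expR y.
Proof.
move=> K0 y1 Ky; have y0 : 0 <= y by lra.
have h : 1 + y ^+ 3 / 6 <= expR y by have := @expR_ge1Dxn R y 2 y0.
have y2 : 0 <= y ^+ 2 by exact: sqr_ge0.
have h1 : 24 * K * y ^+ 2 <= y ^+ 3 by rewrite exprS ler_wpM2r.
have h2 : K * (1 + y) ^+ 2 <= K * (4 * y ^+ 2).
  by rewrite ler_wpM2l//; move: y1 y2; rewrite !expr2; nra.
apply: le_trans h2 _; move: h h1; move: (y ^+ 3) (y ^+ 2) => a b; lra.
Qed.

Lemma coef_growth_gt0 m n k (r : R) : (0 < m)%N ->
  let q := psum1 m n - 8 * r in 0 <= r -> 0 < q -> k%:R <= r * q ->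
  0 < (growth m n)`_k :> R.
Proof.
move=> m0 q r0 q0 kq.
have a0 : 0 < (growth m n)`_0 :> R.
  elim: n {q q0 kq} => [|n IHn]; first by rewrite /growth big_geq// coef1.
  case: (leqP m n) => mn; last by rewrite /growth big_geq// coef1.
  rewrite growthSr// mulrC coef_factorM0 mulr_gt0// divr_gt0// ltr0n.
  exact: leq_trans mn.
have := coef_growth_back m0 (leqnn k) r0 q0 kq; rewrite subnn.
rewrite lt0r coef_growth_ge0 andbT => h; apply/eqP => a; move: h; rewrite a mulr0.
by rewrite leNgt mulr_gt0// exprn_gt0.
Qed.

(** With y = ln ln n, so that exp y = ln n: polynomial quantities in ln ln n are
    negligible with respect to ln n. *)
Lemma loglog_negligible (a e zm S b : R) : 0 < e -> 0 < zm -> 0 <= S -> 0 <= b ->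
  exists Y, 1 <= Y /\ forall y, Y <= y -> let w := (a * (1 + y)) ^+ 2 in
    [/\ w <= expR y, w <= e * expR y, w <= e * (2 * zm * expR y),
        S * w <= e * (2 * zm * expR y) & b <= expR y].
Proof.
move=> e0 zm0 S0 b0.
have ez0 : 0 < 2 * e * zm by rewrite !mulr_gt0.
have ei0 : 0 <= e^-1 by rewrite invr_ge0 ltW.
have ezi0 : 0 <= (2 * e * zm)^-1 by rewrite invr_ge0 ltW.
have Sz0 : 0 <= S / (2 * e * zm) by rewrite divr_ge0 ?(ltW ez0).
have a20 : 0 <= a ^+ 2 by exact: sqr_ge0.
pose b1 := a ^+ 2 * (1 + e^-1 + (2 * e * zm)^-1 + S / (2 * e * zm)).
have b10 : 0 <= b1 by rewrite /b1 mulr_ge0 ?sqr_ge0// !addr_ge0.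
exists (1 + 24 * (b1 + b)); split=> [|y yY w]; first by move: b10 b0; lra.
have y1 : 1 <= y by move: b10 b0 yY; lra.
have key : (b1 + b) * (1 + y) ^+ 2 <= expR y.
  by apply: sqr_le_expR => //; [rewrite addr_ge0|move: yY; lra].
have wE t : 0 <= t -> a ^+ 2 * t <= b1 -> w * t <= expR y.
  move=> t0 tb; apply: le_trans key; rewrite /w exprMn mulrAC ler_wpM2r ?sqr_ge0//.
  by apply: le_trans tb _; rewrite lerDl.
have t1 : w * 1 <= expR y by apply: wE => //; rewrite /b1 ler_wpM2l//; move: ei0 ezi0 Sz0; lra.
have t2 : w * e^-1 <= expR y by apply: wE => //; rewrite /b1 ler_wpM2l//; move: ei0 ezi0 Sz0; lra.
have t3 : w * (2 * e * zm)^-1 <= expR y.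
  by apply: wE => //; rewrite /b1 ler_wpM2l//; move: ei0 ezi0 Sz0; lra.
have t4 : w * (S / (2 * e * zm)) <= expR y.
  by apply: wE => //; rewrite /b1 ler_wpM2l//; move: ei0 ezi0 Sz0; move: (_^-1) => ?; lra.
have eE : e * (2 * zm * expR y) = expR y * (2 * e * zm) by ring.
rewrite !eE; split.
- by rewrite -[w]mulr1.
- by rewrite [leRHS]mulrC -ler_pdivrMr.
- by rewrite -ler_pdivrMr.
- rewrite -ler_pdivrMr// [leLHS](_ : _ = w * (S / (2 * e * zm)))//.
  by rewrite (mulrC S) mulrA.
apply: le_trans key; have h1 : 1 <= (1 + y) ^+ 2 by rewrite exprn_ege1//; lra.
apply: le_trans (_ : (b1 + b) * 1 <= _); first by rewrite mulr1 lerDr.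
by rewrite ler_wpM2l// addr_ge0.
Qed.

(** A common bound a (1 + y) for the quantities of order ln m = A ln ln n that
    enter the hypotheses of [cond_profile_ratio]. *)
Lemma affine_majorant (A zp DB : R) : 0 <= A -> 0 <= zp -> 0 <= DB ->
  exists a, 1 <= a /\ forall y, 0 <= y -> [/\ 2 + A * y <= a * (1 + y),
     DB * (2 + A * y) <= a * (1 + y), 2 * A * y + 16 * zp <= a * (1 + y) &
     1 + 2 * zp * (1 + A * y) <= a * (1 + y)].
Proof.
move=> hA hz DB0; exists (3 + 2 * A + 16 * zp + DB * (2 + A) + 2 * zp * (1 + A)).
have t1 : 0 <= DB * A by exact: mulr_ge0.
have t2 : 0 <= zp * A by exact: mulr_ge0.
split=> [|y y0]; first by lra.
have t3 : 0 <= DB * y by exact: mulr_ge0.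
have t4 : 0 <= zp * y by exact: mulr_ge0.
have t5 : 0 <= A * y by exact: mulr_ge0.
have t6 : 0 <= DB * A * y by exact: mulr_ge0.
have t7 : 0 <= zp * A * y by exact: mulr_ge0.
by split; lra.
Qed.

(** The deterministic part of the argument: [hs] stands for the histories of one
    outcome, for which depths, uniform Cauchy property and deviations are
    controlled.  The error is split at an intermediate time m into three terms
    of size eps / 3. *)
Lemma profile_uniform (hs : nat -> seq word) (zm z1 zp g gc DB K : R) NM :
  (forall n, hs n \in histories n) -> 0 < zm -> zm <= z1 -> z1 < zp -> 0 < g -> 0 <= gc ->
  0 <= DB -> (forall n u, u \in leaves (tree_of (hs n)) -> (size u)%:R <= DB * (1 + H n)) ->
  0 <= K -> (forall z, zm <= z -> z <= z1 -> forall m n, (NM <= m)%N -> (m <= n)%N ->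
    `|pgf (hs n) z / C n z - pgf (hs m) z / C m z| <= K * expR (- (g / 4) * ln m.+1%:R)) ->
  (exists N, forall n k m, (N <= n)%N -> (k <= n)%N -> (m <= n)%N ->
    gc ^+ 2 * (1 + 2 * H n) <= expR (g * ln m.+1%:R) ->
    let z := k%:R / (2 * ln n%:R) in zm <= z -> z <= z1 ->
    `|hsum (hs n) (fun d => (d == k)%:R) - cond_profile n k m (hs m)| <=
    (1 + 6 * ln n.+1%:R) / expR (g / 2 * ln m.+1%:R) * (C n z / z ^+ k)) ->
  forall eps, 0 < eps -> exists N, forall n k, (N <= n)%N ->
    let z := k%:R / (2 * ln n%:R) in zm <= z -> z <= z1 ->
    `|hsum (hs n) (fun d => (d == k)%:R) / (growth 0 n)`_k
      - limn (fun n => pgf (hs n) z / C n z)| <= eps.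
Proof.
move=> hsP zm0 zm1 z1p g0 gc0 DB0 hD K0 hM [ND hdev] eps eps0.
have zp0 : 0 < zp by apply: lt_trans z1p; exact: lt_le_trans zm1.
pose Mb := pgf (hs NM) zp / C NM zm + K.
have Mb0 : 0 <= Mb by rewrite addr_ge0// divr_ge0 ?pgf_ge0 ?(ltW zp0)// ltW// BST_norm_gt0.
have hMb z m : zm <= z -> z <= z1 -> (NM <= m)%N -> pgf (hs m) z / C m z <= Mb.
  move=> zmz zz1 Nm; have z0 : 0 < z by exact: lt_le_trans zmz.
  have := hM z zmz zz1 NM m (leqnn _) Nm; rewrite ler_norml => /andP[_].
  rewrite lerBlDl => /le_trans; apply; apply: lerD.
    apply: ler_pM; rewrite ?pgf_ge0 ?invr_ge0 ?(ltW z0)// ?(ltW (BST_norm_gt0 _ z0))//.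
      apply: ler_sum => u _; rewrite lerXn2r ?nnegrE ?(ltW z0) ?(ltW zp0)//.
      by rewrite (le_trans zz1)// ltW.
    by rewrite lef_pV2 ?posrE ?BST_norm_gt0// le_BST_norm.
  rewrite ler_piMr// expR_le1 mulNr oppr_le0.
  by apply: mulr_ge0; [rewrite divr_ge0// ltW|rewrite ln_ge0// ler1n].
(* The relative error allowed in the comparison of the conditional profile at
   time m with M_m(z), which is at most Mb: it must satisfy 6 e Mb <= eps / 3 and
   e <= 1 / 2. *)
pose e := eps / (2 * eps + 18 * (Mb + 1)).
have den0 : 0 < 2 * eps + 18 * (Mb + 1) by lra.
have e0 : 0 < e by rewrite divr_gt0.
have e12 : e <= 2^-1 by rewrite /e ler_pdivrMr//; lra.
have eM : 6 * e * Mb <= eps / 3.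
  have -> : 6 * e * Mb = 6 * eps * Mb / (2 * eps + 18 * (Mb + 1)) by rewrite /e; ring.
  by rewrite ler_pdivrMr//; nra.
clearbody e Mb.
(* The time m is about (ln n)^A; then m^(g / 2) is about (ln n)^4 and m^(g / 4)
   about (ln n)^2. *)
pose A := 8 / g; have AE : A = 8 / g by [].
have A0 : 0 < A by rewrite divr_gt0.
clearbody A.
pose S := spread_const zp; have S0 : 0 < S by rewrite /S /spread_const mulr_gt0 ?expR_gt0.
pose mc := mean_const zp; have mc0 : 0 <= mc by rewrite /mc /mean_const !mulr_ge0 ?expR_ge0 ?(ltW zp0).
have SE z : z <= zp -> spread_const z <= S.
  by move=> zz; rewrite /S /spread_const ler_pM2l// ler_expR lerD2l ler_pM2l.
have mcE : mean_const zp = mc by [].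
clearbody S mc.
have [a [a1 ah]] := affine_majorant (ltW A0) (ltW zp0) DB0.
have q1 : 0 <= 5 * gc ^+ 2 by rewrite mulr_ge0 ?sqr_ge0.
have q2 : 0 <= 39 * mc / eps by rewrite divr_ge0 ?(ltW eps0)// mulr_ge0.
have q3 : 0 <= 3 * K / eps by rewrite divr_ge0 ?(ltW eps0)// mulr_ge0.
have q4 : 0 <= (2 + 16 * zp ^+ 2) / (2 * zm).
  by rewrite divr_ge0 ?mulr_ge0 ?(ltW zm0)// addr_ge0// mulr_ge0 ?sqr_ge0.
have [Y0 [Y01 hY0]] := loglog_negligible a e0 zm0 (ltW S0)
   (addr_ge0 (addr_ge0 q1 q2) (addr_ge0 q3 q4)).
pose Y := Y0 + A^-1 + ln NM.+1%:R / A.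
have lNM : 0 <= ln NM.+1%:R / A :> R by rewrite divr_ge0 ?(ltW A0)// ln_ge0// ler1n.
have Ai0 : 0 < A^-1 by rewrite invr_gt0.
have [N1 hN1] := ln_ge_eventually (expR Y).
exists (maxn N1 ND) => n k; rewrite geq_max => /andP[Nn1 Nn2] z zmz zz1.
pose x : R := ln n%:R; pose y := ln x.
have xY : expR Y <= x by exact: hN1.
have x0 : 0 < x by apply: lt_le_trans xY; exact: expR_gt0.
have n0 : (0 < n)%N.
  by rewrite lt0n; apply/eqP => nE; move: x0; rewrite /x nE ln0// ltxx.
have yY : Y <= y by rewrite /y -[Y]expRK ler_ln ?posrE ?expR_gt0.
have xE : expR y = x by rewrite /y lnK ?posrE.
have [yY0 yA yN] : [/\ Y0 <= y, A^-1 <= y & ln NM.+1%:R / A <= y].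
  by clear -yY Y01 lNM Ai0; move: yY; rewrite /Y; split; lra.
have y1 : 1 <= y by exact: le_trans yY0.
have [/=] := hY0 y yY0; rewrite xE; have [w wE] : exists w, w = (a * (1 + y)) ^+ 2 by eexists.
rewrite -wE => w1 w2 w3 w4 xb.
have y0 : 0 <= y by exact: le_trans y1.
have [ah1 ah2 ah3 ah4] := ah y y0.
have ay1 : 1 <= a * (1 + y) by rewrite -[leLHS]mulr1 ler_pM// lerDl.
have ayx : a * (1 + y) <= x.
  by apply: le_trans w1; rewrite wE expr2 ler_peMl// (le_trans _ ay1).
have x1 : 1 <= x by exact: le_trans ayx.
(* Here x = ln n and y = ln ln n, and w, a polynomial in y, is small compared
   with x. *)
pose m := Num.truncn (expR (A * y)).
have Ay1 : 1 <= A * y by rewrite -(mulfV (lt0r_neq0 A0)) ler_pM2l.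
have mgt : expR (A * y) < m.+1%:R by exact: truncnS_gt.
have mle : m%:R <= expR (A * y) by rewrite truncn_le// expR_ge0.
have m1 : (1 < m)%N.
  rewrite -ltnS -(ltr_nat R); apply: le_lt_trans mgt.
  by apply: le_trans (expR_ge1Dx _); rewrite -[2]/(1 + 1) lerD2l.
have mR : 0 < m%:R :> R by rewrite ltr0n ltnW.
have lnm : ln m%:R <= A * y by rewrite -[leRHS]expRK ler_ln ?posrE ?expR_gt0.
have lnm1 : A * y <= ln m.+1%:R.
  by rewrite -[leLHS]expRK ler_ln ?posrE ?expR_gt0// ltW.
have Ayx : A * y <= x by apply: le_trans ayx; apply: le_trans ah1; rewrite lerDr.
have nR : 0 < n%:R :> R by rewrite ltr0n.
have mn : (m <= n)%N.
  by rewrite -(ler_nat R) (le_trans mle)// -[leRHS]lnK ?posrE// ler_expR.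
have NMm : (NM <= m)%N.
  rewrite -ltnS -(ltr_nat R); apply: le_lt_trans mgt.
  apply: le_trans (_ : NM.+1%:R <= _); first by rewrite ler_nat.
  by rewrite -[leLHS]lnK ?posrE ?ltr0n// ler_expR mulrC -ler_pdivrMr.
have Hm : H m <= 1 + A * y by apply: le_trans (harm_le m) _; rewrite lerD2l.
clearbody m.
have ln_n1 : ln n.+1%:R <= 1 + x.
  have := @ln_succ_le R n n0; rewrite -/x => h.
  have : n%:R^-1 <= 1 :> R by rewrite invf_le1// ler1n.
  by move: h; move: (ln _) (n%:R^-1) => u v; clear; lra.
have x2 : 0 < 2 * x by rewrite mulr_gt0.
have kE : k%:R = z * (2 * x) by rewrite /z divfK// gt_eqF.
have zpos : 0 < z by exact: lt_le_trans zmz.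
have kR : 0 < k%:R :> R by rewrite kE mulr_gt0.
have k0 : (0 < k)%N by rewrite -(ltr_nat R).
have zzp : z <= zp by apply: le_trans zz1 (ltW z1p).
have Ay0 : 0 <= A * y by exact: le_trans Ay1.
have x16 : 16 * zp <= x by clear -ah3 ayx Ay0; lra.
have kn : (k <= n)%N.
  rewrite -(ler_nat R) kE -[leRHS]lnK ?posrE// -/x.
  have := @expR_ge1Dxn R x 1 (ltW x0); rewrite -[2`!]/2%N => h.
  apply: le_trans h; apply: le_trans (_ : zp * (2 * x) <= _); first by rewrite ler_pM2r.
  by clear -x16 x1 x0 zp0; rewrite expr2; nra.
have kzm : 2 * zm * x <= k%:R by rewrite kE mulrAC mulrC ler_pM2r.
have kbig : 2 + 16 * zp ^+ 2 <= k%:R.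
  apply: le_trans kzm; rewrite [leRHS]mulrC -ler_pdivrMr ?mulr_gt0//.
  by clear -xb q1 q2 q3; lra.
have gA : g * (A * y) = 8 * y by rewrite AE; field; rewrite gt_eqF.
have adm : gc ^+ 2 * (1 + 2 * H n) <= expR (g * ln m.+1%:R).
  apply: le_trans (_ : expR (g * (A * y)) <= _); last by rewrite ler_expR ler_pM2l.
  rewrite gA expRM_natl xE; apply: le_trans (_ : x ^+ 2 <= _); last first.
    by rewrite ler_weXn2l.
  have Hn : H n <= 1 + x by exact: harm_le.
  have gx : 5 * gc ^+ 2 <= x by clear -xb q2 q3 q4; lra.
  have g20 : 0 <= gc ^+ 2 by exact: sqr_ge0.
  apply: le_trans (_ : gc ^+ 2 * (5 * x) <= _).
    by rewrite ler_wpM2l//; clear -Hn x1; lra.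
  by rewrite mulrCA mulrA expr2 ler_wpM2r// ltW.
have mean := mean_profile_ge n0 x0 (erefl _) (erefl _) zzp x16 kbig.
rewrite -/x -/z mcE in mean.
pose EU : R := (growth 0 n)`_k; rewrite -/EU in mean *.
have EU0 : 0 < EU.
  rewrite lt0r coef_growth_ge0 andbT; apply/eqP => EU0.
  by move: mean; rewrite EU0 mulr0 leNgt divr_gt0 ?exprn_gt0// BST_norm_gt0.
(* Deviations of relative order (ln n)^2 / (ln n)^4: one factor ln n comes from
   the deviation bound, the other from the lower bound on the mean profile. *)
have err1 : `|hsum (hs n) (fun d => (d == k)%:R) - cond_profile n k m (hs m)| <= eps / 3 * EU.
  apply: le_trans (hdev n k m Nn2 kn mn adm zmz zz1) _.
  have E4 : x ^+ 4 <= expR (g / 2 * ln m.+1%:R).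
    rewrite -xE -expRM_natl ler_expR (_ : 4 * y = g / 2 * (A * y)).
      by rewrite ler_wpM2l// divr_ge0// ltW.
    by rewrite mulrAC gA; field.
  have x4 : 0 < x ^+ 4 by rewrite exprn_gt0.
  apply: le_trans (_ : (13 * x / x ^+ 4) * (mc * x * EU) <= _).
    have l0 : 0 <= ln n.+1%:R :> R by rewrite ln_ge0// ler1n.
    apply: ler_pM => //.
    - by rewrite divr_ge0 ?expR_ge0// addr_ge0// mulr_ge0.
    - by rewrite divr_ge0 ?exprn_ge0 ?(ltW zpos)// ltW// BST_norm_gt0.
    apply: ler_pM => //.
    - by rewrite addr_ge0// mulr_ge0.
    - by clear -ln_n1 x1; lra.
    - by rewrite lef_pV2 ?posrE ?expR_gt0.
  have -> : 13 * x / x ^+ 4 * (mc * x * EU) = 13 * mc / x ^+ 2 * EU.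
    by field; rewrite gt_eqF.
  rewrite ler_pM2r// ler_pdivrMr ?exprn_gt0//.
  have mx : 39 * mc <= x * eps.
    by rewrite -ler_pdivrMr//; clear -xb q1 q3 q4; lra.
  have xx : x * eps <= x ^+ 2 * eps by rewrite ler_pM2r// expr2 ler_peMl// ltW.
  by clear -mx xx; lra.
have err3 : `|limn (fun n => pgf (hs n) z / C n z) - pgf (hs m) z / C m z| <= eps / 3.
  apply: le_trans (_ : K * expR (- (g / 4) * ln m.+1%:R) <= _).
    apply: (@cauchy_bound_cvg _ (fun n => pgf (hs n) z / C n z) _ _ NM) => //.
      by rewrite divr_gt0.
    exact: hM.
  have E2 : expR (- (g / 4) * ln m.+1%:R) <= x^-1.
    apply: le_trans (_ : expR (- y) <= _); last by rewrite expRN xE.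
    rewrite ler_expR mulNr lerN2; apply: le_trans (_ : g / 4 * (A * y) <= _).
      by rewrite mulrAC gA; clear -y0; lra.
    by rewrite ler_pM2l// divr_gt0.
  apply: le_trans (ler_wpM2l K0 E2) _; rewrite ler_pdivrMr//.
  have : 3 * K <= x * eps by rewrite -ler_pdivrMr//; clear -xb q1 q2 q4; lra.
  by clear; lra.
pose r := 2 * zp; pose q := psum1 m n - 8 * r.
have r0 : 0 <= r by rewrite mulr_ge0// ltW.
have qge : 2 * x - a * (1 + y) <= q.
  have := psum1_ge (ltnW m1) mn (R := R); rewrite -/x /q /r.
  by clear -lnm ah3; move: (psum1 m n) (ln m%:R) lnm => u v; lra.
have qx : x <= q by clear -qge ayx; lra.
have q0 : 0 < q by exact: lt_le_trans qx.
have q2x : q <= 2 * x.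
  have := psum1_le_ln m1 mn (R := R); rewrite -/x /q => h.
  by clear -h r0; lra.
have krq : k%:R <= r * q.
  rewrite kE mulrA; apply: le_trans (_ : r * x <= _); last by rewrite ler_wpM2l.
  by rewrite ler_pM2r// mulrC ler_pM2l.
have s1 : 2 * x / q - 1 <= a * (1 + y) / x.
  have -> : 2 * x / q - 1 = (2 * x - q) / q by field; rewrite gt_eqF.
  apply: ler_pM; rewrite ?subr_ge0 ?invr_ge0 ?(ltW q0)//.
    by clear -qge; lra.
  by rewrite lef_pV2 ?posrE.
have s0 : 0 <= 2 * x / q - 1 by rewrite subr_ge0 ler_pdivlMr// mul1r.
have aw (t : R) : 0 <= t -> t <= a * (1 + y) -> t * (2 * x / q - 1) <= e.
  move=> t0 ta; apply: le_trans (_ : w / x <= _); last by rewrite ler_pdivrMr.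
  have -> : w / x = a * (1 + y) * (a * (1 + y) / x) by rewrite wE; ring.
  exact: ler_pM.
have Hm2 : 1 + H m <= a * (1 + y) by clear -Hm ah1; lra.
have H0 : 0 <= H m by exact: harm_ge0.
have DBH : DB * (1 + H m) <= a * (1 + y).
  by apply: le_trans ah2; rewrite ler_wpM2l//; clear -Hm; lra.
have DBH0 : 0 <= DB * (1 + H m) by rewrite mulr_ge0// addr_ge0.
have ek : e * (2 * zm * x) <= e * k%:R by rewrite ler_pM2l.
have err2 := @cond_profile_ratio R n m k (hs m) r x z e (DB * (1 + H m)) (hsP m) m1 mn k0
  r0 q0 q2x krq x0 (erefl _) (erefl _) (hD m) DBH0 (ltW e0) e12.
have {}err2 : `|cond_profile n k m (hs m) / EU - pgf (hs m) z / C m z| <= eps / 3.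
  apply: le_trans (err2 _ _ _ _ _) _.
  - apply: le_trans ek; apply: le_trans w3; rewrite wE lerXn2r ?nnegrE//.
    exact: le_trans DBH.
  - exact: aw.
  - apply: le_trans ek; apply: le_trans w4; rewrite wE; apply: ler_pM => //.
    + by rewrite /spread_const mulr_ge0 ?expR_ge0.
    + exact: sqr_ge0.
    + exact: SE.
    by rewrite lerXn2r ?nnegrE// ?addr_ge0// (le_trans _ Hm2)// addr_ge0.
  - rewrite mulrC; apply: aw.
      exact: addr_ge0 ler01 (mulr_ge0 (mulr_ge0 (ler0n _ 2) (ltW zpos)) H0).
    apply: le_trans ah4; rewrite lerD2l; apply: ler_pM => //.
      exact: mulr_ge0 (ler0n _ 2) (ltW zpos).
    by rewrite ler_pM2l.
  - exact: coef_growth_gt0 (ltnW m1) r0 q0 krq.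
  apply: le_trans eM; rewrite ler_wpM2l ?mulr_ge0 ?(ltW e0)//.
  exact: hMb.
set U := hsum _ _ in err1 *.
have err1' : `|U / EU - cond_profile n k m (hs m) / EU| <= eps / 3.
  by rewrite -mulrBl normrM normfV (ger0_norm (ltW EU0)) ler_pdivrMr.
rewrite (_ : U / EU - _ = (U / EU - cond_profile n k m (hs m) / EU) +
  (cond_profile n k m (hs m) / EU - pgf (hs m) z / C m z) -
  (limn (fun n => pgf (hs n) z / C n z) - pgf (hs m) z / C m z)); last by ring.
apply: le_trans (ler_normB _ _) _; apply: le_trans (lerD (ler_normD _ _) (lexx _)) _.
apply: le_trans (lerD (lerD err1' err2) err3) _.
by clear; lra.
Qed.

End ProfileUniform.

(** * Almost sure convergence near one point *)
Section Local.
Context (R : realType) (d : measure_display) (Omega : measurableType d)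
  (P : probability Omega R) (T : nat -> Omega -> {fset word})
  (D : nat -> Omega -> word) (hTD : BST_process P T D).
Implicit Types (n k m : nat) (w : Omega) (z : R).
Local Notation hist := (history D).
Local Notation C := (@BST_norm R).

Definition profile_error k n w : R :=
  `| profile R T k n w / fine ('E_P[profile R T k n])%E
     - BST_limit T (k%:R / (2 * ln n%:R)) w |.

Definition profile_converges (A : set R) w := forall eps, 0 < eps ->
  \forall n \near \oo, forall k, A (k%:R / ln n%:R) -> profile_error k n w <= eps.

Lemma BST_martingale_pgf n z w : BST_martingale T n z w = pgf (hist n w) z / C n z.
Proof. by rewrite /BST_martingale (tree_history hTD) mulrC. Qed.

(** A leaf of depth d contributes exp d to the generating function at exp 1,
    which is at most B C_n(exp 1). *)
Lemma depth_le n h (B : R) u : h \in histories n -> 1 <= B ->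
  pgf_bounded (expR 1) B h -> u \in leaves (tree_of h) ->
  (size u)%:R <= (ln B + (2 * expR 1 - 1)) * (1 + harm n).
Proof.
move=> hn B1 hB ul; have B0 : 0 < B by exact: lt_le_trans B1.
have e1 : 1 <= expR 1 :> R by apply: le_trans (expR_ge1Dx 1); rewrite lerDl.
have := pgf_boundedW hB (leqnn _); rewrite take_size (size_history hn) => hb.
have H0 : 0 <= harm n :> R by exact: harm_ge0.
have lB : 0 <= ln B by exact: ln_ge0.
apply: le_trans (_ : ln B + (2 * expR 1 - 1) * harm n <= _); last first.
  have : 0 <= ln B * harm n by exact: mulr_ge0.
  move: e1; move: (expR 1) => e; lra.
rewrite -ler_expR expRD lnK ?posrE//.
apply: le_trans (ler_wpM2l (ltW B0) (BST_norm_le n (expR_gt0 1))).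
apply: le_trans hb; rewrite -{1}[(size u)%:R]mulr1 expRM_natl /pgf /hsum (big_fsetD1 u)//= lerDl.
by apply: sumr_ge0 => v _; rewrite exprn_ge0// expR_ge0.
Qed.

(** The deviation bound is used twice: with z = zp for the uniform convergence of
    the martingale, and with z = k / (2 ln n) for the profile itself. *)
Lemma ae_profile_converges_local (zm z1 zp p : R) :
  0 < zm -> zm <= z1 -> z1 < zp -> 1 <= p -> p <= 2 -> 0 < gap zm zp p ->
  2 * (zp - zm) <= gap zm zp p / 8 ->
  {ae P, forall w, profile_converges `[2 * zm, 2 * z1] w}.
Proof.
move=> zm0 zm1 z1p p1 p2 g0 hg; have zmp : zm <= zp by apply: le_trans zm1 (ltW z1p).
pose zeta := expR (p * ln zp).
pose zf n k := let z := k%:R / (2 * ln n%:R) in if (zm <= z) && (z <= zp) then z else zm : R.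
have zfm n k : zm <= zf n k by rewrite /zf; case: ifP => // /andP[].
have zfp n k : zf n k <= zp by rewrite /zf; case: ifP => // /andP[].
have a1 := ae_history hTD.
have a2 := ae_pgf_bounded hTD (expR_gt0 (p * ln zp)).
have a3 := ae_pgf_bounded hTD (expR_gt0 (1 : R)).
have B1 (B : nat) : 1 <= B.+1%:R :> R by rewrite ler1n.
have a4 : {ae P, forall w, forall B : nat, _} := ae_foralln (fun B : nat =>
  ae_profile_deviation hTD zm0 zmp p1 p2 (B1 B) (fun n k : nat => zmp) (fun _ _ => lexx zp) (ltW g0)).
have a5 : {ae P, forall w, forall B : nat, _} := ae_foralln (fun B : nat =>
  ae_profile_deviation hTD zm0 zmp p1 p2 (B1 B) zfm zfp (ltW g0)).
near=> w.
have h1 : forall n, hist n w \in histories n by near: w; exact: a1.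
have [B hB] : exists B : nat, forall n, pgf_bounded zeta B.+1%:R (hist n w) by near: w; exact: a2.
have [B' hB'] : exists B : nat, forall n, pgf_bounded (expR 1) (B.+1%:R : R) (hist n w) by near: w; exact: a3.
have h4 : forall B : nat, (forall n, pgf_bounded zeta B.+1%:R (hist n w)) ->
  exists N, forall n k m, (N <= n)%N -> (k <= n)%N -> (m <= n)%N -> admissible zm zp p B.+1%:R n m ->
  `|profile R T k n w - cond_profile n k m (hist m w)| <= dev_bound zm zp p (fun _ _ => zp) n m k.
  by near: w; exact: a4.
have h5 : forall B : nat, (forall n, pgf_bounded zeta B.+1%:R (hist n w)) ->
  exists N, forall n k m, (N <= n)%N -> (k <= n)%N -> (m <= n)%N -> admissible zm zp p B.+1%:R n m ->
  `|profile R T k n w - cond_profile n k m (hist m w)| <= dev_bound zm zp p zf n m k.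
  by near: w; exact: a5.
have {h4} [N4 h4] := h4 B hB; have {h5} [N5 h5] := h5 B hB.
have gc0 : 0 < gap_const zm zp p (B.+1%:R : R) by exact: gap_const_gt0.
have [K [NM [K0 hM]]] : exists K N, 0 <= K /\ forall z, zm <= z -> z <= z1 ->
   forall m n, (N <= m)%N -> (m <= n)%N ->
    `|pgf (hist n w) z / C n z - pgf (hist m w) z / C m z| <=
     K * expR (- (gap zm zp p / 4) * ln m.+1%:R).
  apply: (martingale_uniform h1 zm0 zm1 z1p g0 gc0 hg).
  exists N4 => n k m Nn kn mn ha; have := h4 n k m Nn kn mn ha.
  by rewrite (profile_history hTD).
have e1 : 1 <= expR 1 :> R by apply: le_trans (expR_ge1Dx 1); rewrite lerDl.
have DB0 : 0 <= ln (B'.+1%:R : R) + (2 * expR 1 - 1).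
  by have := ln_ge0 (B1 B'); move: e1; move: (expR 1) (ln _) => e l; lra.
move=> eps eps0.
have [|N hN] := @profile_uniform R (fun n => hist n w) zm z1 zp (gap zm zp p)
  (gap_const zm zp p B.+1%:R) _ K NM h1 zm0 zm1 z1p g0 (ltW gc0) DB0
  (fun n u ul => depth_le (h1 n) (B1 B') (hB' n) ul) K0 hM _ eps eps0.
  exists N5 => n k m Nn kn mn ha z zmz zz1; have := h5 n k m Nn kn mn ha.
  rewrite (profile_history hTD) /dev_bound /zf -/z zmz (le_trans zz1)//=.
  exact: ltW.
exists N => // n /= Nn k; rewrite /= in_itv /= => /andP[].
have -> : k%:R / ln n%:R = 2 * (k%:R / (2 * ln n%:R)) :> R.
  by rewrite invfM [RHS]mulrCA (mulrA 2) divff ?mul1r ?pnatr_eq0.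
rewrite !ler_pM2l// => zmz zz1; have := hN n k Nn zmz zz1.
rewrite /profile_error (expectation_profile hTD) (profile_history hTD) /BST_limit.
by congr (`|_ - limn _| <= _); apply/funext => i; rewrite BST_martingale_pgf.
Unshelve. all: by end_near.
Qed.

End Local.

(** * Choice of the exponents *)
Section GapExponent.
Context {R : realType}.

(** The function eta2 is strictly convex, with derivative ln (x / 2). *)
Lemma eta2_tangent (x y : R) : 0 < x -> 0 <= y -> y != x ->
  eta2 x + ln (x / 2) * (y - x) < eta2 y.
Proof.
move=> x0 y0 yx; rewrite /eta2.
have [->|yn0] := eqVneq y 0; first by move: (ln (x / 2)) (ln (0 / 2)) => a b; lra.
have yp : 0 < y by rewrite lt0r yn0.
have x2 : 0 < x / 2 by rewrite divr_gt0.
have h : ln (x / y) < x / y - 1.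
  have xy1 : x / y != 1 by rewrite -subr_eq0 -(mulfV yn0) -mulrBl mulf_neq0 ?invr_eq0// subr_eq0 eq_sym.
  rewrite -ltr_expR lnK ?posrE ?divr_gt0//.
  rewrite -{1}[x / y](subrKC 1); apply: expR_gt1Dx; by rewrite subr_eq0.
have e : ln (x / 2) = ln (y / 2) + ln (x / y).
  rewrite -lnM ?posrE ?divr_gt0//; congr ln; by field.
have := h; rewrite -(ltr_pM2l yp) mulrBr mulr1 mulrCA divff// mulr1.
rewrite e; move: (ln (x / y)) (ln (y / 2)) => a b; nra.
Qed.

(** Whatever the sign of its slope, the tangent at x is at least eta2 x at one of
    the two points c' and c, where eta2 is strictly above the tangent. *)
Lemma eta2_lt1 (c' c x : R) : 0 <= c' -> eta2 c' = 1 -> eta2 c = 1 ->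
  c' < x -> x < c -> eta2 x < 1.
Proof.
move=> c0 e' e cx xc; have x0 : 0 < x by exact: le_lt_trans cx.
have cp : 0 <= c by apply: ltW; exact: lt_trans xc.
have h1 := @eta2_tangent x c' x0 c0 (negbT (lt_eqF cx)).
have h2 := @eta2_tangent x c x0 cp (negbT (gt_eqF xc)).
rewrite e' in h1; rewrite e in h2; move: h1 h2; set s := ln _ => h1 h2.
have [s0|s0] := leP 0 s.
  have : 0 <= s * (c - x) by rewrite mulr_ge0// subr_ge0 ltW.
  lra.
have : 0 <= s * (c' - x) by rewrite mulr_le0 ?subr_le0 ?(ltW s0) ?(ltW cx).
lra.
Qed.

(** At p = 1 the gap vanishes, and its derivative there is
    D = 2 z - 1 - 2 z ln z > 0; p = 1 + h with h small compared with D works,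
    the second order term being controlled by [expR_le_quadratic]. *)
Lemma gap_pos_exponent (z : R) : 0 < z -> 2 * z * ln z < 2 * z - 1 ->
  exists p, [/\ 1 <= p, p <= 2 & 0 < gap z z p].
Proof.
move=> z0; set L := ln z => hz; pose D := 2 * z - 1 - 2 * z * L.
have D0 : 0 < D by rewrite subr_gt0.
have L2 : 0 <= L ^+ 2 by exact: sqr_ge0.
have zL2 : 0 <= z * L ^+ 2 by rewrite mulr_ge0// ltW.
pose M := 1 + L ^+ 2 + D + 8 * (z * L ^+ 2).
have M0 : 0 < M by rewrite /M; lra.
pose h := D / (M * (1 + D)).
have D1 : 0 < 1 + D by rewrite addr_gt0.
have h0 : 0 < h by rewrite divr_gt0// mulr_gt0.
have hM : h * M <= D.
  rewrite /h (_ : D / (M * (1 + D)) * M = D / (1 + D)); last by field; rewrite !gt_eqF// addr_gt0.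
  by rewrite ler_pdivrMr// ler_peMr ?(ltW D0)// lerDl ltW.
have hM1 : h * M <= 1.
  rewrite /h (_ : D / (M * (1 + D)) * M = D / (1 + D)); last by field; rewrite !gt_eqF// addr_gt0.
  by rewrite ler_pdivrMr// mul1r lerDr.
have h1 : h <= 1 by apply: le_trans hM1; rewrite ler_peMr ?(ltW h0)// /M; lra.
have hL : `|h * L| <= 1.
  rewrite normrM (ger0_norm (ltW h0)); apply: le_trans hM1; rewrite ler_pM2l//.
  have : 0 <= (`|L| - 1) ^+ 2 by exact: sqr_ge0.
  rewrite sqrrB1 real_normK ?num_real// -/(_ *+ 2) /M; move: D0 zL2; move: (`|L|) => l; lra.
exists (1 + h); split; [lra|lra|].
have p0 : 0 < 1 + h by lra.
rewrite /gap -(pmulr_rgt0 _ p0) mulrBr mulrCA divff ?gt_eqF// mulr1.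
rewrite (mulrDl _ _ (ln z)) (mul1r (ln z)) expRD lnK ?posrE//.
have q := expR_le_quadratic hL; rewrite -/L.
have := ler_wpM2l (ltW z0) q; set E := z * expR _ => hE.
have e1 : 4 * h * (z * L ^+ 2) <= D / 2.
  have : h * (8 * (z * L ^+ 2)) <= h * M by rewrite ler_pM2l// /M; lra.
  lra.
have : 0 < h * (D - 4 * h * (z * L ^+ 2)) by rewrite mulr_gt0//; lra.
rewrite /D in e1 *; move: hE; rewrite !expr2; nra.
Qed.

(** Take zm, z1, zp equal to x0 / 2 times exp (- h), exp (h / 2), exp h: as h
    tends to 0 the gap tends to its positive value at z = x0 / 2, while zp - zm
    tends to 0. *)
Lemma gap_parameters (c' c x0 : R) : 0 <= c' -> eta2 c' = 1 -> eta2 c = 1 ->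
  c' < x0 -> x0 < c -> exists zm z1 zp p : R,
  [/\ [/\ 0 < zm, 2 * zm < x0, x0 < 2 * z1 & z1 < zp], 1 <= p, p <= 2, 0 < gap zm zp p &
      2 * (zp - zm) <= gap zm zp p / 8].
Proof.
move=> c0 e' e cx xc; have x00 : 0 < x0 by exact: le_lt_trans cx.
have := eta2_lt1 c0 e' e cx xc; rewrite /eta2 => hx.
pose z := x0 / 2; have z0 : 0 < z by rewrite divr_gt0.
have xE : x0 = 2 * z by rewrite /z; field.
have [|p [p1 p2 g0]] := @gap_pos_exponent z z0.
  by move: hx; rewrite -/z xE; lra.
have p0 : 0 < p by exact: lt_le_trans p1.
pose g := gap z z p; pose X := expR (p * ln z).
have X0 : 0 < X by exact: expR_gt0.
pose M := 128 * z + 40 * X + 2 * g.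
have M0 : 0 < M by rewrite !addr_gt0 ?mulr_gt0.
pose h := g / M; have h0 : 0 < h by rewrite divr_gt0.
have hM : h * M = g by rewrite /h divfK// gt_eqF.
have h12 : h <= 2^-1 by rewrite /h ler_pdivrMr// /M; lra.
have hz : 128 * (h * z) <= g by rewrite -hM /M; nra.
have hX : 40 * (h * X) + 4 * (h * z) <= g by rewrite -hM /M; nra.
have gg : g = 2 * z - 1 - (2 * X - 1) / p by [].
have XE : expR (p * ln z) = X by [].
have gpos : 0 < g by [].
clearbody h; clear M M0 hM; clearbody g X.
have eh : expR h <= 1 + 2 * h.
  have := @expR_le_quadratic R h; rewrite ger0_norm ?(ltW h0)// => /(_ _)H.
  by apply: le_trans (H _) _; nra.
have emh : 1 - h <= expR (- h) := expR_ge1Dx (- h).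
have emh1 : expR (- h) < 1 by rewrite expR_lt1 oppr_lt0.
have eph : expR (p * h) <= 1 + 10 * h.
  have ph0 : 0 <= p * h by rewrite mulr_ge0// ltW.
  have := @expR_le_quadratic R (p * h); rewrite ger0_norm// => H.
  have ph : p * h <= 2 * h by rewrite ler_pM2r.
  have ph2 : (p * h) ^+ 2 <= (2 * h) ^+ 2 by rewrite lerXn2r ?nnegrE// mulr_ge0// ltW.
  have hh : h ^+ 2 <= h * 2^-1 by rewrite expr2 ler_pM2l.
  apply: le_trans (H _) _; first lra.
  move: ph2; rewrite exprMn; lra.
exists (z * expR (- h)), (z * expR (h / 2)), (z * expR h), p.
have gE : g / 2 <= gap (z * expR (- h)) (z * expR h) p.
  have gX : gap (z * expR (- h)) (z * expR h) p =
     2 * (z * expR (- h)) - 1 - (2 * (X * expR (p * h)) - 1) / p.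
    by rewrite /gap lnM ?posrE ?expR_gt0// expRK mulrDr expRD XE.
  have zh : z * (1 - h) <= z * expR (- h) by rewrite ler_pM2l.
  have Xh : (2 * (X * expR (p * h)) - 1) / p <= (2 * X - 1) / p + 20 * (h * X).
    have -> : (2 * X - 1) / p + 20 * (h * X) = (2 * X - 1 + p * (20 * (h * X))) / p.
      by field; rewrite gt_eqF.
    rewrite ler_pM2r ?invr_gt0//.
    have h1 := ler_wpM2l (ltW X0) eph.
    have h2 : 20 * (h * X) <= p * (20 * (h * X)) by rewrite ler_peMl// !mulr_ge0// ltW.
    move: h1 h2; move: (X * expR _) => Y; lra.
  rewrite gX; move: Xh zh hX gg.
  by move: (_ / p) (_ / p) (h * X) (z * expR _) => a b e1 e2; clear; lra.
have hE2 : expR (h / 2) < expR h by rewrite ltr_expR; lra.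
have hE1 : 1 < expR (h / 2) by rewrite expR_gt1 divr_gt0.
split=> //.
- split.
  + by rewrite mulr_gt0 ?expR_gt0.
  + by rewrite xE ltr_pM2l// gtr_pMr.
  + by rewrite xE ltr_pM2l// ltr_pMr.
  + by rewrite ltr_pM2l.
- by apply: lt_le_trans gE; rewrite divr_gt0.
have zz : z * expR h - z * expR (- h) <= 3 * (h * z).
  have a1 := ler_wpM2l (ltW z0) eh; have a2 := ler_wpM2l (ltW z0) emh.
  move: a1 a2; move: (z * expR _) (z * expR _) => a b; lra.
move: gE hz zz; move: (gap _ _ _) (_ - _) => a b; lra.
Qed.

End GapExponent.

(** * Compact subsets of the interval *)
Section Cover.
Context (R : realType) (d : measure_display) (Omega : measurableType d)
  (P : probability Omega R) (T : nat -> Omega -> {fset word})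
  (D : nat -> Omega -> word) (hTD : BST_process P T D).
Context (c' c : R) (c'_ge0 : 0 <= c') (eta2_c' : eta2 c' = 1) (eta2_c : eta2 c = 1).

Lemma ae_profile_converges_segment (a b : R) : c' < a -> b < c ->
  {ae P, forall w, profile_converges P T `[a, b] w}.
Proof.
move=> ca bc.
have loc (x : R) : exists U : set R, [/\ open U, c' < x < c -> U x &
    {ae P, forall w, profile_converges P T U w}].
  have [/andP[cx xc]|nx] := boolP (c' < x < c); last first.
    exists set0; split=> //.
    by apply: aeW => w eps eps0; exists 0%N => // n _ k.
  have [zm [z1 [zp [p [[zm0 zmx xz1 z1p] p1 p2 g0 hg]]]]] :=
    gap_parameters c'_ge0 eta2_c' eta2_c cx xc.
  exists `]2 * zm, 2 * z1[%classic; split.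
  - exact: interval_open.
  - by move=> _; rewrite /= in_itv /= zmx xz1.
  have zm1 : zm <= z1 by move: zmx xz1; lra.
  have := ae_profile_converges_local hTD zm0 zm1 z1p p1 p2 g0 hg.
  apply: filterS => w hw eps eps0; have := hw eps eps0.
  apply: filterS => n hn k; rewrite /= in_itv /= => /andP[k1 k2]; apply: hn.
  by rewrite /= in_itv /= !ltW.
have [U hU] := choice loc.
have := @segment_compact R a b; rewrite compact_cover.
move=> /(_ R setT U)[x _||F _ hF]; first by have [] := hU x.
  move=> x; rewrite /= in_itv /= => /andP[ax xb]; exists x => //.
  by have [_ + _] := hU x; apply; rewrite (lt_le_trans ca)// (le_lt_trans xb).
have aF : {ae P, forall w, forall x, x \in F -> profile_converges P T (U x) w}.
  suff : almost_everywhere P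
      (\bigcap_(x in [set` F]) [set w | profile_converges P T (U x) w]).
    by apply: filterS => w hw x; exact: hw.
  by apply: filter_bigI => x _; have [] := hU x.
apply: filterS aF => w hw eps eps0.
have nF : \forall n \near \oo, forall x, x \in F ->
    forall k, U x (k%:R / ln n%:R) -> profile_error P T k n w <= eps.
  suff : nbhs \oo (\bigcap_(x in [set` F]) [set n | forall k : nat,
      U x (k%:R / ln n%:R) -> profile_error P T k n w <= eps]).
    by apply: filterS => n hn x; exact: hn.
  by apply: filter_bigI => x xF; exact: hw.
apply: filterS nF => n hn k /hF[x xF]; exact: hn.
Qed.

End Cover.

Theorem theorem4p1 (R : realType) (d : measure_display)
    (Omega : measurableType d) (P : probability Omega R)
    (T : nat -> Omega -> {fset word}) (D : nat -> Omega -> word)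
    (hTD : BST_process P T D)
    (c' c : R) (c'_ge0 : 0 <= c') (c'_lt_c : c' < c)
    (eta2_c' : eta2 c' = 1) (eta2_c : eta2 c = 1) :
  {ae P, forall w : Omega, forall K : set R,
    compact K -> K `<=` `]c', c[ ->
    sup [set `| profile R T k n w / fine ('E_P[profile R T k n])%E
                - BST_limit T (k%:R / (2 * ln n%:R)) w |
        | k in [set k : nat | (1 <= k)%N /\ K (k%:R / ln n%:R)]]
      @[n --> \oo] --> (0 : R)}.
Proof.
have seg (i : nat) : {ae P, forall w, profile_converges P T `[c' + i.+1%:R^-1, c - i.+1%:R^-1] w}.
  apply: (ae_profile_converges_segment hTD c'_ge0 eta2_c' eta2_c).
    by rewrite ltrDl invr_gt0.
  by rewrite gtrBl invr_gt0.
have /ae_foralln := seg; apply: filterS => w hw K cK Kc.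
have [->|K0] := eqVneq K set0.
  rewrite (_ : (fun n => _) = (fun=> 0)); first exact: cvg_cst.
  apply/funext => n; rewrite (_ : [set _ | _ in _] = set0) ?sup0//.
  by apply/seteqP; split=> // x [k [_ []]].
have K_ne : K !=set0 by exact/set0P.
have cid (f : R -> R) : continuous f -> {within K, continuous f} by exact: continuous_subspaceT.
have [M MK hM] := compact_EVT_max K_ne cK (cid id (fun x => cvg_id)).
have copp : continuous (-%R : R -> R) by move=> x; exact: opp_continuous.
have [m mK hm] := compact_EVT_max K_ne cK (cid -%R copp).
rewrite !inE in MK mK.
have := Kc _ MK; rewrite /= in_itv /= => /andP[_ Mc].
have := Kc _ mK; rewrite /= in_itv /= => /andP[cm _].
pose e := Num.min (m - c') (c - M).
have e0 : 0 < e by rewrite lt_min !subr_gt0 cm.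
have [i hi] : exists i : nat, i.+1%:R^-1 <= e.
  exists (Num.truncn e^-1); rewrite -[leRHS]invrK lef_pV2 ?posrE ?invr_gt0//.
  by rewrite ltW// truncnS_gt.
have Ki x : K x -> (c' + i.+1%:R^-1 <= x <= c - i.+1%:R^-1).
  move=> Kx; have := hM x; rewrite inE => /(_ Kx) xM.
  have := hm x; rewrite inE => /(_ Kx); rewrite lerN2 => mx.
  move: hi; rewrite le_min => /andP[i1 i2].
  by apply/andP; split; move: i1 i2 xM mx; move: (_^-1) => t; lra.
apply/cvgrPdist_le => eps eps0; have := hw i eps eps0; apply: filterS => n hn.
rewrite sub0r normrN; set A := [set _ | _ in _].
have [A0|A0] := eqVneq A set0; first by rewrite A0 sup0 normr0 ltW.
have {}A0 : A !=set0 by exact/set0P.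
have hA x : A x -> 0 <= x <= eps.
  move=> [k [_ Kk] <-]; rewrite normr_ge0 /=; apply: (hn k).
  by rewrite /= in_itv /= Ki.
have supA : sup A <= eps by apply: ge_sup => // x /hA/andP[].
rewrite ger0_norm//; have [x Ax] := A0.
apply: le_trans (_ : x <= _); first by have /andP[] := hA x Ax.
by apply: ub_le_sup => //; exists eps => z /hA/andP[].
Qed.
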